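(* Let $d\ge3$ and $N\ge2$, let $\mathcal S^*$ be the set of $\Phi\in\mathcal S$ whose generators have pairwise distinct poles in $\mathbb R^d\cup\{\infty\}$, and let $\mathcal G_T^{\mathrm{fin}}$ be the set of $\Phi\in\mathcal S$ with $p_{\mathtt i}\ne p_{\mathtt j}$ for all $(\mathtt i,\mathtt j)\in Z$ with $\mathtt i,\mathtt j\in\mathcal I^*$. Then $$\mathcal G_T\subseteq\mathcal G_T^{\mathrm{fin}}\subseteq\mathcal S^*,$$ the set $\mathcal S^*$ is open in $(\mathcal S,d_2)$, and $\mathcal G_T^{\mathrm{fin}}$ is dense in $\mathcal S^*$. More precisely, let $\mathcal A=(0,\infty)\times\mathrm{SO}(d)\times\mathbb R^d$ and, for $\beta=(\lambda,O,v)\in\mathcal A$, let $A_\beta(x)=\lambda Ox+v$. Then for every $\Phi=(\varphi_i)_{i\in\mathcal I}\in\mathcal S^*$ there is a neighborhood $\mathcal N$ of the identity tuple, all of whose entries equal $(1,I,0)$, in $\mathcal A^N$ such that $\Phi^\alpha=(A_{\alpha_i}\circ\varphi_i)_{i\in\mathcal I}$ lies in $\mathcal S^*$ for every $\alpha=(\alpha_i)_{i\in\mathcal I}\in\mathcal N$, with $d_2(\Phi^\alpha,\Phi)\to0$ as $\alpha$ tends to the identity tuple, and the set of $\alpha\in\mathcal N$ with $\Phi^\alpha\notin\mathcal G_T^{\mathrm{fin}}$ has (Lebesgue) measure zero in every chart of $\mathcal A^N$.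
   Context: Let $d\ge3$. A domain is a nonempty connected open set. M\''obius transformations of $\mathbb R^d\cup\{\infty\}$ are finite compositions of similarities $x\mapsto\lambda Ox+b$ ($\lambda>0$, $O\in O(d)$) and inversions in spheres. Conformal maps of domains in $\mathbb R^d$ are (Liouville) restrictions of M\''obius transformations and are identified with them; the pole of a M\''obius transformation $f$ is $f^{-1}(\infty)$ (equal to $\infty$ exactly for similarities). Fix $\mathcal I=\{1,\dots,N\}$, a bounded domain $\Omega\subset\mathbb R^d$ and a domain $\Omega'$ with $\overline\Omega\subset\Omega'\subset\mathbb R^d$. $\mathcal S$ is the set of conformal iterated function systems on $\Omega$ with extension domain $\Omega'$: tuples $\Phi=(\varphi_i)_{i\in\mathcal I}$ of conformal maps $\varphi_i:\Omega'\to\mathbb R^d$ with $\varphi_i(\overline\Omega)\subset\Omega$ and $\|D\varphi_i\|<1$ (operator norm) on $\overline\Omega$. Its metric is $d_2(\Phi,\Psi)=\max_i(\|\varphi_i-\psi_i\|+\|D\varphi_i-D\psi_i\|+\|D^2\varphi_i-D^2\psi_i\|)$, norms being suprema over $\overline\Omega$ (of operator norms). For a finite word $\mathtt i=i_1\cdots i_n$ put $f_{\mathtt i}=\varphi_{i_n}\circ\cdots\circ\varphi_{i_1}$, $p_{\mathtt i}=f_{\mathtt i}^{-1}(\infty)\in\mathbb R^d\cup\{\infty\}$, and $T_{\mathtt i}=\nabla\log\|Df_{\mathtt i}\|$ on $\overline\Omega$; for an infinite word, $T_{\mathtt i}$ is the uniform limit on $\overline\Omega$ of $T_{\mathtt i|_n}$,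 with $\mathtt i|_n$ the length-$n$ prefix (the limit exists). With $\mathcal I^*$ the finite and $\mathcal I^{\mathbb N}$ the infinite words and $|\cdot|$ the length, $Z=\{(\mathtt i,\mathtt j)\in(\mathcal I^{\mathbb N}\cup\mathcal I^* )^2:|\mathtt i|=|\mathtt j|\ge1,\ i_1\ne j_1\}$ and $\mathcal G_T=\{\Phi\in\mathcal S:\inf_{(\mathtt i,\mathtt j)\in Z}\sup_{\overline\Omega}|T_{\mathtt i}-T_{\mathtt j}|>0\}$. *)

(* Defs.v *)
From HB Require Import structures.
From mathcomp Require Import all_boot all_order all_algebra.
From mathcomp Require Import all_classical all_reals all_analysis.

Set Implicit Arguments.
Unset Strict Implicit.
Unset Printing Implicit Defensive.

Import Order.TTheory GRing.Theory Num.Theory.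
Import numFieldNormedType.Exports.

Local Open Scope classical_set_scope.
Local Open Scope ring_scope.

(* R^d is 'rV[R]_d. The library's norm on it is the max norm; it is used only
   for notions that do not depend on the choice of a norm (topology,
   boundedness, differentials). Metric quantities use the Euclidean norm. *)
Definition enorm (R : realType) (d : nat) (x : 'rV[R]_d) : R :=
  Num.sqrt (\sum_(k < d) x 0 k ^+ 2).

Definition domain (R : realType) (d : nat) (U : set 'rV[R]_d) : Prop :=
  [/\ U !=set0, open U & connected U].

Definition opnorm (R : realType) (d : nat) (L : 'rV[R]_d -> 'rV[R]_d) : R :=
  sup [set enorm (L u) | u in [set u | enorm u <= 1]].

Definition opnorm2 (R : realType) (d : nat)
    (B : 'rV[R]_d -> 'rV[R]_d -> 'rV[R]_d) : R :=
  sup [set enorm (B u v) | u in [set u | enorm u <= 1]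
                         & v in [set v | enorm v <= 1]].

(* The second derivative as a bilinear map: D^2 f (x) [u, v]. *)
Definition diff2 (R : realType) (d : nat) (f : 'rV[R]_d -> 'rV[R]_d)
    (x u v : 'rV[R]_d) : 'rV[R]_d :=
  'd (fun y => 'd f y v : 'rV[R]_d) x u.

Definition gradient (R : realType) (d : nat) (g : 'rV[R]_d -> R)
    (x : 'rV[R]_d) : 'rV[R]_d :=
  \row_k 'D_(delta_mx 0 k) g x.

(* R^d together with the point at infinity, which is None. *)
Definition hat (R : realType) (d : nat) : Type :=
  one_point_compactification 'rV[R]_d.

Definition orthogonal (R : realType) (d : nat) (O : 'M[R]_d) : Prop :=
  O *m O^T = 1%:M.

(* Vectors being rows, the image of x under the matrix O is x *m O^T. *)
Definition similarity (R : realType) (d : nat)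
    (l : R) (O : 'M[R]_d) (b : 'rV[R]_d) (z : hat R d) : hat R d :=
  if z is Some x then Some (l *: (x *m O^T) + b) else None.

Definition inversion (R : realType) (d : nat) (a : 'rV[R]_d) (r : R)
    (z : hat R d) : hat R d :=
  match z with
  | Some x => if x == a then None
              else Some (a + (r ^+ 2 / enorm (x - a) ^+ 2) *: (x - a))
  | None => Some a
  end.

Inductive moebius (R : realType) (d : nat) : (hat R d -> hat R d) -> Prop :=
| moebius_similarity (l : R) (O : 'M[R]_d) (b : 'rV[R]_d) :
    0 < l -> orthogonal O -> moebius (similarity l O b)
| moebius_inversion (a : 'rV[R]_d) (r : R) :
    0 < r -> moebius (inversion a r)
| moebius_comp (f g : hat R d -> hat R d) :
    moebius f -> moebius g -> moebius (f \o g).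

Definition pole (R : realType) (d : nat) (f : hat R d -> hat R d) : hat R d :=
  xget None [set z | f z = None].

(* f as a map of R^d; the value 0 at a finite pole is a dummy. *)
Definition fin (R : realType) (d : nat) (f : hat R d -> hat R d)
    (x : 'rV[R]_d) : 'rV[R]_d :=
  odflt 0 (f (Some x)).

(* The set S of conformal IFSs. A conformal map of Omega' is identified with
   the Moebius transformation of which it is the restriction, so it is such a
   transformation without pole in Omega'. The index set {1, .., N} is 'I_N. *)
Definition cifs (R : realType) (d N : nat) (Omega Omega' : set 'rV[R]_d) :
    set ('I_N -> hat R d -> hat R d) :=
  [set Phi | forall i : 'I_N,
    [/\ moebius (Phi i),
        forall x, Omega' x -> Phi i (Some x) <> None,
        forall x, closure Omega x ->
          exists2 y, Omega y & Phi i (Some x) = Some y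
      & forall x, closure Omega x -> opnorm ('d (fin (Phi i)) x) < 1]].

Definition supnorm (R : realType) (d : nat) (K : set 'rV[R]_d)
    (g : 'rV[R]_d -> R) : \bar R :=
  ereal_sup [set (g x)%:E | x in K].

Definition dist0 (R : realType) (d : nat) (K : set 'rV[R]_d)
    (f g : 'rV[R]_d -> 'rV[R]_d) : \bar R :=
  supnorm K (fun x => enorm (f x - g x)).

Definition dist1 (R : realType) (d : nat) (K : set 'rV[R]_d)
    (f g : 'rV[R]_d -> 'rV[R]_d) : \bar R :=
  supnorm K (fun x => opnorm (fun u => 'd f x u - 'd g x u)).

Definition dist2 (R : realType) (d : nat) (K : set 'rV[R]_d)
    (f g : 'rV[R]_d -> 'rV[R]_d) : \bar R :=
  supnorm K (fun x => opnorm2 (fun u v => diff2 f x u v - diff2 g x u v)).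

Definition d2 (R : realType) (d N : nat) (Omega : set 'rV[R]_d)
    (Phi Psi : 'I_N -> hat R d -> hat R d) : \bar R :=
  let K := closure Omega in
  \big[maxe/0%E]_(i < N)
    (dist0 K (fin (Phi i)) (fin (Psi i)) +
     dist1 K (fin (Phi i)) (fin (Psi i)) +
     dist2 K (fin (Phi i)) (fin (Psi i)))%E.

Inductive word (N : nat) : Type :=
| FinWord of seq 'I_N
| InfWord of (nat -> 'I_N).

(* None stands for infinite length. *)
Definition wlen (N : nat) (w : word N) : option nat :=
  match w with FinWord s => Some (size s) | InfWord _ => None end.

Definition wfirst (N : nat) (w : word N) : option 'I_N :=
  match w with FinWord s => ohead s | InfWord s => Some (s 0%N) end.

Definition Zpairs (N : nat) : set (word N * word N) :=
  [set w | [/\ wlen w.1 = wlen w.2, wlen w.1 <> Some 0%N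
             & wfirst w.1 <> wfirst w.2]].

(* The first letter acts first. *)
Definition fword (R : realType) (d N : nat)
    (Phi : 'I_N -> hat R d -> hat R d) (s : seq 'I_N) : hat R d -> hat R d :=
  foldl (fun f i => Phi i \o f) id s.

Definition Tfin (R : realType) (d N : nat)
    (Phi : 'I_N -> hat R d -> hat R d) (s : seq 'I_N) :
    'rV[R]_d -> 'rV[R]_d :=
  gradient (fun y => ln (opnorm ('d (fin (fword Phi s)) y))).

(* For an infinite word, a uniform limit over closure Omega; it is determined
   on closure Omega only. *)
Definition Tword (R : realType) (d N : nat) (Omega : set 'rV[R]_d)
    (Phi : 'I_N -> hat R d -> hat R d) (w : word N) : 'rV[R]_d -> 'rV[R]_d :=
  match w with
  | FinWord s => Tfin Phi s
  | InfWord s => xget (fun=> 0)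
      [set g | {uniform closure Omega,
                 (fun n : nat => Tfin Phi (mkseq s n)) @ \oo --> g}]
  end.

Definition GT (R : realType) (d N : nat) (Omega Omega' : set 'rV[R]_d) :
    set ('I_N -> hat R d -> hat R d) :=
  [set Phi | cifs Omega Omega' Phi /\
    (0 < ereal_inf
      [set dist0 (closure Omega) (Tword Omega Phi w.1) (Tword Omega Phi w.2)
      | w in @Zpairs N])%E].

Definition GTfin (R : realType) (d N : nat) (Omega Omega' : set 'rV[R]_d) :
    set ('I_N -> hat R d -> hat R d) :=
  [set Phi | cifs Omega Omega' Phi /\
    forall s t : seq 'I_N, Zpairs (FinWord s, FinWord t) ->
      pole (fword Phi s) <> pole (fword Phi t)].

Definition Sstar (R : realType) (d N : nat) (Omega Omega' : set 'rV[R]_d) :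
    set ('I_N -> hat R d -> hat R d) :=
  [set Phi | cifs Omega Omega' Phi /\
    forall i j : 'I_N, i <> j -> pole (Phi i) <> pole (Phi j)].

(* Triples (lambda, O, v); A = (0, oo) x SO(d) x R^d is a subset of this
   normed space. *)
Definition aff (R : realType) (d : nat) : Type :=
  (R * 'M[R]_d * 'rV[R]_d)%type.

Definition Aset (R : realType) (d : nat) : set (aff R d) :=
  [set b | [/\ 0 < b.1.1, orthogonal b.1.2 & \det b.1.2 = 1]].

(* N-tuples of triples, with the product topology. *)
Definition afftuple (R : realType) (d N : nat) : Type :=
  {ptws 'I_N -> (R * 'M[R]_d * 'rV[R]_d)%type}.

Definition AsetN (R : realType) (d N : nat) : set (afftuple R d N) :=
  [set alpha | forall i, @Aset R d (alpha i)].

Definition idtuple (R : realType) (d N : nat) : afftuple R d N :=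
  fun=> (1, 1%:M, 0).

(* The neighborhoods, in A^N, of the identity tuple. *)
Definition nbhs_id (R : realType) (d N : nat) : set_system (afftuple R d N) :=
  within (@AsetN R d N) (nbhs (@idtuple R d N)).

Definition perturb (R : realType) (d N : nat) (alpha : afftuple R d N)
    (Phi : 'I_N -> hat R d -> hat R d) : 'I_N -> hat R d -> hat R d :=
  fun i => similarity (alpha i).1.1 (alpha i).1.2 (alpha i).2 \o Phi i.

(* f is of class C^k on the open set V. *)
Fixpoint classC (R : realType) (m : nat) (W : normedModType R) (k : nat)
    (V : set 'rV[R]_m) (f : 'rV[R]_m -> W) : Prop :=
  match k with
  | 0 => forall x, V x -> {for x, continuous f}
  | k'.+1 => (forall x, V x -> differentiable f x) /\
             (forall v, classC k' V (fun x => 'd f x v : W))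
  end.

(* dim A^N = N * (1 + d (d - 1) / 2 + d) *)
Definition dimAN (d N : nat) : nat := (N * (1 + 'C(d, 2) + d))%N.

(* The smooth charts of A^N as a submanifold of the space of N-tuples of
   triples. A chart is represented by its inverse psi: a smooth immersion that
   is a homeomorphism of an open set V of Euclidean space onto an open subset
   of A^N. *)
Definition is_chart (R : realType) (d N : nat) (V : set 'rV[R]_(dimAN d N))
    (psi : 'rV[R]_(dimAN d N) -> afftuple R d N) : Prop :=
  [/\ open V,
      set_inj V psi,
      forall V' : set 'rV[R]_(dimAN d N), open V' -> V' `<=` V ->
        exists2 W : set (afftuple R d N), open W &
          psi @` V' = @AsetN R d N `&` W,
      forall (k : nat) (i : 'I_N),
        classC k V (fun x => psi x i : (R * 'M[R]_d * 'rV[R]_d)%type)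
    & forall x u, V x ->
        (forall i : 'I_N,
           'd (fun y => psi y i : (R * 'M[R]_d * 'rV[R]_d)%type) x u = 0) ->
        u = 0].

Definition box (R : realType) (m : nat) (a b : 'rV[R]_m) : set 'rV[R]_m :=
  [set x | forall i, a 0 i <= x 0 i <= b 0 i].

Definition lebesgue_outer (R : realType) (m : nat) (E : set 'rV[R]_m) :
    \bar R :=
  ereal_inf [set s | exists a b : nat -> 'rV[R]_m,
    [/\ forall k i, a k 0 i <= b k 0 i,
        E `<=` \bigcup_k box (a k) (b k)
      & s = (\sum_(0 <= k <oo) (\prod_(i < m) (b k 0 i - a k 0 i))%:E)%E]].

Definition null_in_charts (R : realType) (d N : nat)
    (E : set (afftuple R d N)) : Prop :=
  forall V psi, is_chart V psi -> lebesgue_outer (V `&` psi @^-1` E) = 0%E.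

(* Main.v *)
Require Import Defs.
From HB Require Import structures.
From mathcomp Require Import all_boot all_order all_algebra.
From mathcomp Require Import all_classical all_reals all_analysis.
From mathcomp Require Import ring lra.

(* The pole of a word satisfies pole(i s) = g_i^{-1}(pole(s)), where g_i is the
   perturbed generator and the empty word has its pole at infinity. In the
   light cone model of the conformal sphere, g_i^{-1} lifts to a map that is
   polynomial in the parameters (lambda, O, v), so that a coincidence of the
   poles of two words is the vanishing of a polynomial in the parameters. This
   polynomial is not identically zero in the translation parts v, whatever
   (lambda, O) are: choosing the v_i such that all g_i send infinity to a common
   point c far away (or fix c, for the at most one generator which is a
   similarity), the maps g_i^{-1} send the exterior of a large ball around c
   into disjoint subsets of it, and ping-pong separates all poles. Hence at each
   bad parameter some iterated translation derivative of the polynomial vanishes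
   while its gradient along a translation does not, and translations are tangent
   to the parameter manifold, so that in any chart the bad set is a countable
   union of pieces of regular level sets of C^1 functions.

   The gradient of log ||Df|| depends only on the pole of f, and is determined
   by Df and D^2 f at a single point: this gives the first inclusion, and
   openness. *)

Set Implicit Arguments.
Unset Strict Implicit.
Unset Printing Implicit Defensive.

Import Order.TTheory GRing.Theory Num.Theory.
Import numFieldNormedType.Exports.

Local Open Scope classical_set_scope.
Local Open Scope ring_scope.

(** * Euclidean inner product *)

(** The parameter set A^N is curved, and the charts are known only as immersions that are
    homeomorphisms onto open subsets of A^N. The obstacle is to get transversality without computing
    tangent spaces of SO(d). Adding t w to the vectors v_i never leaves A^N, so a polynomial can be
    restricted to straight lines inside A^N, where it is univariate. Ping-pong keeps ratios and
    rotations and moves only the v_i, so it shows that such a line through a bad parameter carries a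
    nonzero polynomial, some Taylor coefficient of which survives. The contraction of the generators
    enters there: a generator that is a similarity needs a ratio below 1 for its region near
    infinity to stay apart from the regions of the finite poles. Regular level sets are covered by
    boxes by hand, through a Lipschitz cone condition in place of the implicit function theorem.
    Density does not go through charts: on one line through the identity tuple, countably many
    nonzero polynomials have a common non-root arbitrarily close to 0. *)

Lemma eqr_le (R : numDomainType) (x y : R) : x = y -> x <= y.
Proof. by move=> ->. Qed.

Section Dot.
Variables (R : realType) (d : nat).
Implicit Types (u v w x y : 'rV[R]_d) (a c : R) (O : 'M[R]_d).

Definition dot u v : R := (u *m v^T) 0 0.

Lemma dotE u v : dot u v = \sum_k u 0 k * v 0 k.
Proof. by rewrite /dot mxE; apply: eq_bigr => k _; rewrite mxE. Qed.

Lemma dotC u v : dot u v = dot v u.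
Proof. by rewrite !dotE; apply: eq_bigr => k _; rewrite mulrC. Qed.

Lemma dotDl u v w : dot (u + v) w = dot u w + dot v w.
Proof. by rewrite /dot mulmxDl mxE. Qed.

Lemma dotDr u v w : dot u (v + w) = dot u v + dot u w.
Proof. by rewrite dotC dotDl !(dotC u). Qed.

Lemma dotZl a u v : dot (a *: u) v = a * dot u v.
Proof. by rewrite /dot -scalemxAl mxE. Qed.

Lemma dotZr a u v : dot u (a *: v) = a * dot u v.
Proof. by rewrite dotC dotZl dotC. Qed.

Lemma dotNl u v : dot (- u) v = - dot u v.
Proof. by rewrite -scaleN1r dotZl mulN1r. Qed.

Lemma dotNr u v : dot u (- v) = - dot u v.
Proof. by rewrite dotC dotNl dotC. Qed.

Lemma dotBl u v w : dot (u - v) w = dot u w - dot v w.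
Proof. by rewrite dotDl dotNl. Qed.

Lemma dotBr u v w : dot u (v - w) = dot u v - dot u w.
Proof. by rewrite dotDr dotNr. Qed.

Lemma dot0l u : dot 0 u = 0.
Proof. by rewrite -(scale0r 0) dotZl mul0r. Qed.

Lemma dot0r u : dot u 0 = 0.
Proof. by rewrite dotC dot0l. Qed.

Definition dot_lin := (dotDl, dotDr, dotBl, dotBr, dotNl, dotNr, dotZl, dotZr).

Lemma dot_ge0 u : 0 <= dot u u.
Proof. by rewrite dotE sumr_ge0 // => k _; rewrite -expr2 sqr_ge0. Qed.

Lemma dot_eq0 u : (dot u u == 0) = (u == 0).
Proof.
apply/eqP/eqP => [|->]; last by rewrite dot0l.
rewrite dotE => /eqP; rewrite psumr_eq0 => [/allP u0|k _]; last first.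
  by rewrite -expr2 sqr_ge0.
apply/rowP => k; rewrite mxE; apply/eqP.
by have := u0 k; rewrite mem_index_enum mulf_eq0 orbb; apply.
Qed.

Lemma dot_gt0 u : (0 < dot u u) = (u != 0).
Proof. by rewrite lt_def dot_ge0 dot_eq0 andbT. Qed.

Lemma dot_mulmx u v O : dot (u *m O) v = dot u (v *m O^T).
Proof. by rewrite /dot trmx_mul trmxK mulmxA. Qed.

Lemma orthogonalK O : Defs.orthogonal O -> O^T *m O = 1%:M.
Proof. exact: mulmx1C. Qed.

Lemma dot_orth u v O : Defs.orthogonal O -> dot (u *m O^T) (v *m O^T) = dot u v.
Proof.
by move=> hO; rewrite dot_mulmx trmxK -mulmxA (orthogonalK hO) mulmx1.
Qed.

Lemma enormE u : enorm u = Num.sqrt (dot u u).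
Proof. by rewrite /enorm dotE; under eq_bigr do rewrite expr2. Qed.

Lemma enorm_ge0 u : 0 <= enorm u.
Proof. exact: sqrtr_ge0. Qed.

Lemma sqr_enorm u : enorm u ^+ 2 = dot u u.
Proof. by rewrite enormE sqr_sqrtr // dot_ge0. Qed.

Lemma enorm_eq0 u : (enorm u == 0) = (u == 0).
Proof. by rewrite -sqrf_eq0 sqr_enorm dot_eq0. Qed.

Lemma enorm_gt0 u : (0 < enorm u) = (u != 0).
Proof. by rewrite lt_def enorm_ge0 enorm_eq0 andbT. Qed.

Lemma enorm0 : enorm (0 : 'rV[R]_d) = 0.
Proof. by apply/eqP; rewrite enorm_eq0. Qed.

Lemma enormZ a u : enorm (a *: u) = `|a| * enorm u.
Proof. by rewrite !enormE !dot_lin mulrA -expr2 sqrtrM ?sqr_ge0 // sqrtr_sqr. Qed.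

Lemma enormN u : enorm (- u) = enorm u.
Proof. by rewrite !enormE !dot_lin opprK. Qed.

Lemma enormBC u v : enorm (u - v) = enorm (v - u).
Proof. by rewrite -enormN opprB. Qed.

Lemma enorm_orth u O : Defs.orthogonal O -> enorm (u *m O^T) = enorm u.
Proof. by move=> hO; rewrite !enormE dot_orth. Qed.

(** Cauchy-Schwarz, from the nonnegative square of |v|^2 u - <u,v> v. *)
Lemma ler_dot_enorm u v : `|dot u v| <= enorm u * enorm v.
Proof.
rewrite -(@ler_pXn2r _ 2) ?nnegrE ?mulr_ge0 ?enorm_ge0 //.
rewrite exprMn !sqr_enorm real_normK ?num_real //.
have [->|v0] := eqVneq v 0; first by rewrite !dot0r expr0n mulr0.
have v_gt0 : 0 < dot v v by rewrite dot_gt0.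
have := dot_ge0 (dot v v *: u - dot u v *: v).
have -> : dot (dot v v *: u - dot u v *: v) (dot v v *: u - dot u v *: v) =
    dot v v * (dot u u * dot v v - dot u v ^+ 2).
  by rewrite !dot_lin (dotC v u); ring.
by rewrite pmulr_rge0 // subr_ge0.
Qed.

Lemma ler_enormD u v : enorm (u + v) <= enorm u + enorm v.
Proof.
rewrite -(@ler_pXn2r _ 2) ?nnegrE ?addr_ge0 ?enorm_ge0 //.
rewrite sqr_enorm !dot_lin (dotC v u).
have := ler_dot_enorm u v; rewrite ler_norml => /andP[_ h].
by have := sqr_enorm u; have := sqr_enorm v; nra.
Qed.

Lemma ler_enormB u v : enorm (u - v) <= enorm u + enorm v.
Proof. by rewrite -(enormN v) ler_enormD. Qed.

Lemma ler_enorm_dist u v : enorm u - enorm v <= enorm (u - v).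
Proof. by rewrite lerBlDr -{1}(subrK v u) ler_enormD. Qed.

Lemma ler_coord_enorm u k : `|u 0 k| <= enorm u.
Proof.
rewrite -(@ler_pXn2r _ 2) ?nnegrE ?enorm_ge0 //.
rewrite sqr_enorm real_normK ?num_real // dotE (bigD1 k) //= -expr2 lerDl.
by rewrite sumr_ge0 // => j _; rewrite -expr2 sqr_ge0.
Qed.

Lemma enorm_delta k : enorm (delta_mx 0 k : 'rV[R]_d) = 1.
Proof.
rewrite enormE dotE (bigD1 k) //= big1 => [|j jk].
  by rewrite !mxE !eqxx mulr1 addr0 sqrtr1.
by rewrite !mxE (negbTE jk) mulr0.
Qed.

Lemma dot_delta u k : dot u (delta_mx 0 k) = u 0 k.
Proof.
rewrite dotE (bigD1 k) //= big1 => [|j jk].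
  by rewrite !mxE !eqxx mulr1 addr0.
by rewrite !mxE (negbTE jk) mulr0.
Qed.

(** Together with the reverse bound up to sqrt d below, this passes between the max norm behind the
    topology and the Euclidean norm. *)
Lemma ler_norm_enorm u : `|u| <= enorm u.
Proof.
rewrite [leLHS]/Num.Def.normr /= mx_normrE; apply/bigmax_leP; split.
  exact: enorm_ge0.
by move=> [i j] _ /=; rewrite ord1 ler_coord_enorm.
Qed.

Lemma ler_coord_norm u k : `|u 0 k| <= `|u|.
Proof.
rewrite [leRHS]/Num.Def.normr /= mx_normrE.
by rewrite (le_trans _ (le_bigmax _ _ (0, k))).
Qed.

Lemma ler_enorm_norm u : enorm u <= Num.sqrt d%:R * `|u|.
Proof.
rewrite -[X in _ <= _ * X]normr_id -sqrtr_sqr -sqrtrM ?ler0n // ler_wsqrtr //.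
rewrite mulr_natl -[X in _ *+ X](card_ord d) -sumr_const ler_sum // => k _.
by rewrite -real_normK ?num_real // lerXn2r ?nnegrE ?normr_ge0 // ler_coord_norm.
Qed.

End Dot.

(** * Normal form of Moebius transformations *)

Section NormalForm.
Variables (R : realType) (d : nat).
Implicit Types (x y q a b e : 'rV[R]_d) (l : R) (O : 'M[R]_d).
Local Notation hat := (hat R d).

Lemma orthogonal1 : Defs.orthogonal (1%:M : 'M[R]_d).
Proof. by rewrite /Defs.orthogonal trmx1 mulmx1. Qed.

Lemma orthogonalM O1 O2 : Defs.orthogonal O1 -> Defs.orthogonal O2 ->
  Defs.orthogonal (O1 *m O2).
Proof.
move=> h1 h2; rewrite /Defs.orthogonal trmx_mul mulmxA -(mulmxA O1).
by rewrite (h2 : _ = _) mulmx1.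
Qed.

Definition reflection e : 'M[R]_d := 1%:M - (2 / dot e e) *: (e^T *m e).

Lemma trmx_reflection e : (reflection e)^T = reflection e.
Proof. by rewrite /reflection linearB /= trmx1 linearZ /= trmx_mul trmxK. Qed.

Lemma mulmx_reflection e x :
  x *m reflection e = x - (2 * dot x e / dot e e) *: e.
Proof.
rewrite mulmxBr mulmx1 -scalemxAr mulmxA [x *m e^T]mx11_scalar mul_scalar_mx.
by rewrite scalerA -/(dot x e) mulrAC.
Qed.

Lemma orthogonal_reflection e : e != 0 -> Defs.orthogonal (reflection e).
Proof.
rewrite -dot_eq0 => e0; rewrite /Defs.orthogonal trmx_reflection.
apply/row_matrixP => i; rewrite row1 rowE mulmxA !mulmx_reflection !dot_lin.
rewrite -addrA -opprD -scalerDl [X in X *: e](_ : _ = 0) ?scale0r ?subr0 //.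
by field.
Qed.

Lemma similarity_comp l1 O1 b1 l2 O2 b2 :
  similarity l1 O1 b1 \o similarity l2 O2 b2 =
  similarity (l1 * l2) (O1 *m O2) (l1 *: (b2 *m O1^T) + b1).
Proof.
apply/funext => -[x|//] /=; congr Some.
by rewrite mulmxDl -scalemxAl scalerDr scalerA trmx_mul mulmxA addrA.
Qed.

Lemma similarity1 : similarity 1 1%:M 0 = id :> (hat -> hat).
Proof. by apply/funext => -[x|//] /=; rewrite trmx1 mulmx1 scale1r addr0. Qed.

(** The factor r^2 is absorbed by a similarity fixing the centre, so that normal forms contain only
    unit inversions. *)
Lemma inversion_radius a (r : R) :
  inversion a r =
  similarity (r ^+ 2) 1%:M (a - r ^+ 2 *: a) \o inversion a 1.
Proof.
apply/funext => -[x|] /=.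
  case: ifP => //= _; congr Some.
  by rewrite trmx1 mulmx1 expr1n; apply/rowP => k; rewrite !mxE; ring.
by congr Some; rewrite trmx1 mulmx1 addrC subrK.
Qed.

Lemma inversionK q : inversion q 1 \o inversion q 1 = id :> (hat -> hat).
Proof.
apply/funext => -[x|] /=; last by rewrite eqxx.
case: eqP => [->//|/eqP]; rewrite -subr_eq0 => xq /=.
have x0 : dot (x - q) (x - q) != 0 by rewrite dot_eq0.
rewrite expr1n addrAC subrr add0r.
rewrite addrC -subr_eq0 addrK scaler_eq0 mulf_eq0 invr_eq0 !(negbTE xq).
rewrite oner_eq0 sqr_enorm (negbTE x0) /=; congr Some.
have -> : x = q + (x - q) by rewrite addrC subrK.
move: (x - q) xq x0 => w xq w0; rewrite addrAC subrr add0r.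
by rewrite sqr_enorm !dot_lin; apply/rowP => k; rewrite !mxE; field.
Qed.

(** An inversion turns dilation by l into dilation by 1/l; q' is the preimage of the centre q under
    the similarity. This moves inversions to the right of similarities. *)
Lemma inversion_similarity q l O b : 0 < l -> Defs.orthogonal O ->
  let q' := l^-1 *: ((q - b) *m O) in
  inversion q 1 \o similarity l O b =
  similarity l^-1 O (q - l^-1 *: (q' *m O^T)) \o inversion q' 1.
Proof.
move=> l0 hO q'; have l_neq0 : l != 0 by rewrite gt_eqF.
have q'E : l *: (q' *m O^T) + b = q.
  rewrite /q' -scalemxAl scalerA divff // scale1r -mulmxA (hO : _ = _).
  by rewrite mulmx1 subrK.
clearbody q'; apply/funext => -[x|] /=; last by congr Some; rewrite addrC subrK.
have E : l *: (x *m O^T) + b - q = l *: ((x - q') *m O^T).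
  by rewrite -{1}q'E opprD addrACA subrr addr0 -scalerBr -mulmxBl.
have -> : (l *: (x *m O^T) + b == q) = (x == q').
  rewrite -subr_eq0 E scaler_eq0 (negbTE l_neq0) /= -enorm_eq0 enorm_orth //.
  by rewrite enorm_eq0 subr_eq0.
case: eqP => //= /eqP; rewrite -subr_eq0 => xq; congr Some.
have x0 : enorm (x - q') != 0 by rewrite enorm_eq0.
rewrite E enormZ enorm_orth // (gtr0_norm l0) [(q' + _) *m _]mulmxDl -scalemxAl.
move: (q' *m O^T) ((x - q') *m O^T) => y z.
by apply/rowP => k; rewrite !mxE; field; rewrite l_neq0 x0.
Qed.

(* With e = a - q, the composition of the two inversions has its pole at
   q + e/|e|^2, the image of a, and reflects in the hyperplane orthogonal to e *)
Lemma inversion_comp a q : a != q ->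
  let e := a - q in let q' := q + (dot e e)^-1 *: e in
  inversion a 1 \o inversion q 1 =
  similarity (dot e e)^-1 (reflection e)
    (a - (dot e e)^-1 *: e - (dot e e)^-1 *: (q' *m reflection e))
  \o inversion q' 1.
Proof.
rewrite -subr_eq0 => e0 e q'; rewrite -/e in e0.
have n0 : dot e e != 0 by rewrite dot_eq0.
have aE : a = q + e by rewrite /e addrC subrK.
have qq' : q' - q = (dot e e)^-1 *: e by rewrite /q' addrAC subrr add0r.
clearbody q' e.
have S y : (dot e e)^-1 *: (y *m (reflection e)^T) +
   (a - (dot e e)^-1 *: e - (dot e e)^-1 *: (q' *m reflection e)) =
   a + (dot e e)^-1 *: ((y - q') *m reflection e - e).
  rewrite trmx_reflection mulmxBl.
  move: (y *m _) (q' *m _) => Y Y'.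
  by apply/rowP => k; rewrite !mxE; ring.
have qaE : q - a = - e by rewrite aE opprD addrA subrr add0r.
apply/funext => -[x|] /=; last first.
  rewrite S subrr mul0mx sub0r -subr_eq0 qaE oppr_eq0 (negbTE e0).
  by rewrite enormN sqr_enorm expr1n mul1r.
case: eqP => [->|/eqP] /=.
  rewrite -subr_eq0 -opprB oppr_eq0 qq' scaler_eq0 invr_eq0 (negbTE n0).
  rewrite (negbTE e0) /= S; congr Some; rewrite -[LHS]addr0; congr (_ + _).
  rewrite addrAC subrr add0r -scalerN sqr_enorm mulmx_reflection !dot_lin.
  by apply/rowP => k; rewrite !mxE; field.
rewrite -subr_eq0 => xq /=.
have xE : x - q' = x - q - (dot e e)^-1 *: e.
  by rewrite -qq' opprB addrA subrK.
have xaE c : q + c *: (x - q) - a = c *: (x - q) - e.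
  by rewrite aE opprD addrACA subrr add0r.
rewrite -subr_eq0 xaE -(subr_eq0 x q') xE expr1n mul1r sqr_enorm.
move: (x - q) xq => w xq {xE xaE}.
have w0 : dot w w != 0 by rewrite dot_eq0.
have E2 : dot ((dot w w)^-1 *: w - e) ((dot w w)^-1 *: w - e) =
   dot (w - (dot e e)^-1 *: e) (w - (dot e e)^-1 *: e) * dot e e / dot w w.
  by rewrite !dot_lin (dotC e w); field; rewrite n0 w0.
have -> : ((dot w w)^-1 *: w - e == 0) = (w - (dot e e)^-1 *: e == 0).
  rewrite -dot_eq0 E2 !mulf_eq0 invr_eq0 (negbTE n0) (negbTE w0) !orbF dot_eq0.
  by [].
case: eqP => //= /eqP w'0; congr Some; rewrite S {S}.
have -> : q' + (1 / enorm (w - (dot e e)^-1 *: e) ^+ 2) *: (w - (dot e e)^-1 *: e) - q'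
   = (enorm (w - (dot e e)^-1 *: e) ^+ 2)^-1 *: (w - (dot e e)^-1 *: e).
  by rewrite addrAC subrr add0r mul1r.
have wE : w = (w - (dot e e)^-1 *: e) + (dot e e)^-1 *: e by rewrite subrK.
rewrite !sqr_enorm E2; move: (w - _) wE w'0 => w' wE; rewrite -dot_eq0 => w'0.
rewrite mulmx_reflection !dot_lin (wE : w = _).
have : dot w w = dot w' w' + 2 * dot w' e / dot e e + (dot e e)^-1.
  by rewrite wE !dot_lin (dotC e w'); field.
rewrite wE => nw; rewrite wE in w0; congr (_ + _).
move: nw w0; move: (dot (w' + _) _) => n -> {}w0.
apply/rowP => k; rewrite !mxE; field.
rewrite w'0 n0 /=; apply: contra_neq w0 => h.
rewrite -[LHS](mulfK n0); apply/eqP; rewrite mulf_eq0 invr_eq0 (negbTE n0) orbF.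
by rewrite -h; apply/eqP; field.
Qed.

(** Every Moebius map has one of these two forms, and the form displays its pole: infinity in the
    first case, q in the second. Derivatives and poles are computed by cases on it. *)
Variant nform : (hat -> hat) -> Prop :=
| nform_similarity l O b : 0 < l -> Defs.orthogonal O ->
    nform (similarity l O b)
| nform_inversion l O b q : 0 < l -> Defs.orthogonal O ->
    nform (similarity l O b \o inversion q 1).

Lemma nform_comp_similarity l O b f : 0 < l -> Defs.orthogonal O ->
  nform f -> nform (similarity l O b \o f).
Proof.
move=> l0 hO [l' O' b' l'0 hO'|l' O' b' q l'0 hO'].
  by rewrite similarity_comp; left; [exact: mulr_gt0|exact: orthogonalM].
rewrite compA similarity_comp.
by right; [exact: mulr_gt0|exact: orthogonalM].
Qed.

Lemma nform_comp f g : nform f -> nform g -> nform (f \o g).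
Proof.
move=> [l O b l0 hO|l O b a l0 hO] ng; first exact: nform_comp_similarity.
rewrite -compA; apply: nform_comp_similarity => //.
case: ng => [l' O' b' l'0 hO'|l' O' b' q l'0 hO'].
  by rewrite inversion_similarity //; right; rewrite ?invr_gt0.
rewrite compA inversion_similarity // -compA.
apply: nform_comp_similarity; rewrite ?invr_gt0 //.
(* Two unit inversions with the same centre cancel; with distinct centres they collapse to a
   similarity after a single inversion. *)
set a' := _ *: _; have [->|aq] := eqVneq a' q.
  by rewrite inversionK -similarity1; left; [exact: ltr01|exact: orthogonal1].
rewrite inversion_comp //; right; last by apply: orthogonal_reflection; rewrite subr_eq0.
by rewrite invr_gt0 dot_gt0 subr_eq0.
Qed.

Lemma moebius_nform f : moebius f -> nform f.
Proof.
elim=> [l O b l0 hO|a r r0|{}f g _ nf _ ng]; first exact: nform_similarity.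
  by rewrite inversion_radius; right; [exact: exprn_gt0|exact: orthogonal1].
exact: nform_comp.
Qed.

(** The choice made by [xget] in [pole] is forced as soon as infinity has only one preimage. *)
Lemma pole_eq (f : hat -> hat) z : f z = None -> (forall z', f z' = None -> z' = z) -> pole f = z.
Proof.
move=> fz fu; rewrite /pole; case: xgetP => [z' _ /fu//|/(_ z)].
by rewrite /= fz.
Qed.

Lemma pole_similarity l O b : pole (similarity l O b : hat -> hat) = None.
Proof. by apply: pole_eq => // -[]. Qed.

Lemma pole_inversion l O b q :
  pole (similarity l O b \o inversion q 1) = Some q.
Proof.
apply: pole_eq => [|[x|]] /=; rewrite ?eqxx //.
by case: eqP => // ->.
Qed.

End NormalForm.

(** * Differentials *)

Section Differentials.
Variables (R : realType).
Implicit Types (V W : normedModType R).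

(** The differential depends only on the germ at x. This matters twice: [fin] of an inversion obeys
    its formula only off the pole, and [diff2] differentiates a map built from first differentials
    that are known explicitly only near x. *)
Lemma is_diff_near V W (f g df : V -> W) x :
  (\forall y \near x, f y = g y) -> is_diff x f df -> is_diff x g df.
Proof.
move=> fg [fx dfE].
have gE : g \o shift x = cst (g x) + 'd f x +o_ 0 id.
  apply/eqaddoP => e e0.
  have /eqaddoP/(_ e e0) := diff_locally fx.
  have fg0 : \forall h \near 0, f (h + x) = g (h + x).
    by have := fg; rewrite (near_shift 0) subr0.
  apply: filterS2 fg0 => h /= fgh.
  have fgx : f x = g x by exact: nbhs_singleton fg.
  by rewrite /shift /= !fctE /= fgh fgx.
have cdf : continuous ('d f x) by exact: diff_continuous.
have dgE : 'd g x = 'd f x :> (V -> W) by exact: diff_unique.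
apply: DiffDef; last by rewrite dgE.
by apply/diff_locallyP; rewrite dgE.
Qed.

Lemma is_diff_diff V W (f df : V -> W) x : is_diff x f df ->
  forall u, 'd f x u = df u.
Proof. by move=> [_ ->]. Qed.

Lemma is_diff_funD V W (f g df dg : V -> W) x :
  is_diff x f df -> is_diff x g dg ->
  is_diff x (fun y => f y + g y) (fun u => df u + dg u).
Proof. by move=> hf hg; exact: is_diffD. Qed.

Lemma is_diff_funB V W (f g df dg : V -> W) x :
  is_diff x f df -> is_diff x g dg ->
  is_diff x (fun y => f y - g y) (fun u => df u - dg u).
Proof. by move=> hf hg; exact: is_diffB. Qed.

Lemma is_diff_fun_cst V W (a : W) (x : V) : is_diff x (fun=> a) (fun=> 0).
Proof. exact: is_diff_cst. Qed.

Lemma is_diff_funZ V W (c : R) (f df : V -> W) x :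
  is_diff x f df -> is_diff x (fun y => c *: f y) (fun u => c *: df u).
Proof. by move=> hf; exact: is_diffZ. Qed.

Lemma is_diff_funM V (f g df dg : V -> R) x :
  is_diff x f df -> is_diff x g dg ->
  is_diff x (fun y => f y * g y) (fun u => f x * dg u + g x * df u).
Proof. by move=> hf hg; exact: is_diffM. Qed.

Lemma is_diff_funMr V (f df : V -> R) (c : R) x :
  is_diff x f df -> is_diff x (fun y => f y * c) (fun u => df u * c).
Proof.
move=> hf; have -> : (fun u => df u * c) = fun u => f x * 0 + c * df u.
  by apply/funext => u; rewrite mulr0 add0r mulrC.
exact: is_diff_funM hf (is_diff_fun_cst c x).
Qed.

Lemma is_diff_funV V (f df : V -> R) x :
  is_diff x f df -> f x != 0 ->
  is_diff x (fun y => (f y)^-1) (fun u => - (f x ^+ 2)^-1 * df u).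
Proof.
move=> [fx dfE] fx0; apply: DiffDef; first exact: differentiableV.
by rewrite diffV // dfE.
Qed.

Lemma is_diff_fun_sum V W n (f df : 'I_n -> V -> W) x :
  (forall i, is_diff x (f i) (df i)) ->
  is_diff x (fun y => \sum_i f i y) (fun u => \sum_i df i u).
Proof.
elim: n f df => [|n IH] f df h.
  under eq_fun do rewrite big_ord0.
  under [X in is_diff_def _ _ X]eq_fun do rewrite big_ord0.
  exact: is_diff_fun_cst.
under eq_fun do rewrite big_ord_recl.
under [X in is_diff_def _ _ X]eq_fun do rewrite big_ord_recl.
by apply: is_diff_funD => //; exact: IH.
Qed.

Lemma is_diff_funZl V W (k dk : V -> R) (a : W) x :
  is_diff x k dk -> is_diff x (fun y => k y *: a) (fun u => dk u *: a).
Proof.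
move=> [kx dkE]; apply: DiffDef; first exact: differentiableZl.
by rewrite diffZl // dkE.
Qed.

Lemma is_diff_fun_coord m n (M : 'M[R]_(m, n)) i j :
  is_diff M (fun N : 'M[R]_(m, n) => N i j) (fun N => N i j).
Proof.
apply: DiffDef; first exact: differentiable_coord.
have @f : {linear 'M[R]_(m, n) -> R}.
  by exists (fun N : 'M[R]_(_, _) => N i j); do 2![eexists]; do ?[constructor];
     rewrite ?mxE// => ? *; rewrite ?mxE//; move=> ?; rewrite !mxE.
rewrite (_ : (fun _ => _) = f) //; apply: diff_lin; exact: coord_continuous.
Qed.

Lemma is_diff_fun_row V n (f df : V -> 'rV[R]_n) x :
  (forall k, is_diff x (fun y => f y 0 k) (fun u => df u 0 k)) ->
  is_diff x f df.
Proof.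
move=> h; rewrite (_ : f = fun y => \sum_k f y 0 k *: delta_mx 0 k); last first.
  by apply/funext => y; exact: row_sum_delta.
rewrite (_ : df = fun y => \sum_k df y 0 k *: delta_mx 0 k); last first.
  by apply/funext => y; exact: row_sum_delta.
by apply: is_diff_fun_sum => k; exact: is_diff_funZl.
Qed.

Lemma is_diff_fun_dot n (v : 'rV[R]_n) q x :
  is_diff x (fun y => dot (y - q) v) (fun u => dot u v).
Proof.
have -> : (fun y => dot (y - q) v) = fun y => \sum_k (y 0 k - q 0 k) * v 0 k.
  by apply/funext => y; rewrite dotE; apply: eq_bigr => k _; rewrite !mxE.
have -> : (fun y => dot y v) = fun y => \sum_k y 0 k * v 0 k.
  by apply/funext => y; rewrite dotE.
apply: is_diff_fun_sum => k; apply: is_diff_funMr.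
rewrite (_ : (fun u : 'rV_n => u 0 k) = fun u => u 0 k - 0); last first.
  by apply/funext => u; rewrite subr0.
exact: (is_diff_funB (is_diff_fun_coord _ _ _) (is_diff_fun_cst _ _)).
Qed.

Lemma is_diff_fun_sqdist n (q x : 'rV[R]_n) :
  is_diff x (fun y => dot (y - q) (y - q)) (fun u => 2 * dot (x - q) u).
Proof.
have -> : (fun y => dot (y - q) (y - q)) = fun y => \sum_k (y 0 k - q 0 k) * (y 0 k - q 0 k).
  by apply/funext => y; rewrite dotE; apply: eq_bigr => k _; rewrite !mxE.
have -> : (fun y => 2 * dot (x - q) y) = fun y => \sum_k ((x 0 k - q 0 k) * y 0 k + (x 0 k - q 0 k) * y 0 k).
  apply/funext => y; rewrite dotE mulr_sumr; apply: eq_bigr => k _.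
  by rewrite !mxE; ring.
have h k : is_diff x (fun y : 'rV[R]_n => y 0 k - q 0 k) (fun y => y 0 k).
  rewrite (_ : (fun u : 'rV_n => u 0 k) = fun u => u 0 k - 0); last first.
    by apply/funext => u; rewrite subr0.
  exact: (is_diff_funB (is_diff_fun_coord _ _ _) (is_diff_fun_cst _ _)).
by apply: is_diff_fun_sum => k; exact: is_diff_funM.
Qed.

Lemma is_diff_fun_mulmx V n m (f df : V -> 'rV[R]_n) x (A : 'M[R]_(n, m)) :
  is_diff x f df -> is_diff x (fun y => f y *m A) (fun u => df u *m A).
Proof.
move=> hf; apply: is_diff_fun_row => k.
have -> : (fun y => (f y *m A) 0 k) = fun y => \sum_j f y 0 j * A j k.
  by apply/funext => y; rewrite mxE.
have -> : (fun y => (df y *m A) 0 k) = fun y => \sum_j df y 0 j * A j k.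
  by apply/funext => y; rewrite mxE.
apply: is_diff_fun_sum => j; apply: is_diff_funMr.
exact: (is_diff_comp hf (is_diff_fun_coord (f x) 0 j)).
Qed.

End Differentials.

(** * Operator norms and the derivatives of inversions *)

Section OperatorNorms.
Variables (R : realType) (d : nat).
Implicit Types (u v : 'rV[R]_d) (L : 'rV[R]_d -> 'rV[R]_d)
  (B : 'rV[R]_d -> 'rV[R]_d -> 'rV[R]_d).

Lemma opnorm_le L c : (forall u, enorm u <= 1 -> enorm (L u) <= c) ->
  opnorm L <= c.
Proof.
move=> h; apply: ge_sup; first by exists (enorm (L 0)), 0 => //=; rewrite enorm0.
by move=> _ [u /= hu <-]; exact: h.
Qed.

(** The values bound [sup] from below only when they form a bounded set; the constant c certifies
    this. *)
Lemma le_opnorm L c u : (forall u, enorm u <= 1 -> enorm (L u) <= c) ->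
  enorm u <= 1 -> enorm (L u) <= opnorm L.
Proof.
move=> h hu; apply: ub_le_sup; last by exists u.
by exists c => _ [v /= hv <-]; exact: h.
Qed.

Lemma opnorm2_le B c :
  (forall u v, enorm u <= 1 -> enorm v <= 1 -> enorm (B u v) <= c) ->
  opnorm2 B <= c.
Proof.
move=> h; apply: ge_sup.
  by exists (enorm (B 0 0)), 0; rewrite /= ?enorm0 //; exists 0; rewrite /= ?enorm0.
by move=> _ [u /= hu [v /= hv <-]]; exact: h.
Qed.

Lemma le_opnorm2 B c u v :
  (forall u v, enorm u <= 1 -> enorm v <= 1 -> enorm (B u v) <= c) ->
  enorm u <= 1 -> enorm v <= 1 -> enorm (B u v) <= opnorm2 B.
Proof.
move=> h hu hv; apply: ub_le_sup; last by exists u => //; exists v.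
by exists c => _ [u' /= hu' [v' /= hv' <-]]; exact: h.
Qed.

Lemma opnorm_ge0 L : 0 <= opnorm L.
Proof.
have [hs|hs] := pselect (has_sup [set enorm (L u) | u in [set u | enorm u <= 1]]).
  apply: le_trans (enorm_ge0 (L 0)) _; apply: ub_le_sup; first exact: hs.2.
  by exists 0 => //=; rewrite enorm0.
(* Without a supremum, [sup] takes its default value 0. *)
by rewrite /opnorm sup_out.
Qed.

Lemma opnorm2_ge0 B : 0 <= opnorm2 B.
Proof.
rewrite /opnorm2; set S := (X in sup X).
have [hs|hs] := pselect (has_sup S); last by rewrite sup_out.
apply: le_trans (enorm_ge0 (B 0 0)) _; apply: ub_le_sup; first exact: hs.2.
by exists 0; rewrite /= ?enorm0 //; exists 0; rewrite /= ?enorm0.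
Qed.

Lemma opnorm_conformal L c : (0 < d)%N -> 0 <= c ->
  (forall u, enorm (L u) = c * enorm u) -> opnorm L = c.
Proof.
move=> d0 c0 h.
have hc u : enorm u <= 1 -> enorm (L u) <= c by rewrite h => hu; rewrite ler_piMr.
apply/eqP; rewrite eq_le opnorm_le //=.
have e1 : enorm (delta_mx 0 (Ordinal d0) : 'rV[R]_d) = 1 by exact: enorm_delta.
rewrite -[leLHS]mulr1 -e1 -h; apply: le_opnorm hc _.
by rewrite e1.
Qed.

End OperatorNorms.

(** * First and second derivatives of inversions *)

Section InversionDerivative.
Variables (R : realType) (d : nat).
Implicit Types (x y q a b u v w : 'rV[R]_d) (l : R) (O : 'M[R]_d).

(** The derivative of the unit inversion at w = x - q: |w|^-2 times the reflection in the hyperplane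
    orthogonal to w. *)
Definition invd w u := (dot w w)^-1 *: u - (2 * dot w u / dot w w ^+ 2) *: w.

(** The derivative along u of [invd w v] as a function of w, hence the second derivative of the
    inversion. *)
Definition invd2 w u v :=
  (8 * dot w u * dot w v / dot w w ^+ 3 - 2 * dot u v / dot w w ^+ 2) *: w
  - (2 * dot w u / dot w w ^+ 2) *: v - (2 * dot w v / dot w w ^+ 2) *: u.

Lemma is_diff_inv q x : x != q ->
  is_diff x (fun y => q + (dot (y - q) (y - q))^-1 *: (y - q)) (invd (x - q)).
Proof.
rewrite -subr_eq0 -dot_eq0 => x0; apply: is_diff_fun_row => k.
have hk : is_diff x (fun y => y 0 k - q 0 k) (fun u => u 0 k - 0).
  exact: (is_diff_funB (is_diff_fun_coord _ _ _) (is_diff_fun_cst _ _)).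
have := is_diff_funD (is_diff_fun_cst (q 0 k) x) (is_diff_funM (is_diff_funV (is_diff_fun_sqdist q x) x0) hk).
congr (is_diff_def _ _ _); apply/funext => u; rewrite !mxE //.
by rewrite subr0 add0r; field.
Qed.

Lemma is_diff_invd q x v : x != q ->
  is_diff x (fun y => invd (y - q) v) (fun u => invd2 (x - q) u v).
Proof.
rewrite -subr_eq0 -dot_eq0 => x0; apply: is_diff_fun_row => k.
have hk : is_diff x (fun y => y 0 k - q 0 k) (fun u => u 0 k - 0).
  exact: (is_diff_funB (is_diff_fun_coord _ _ _) (is_diff_fun_cst _ _)).
have hn := is_diff_funV (is_diff_fun_sqdist q x) x0.
have := is_diff_funB (is_diff_funMr (v 0 k) hn)
   (is_diff_funM (is_diff_funM (is_diff_funM (is_diff_funMr 2 (is_diff_fun_dot v q x)) hn) hn) hk).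
congr (is_diff_def _ _ _); apply/funext => u; rewrite !mxE /= ?(dotC (x - q)) ?(dotC u v).
  by rewrite expr2 invfM; ring.
by field.
Qed.

Lemma is_diff_similarity l O b x :
  is_diff x (fin (similarity l O b)) (fun u => l *: (u *m O^T)).
Proof.
have := is_diff_funD (is_diff_funZ l (is_diff_fun_mulmx O^T (is_diff_id x))) (is_diff_fun_cst b x).
by congr (is_diff_def _ _ _); apply/funext => u; rewrite addr0.
Qed.

Lemma near_neq q x : x != q -> \forall y \near x, y != q.
Proof. rewrite -subr_eq0 -dot_eq0 => xq.
have hc := differentiable_continuous (ex_diff (is_diff_def := is_diff_fun_sqdist q x)).
have h : \forall y \near x, dot (y - q) (y - q) != 0 by exact: cvgr_neq0 hc xq.
by apply: filterS h => y; rewrite dot_eq0 subr_eq0.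
Qed.

Lemma finE_inversion l O b q y : y != q ->
  fin (similarity l O b \o inversion q 1) y =
  l *: ((q + (dot (y - q) (y - q))^-1 *: (y - q)) *m O^T) + b.
Proof. by rewrite /fin /= => /negbTE -> /=; rewrite expr1n mul1r sqr_enorm. Qed.

Lemma is_diff_inversion l O b q x : x != q ->
  is_diff x (fin (similarity l O b \o inversion q 1))
    (fun u => l *: (invd (x - q) u *m O^T)).
Proof.
move=> xq; have := is_diff_funD (is_diff_funZ l (is_diff_fun_mulmx O^T (is_diff_inv xq))) (is_diff_fun_cst b x).
under [X in is_diff_def _ _ X -> _]eq_fun do rewrite addr0.
apply: is_diff_near; apply: filterS (near_neq xq) => y yq.
by rewrite finE_inversion.
Qed.

Lemma diff2_similarity l O b x u v : diff2 (fin (similarity l O b)) x u v = 0.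
Proof.
rewrite /diff2; under eq_fun do rewrite (is_diff_diff (is_diff_similarity l O b _)).
by rewrite (is_diff_diff (is_diff_fun_cst _ _)).
Qed.

Lemma is_diff_diff_inversion l O b q x v : x != q ->
  is_diff x (fun y => 'd (fin (similarity l O b \o inversion q 1)) y v)
    (fun u => l *: (invd2 (x - q) u v *m O^T)).
Proof.
move=> xq; have := is_diff_funZ l (is_diff_fun_mulmx O^T (is_diff_invd v xq)).
apply: is_diff_near; apply: filterS (near_neq xq) => y yq.
by rewrite (is_diff_diff (is_diff_inversion l O b yq)).
Qed.

Lemma diff2_inversion l O b q x u v : x != q ->
  diff2 (fin (similarity l O b \o inversion q 1)) x u v =
  l *: (invd2 (x - q) u v *m O^T).
Proof. by move=> xq; rewrite /diff2 (is_diff_diff (is_diff_diff_inversion _ _ _ _ xq)). Qed.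

Lemma dot_invd w u : w != 0 -> dot (invd w u) (invd w u) = dot u u / dot w w ^+ 2.
Proof.
rewrite -dot_eq0 => w0; rewrite /invd !dot_lin (dotC u w).
by field.
Qed.

Lemma enorm_invd w u : w != 0 -> enorm (invd w u) = (dot w w)^-1 * enorm u.
Proof.
move=> w0; rewrite !enormE dot_invd // -exprVn mulrC sqrtrM ?sqr_ge0 //.
by rewrite sqrtr_sqr ger0_norm // invr_ge0 dot_ge0.
Qed.

(** This is half the derivative along u of |[invd w v]|^2 = |v|^2 / |w|^4. *)
Lemma dot_invd2 w u v : w != 0 ->
  dot (invd2 w u v) (invd w v) = - 2 * dot w u * dot v v / dot w w ^+ 3.
Proof.
rewrite -dot_eq0 => w0; rewrite /invd /invd2 !dot_lin (dotC u w) (dotC v w).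
by field.
Qed.

(** The constant is 14 = (8 + 2) + 2 + 2: the coefficient of w contributes 10, the terms along v and
    u contribute 2 each. *)
Lemma enorm_invd2 w u v : w != 0 ->
  enorm (invd2 w u v) <= 14 / enorm w ^+ 3 * (enorm u * enorm v).
Proof.
move=> w0; have n0 : 0 < enorm w by rewrite enorm_gt0.
have wu := ler_dot_enorm w u; have wv := ler_dot_enorm w v.
have uv := ler_dot_enorm u v.
rewrite /invd2 -!sqr_enorm.
move: n0 wu wv uv (enorm_ge0 u) (enorm_ge0 v) => n0 wu wv uv u0 v0.
have n1 := ltW n0.
set A := _ *: w; set B := _ *: v; set C := _ *: u.
have hA : enorm A <= 10 / enorm w ^+ 3 * (enorm u * enorm v).
  rewrite enormZ.
  have : `|8 * dot w u * dot w v / (enorm w ^+ 2) ^+ 3 - 2 * dot u v / (enorm w ^+ 2) ^+ 2| <=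
     10 * (enorm u * enorm v) / enorm w ^+ 4.
    apply: le_trans (ler_normB _ _) _.
    rewrite !normrM !normfV !normrX !(ger0_norm n1) !normr_nat.
    have -> : 10 * (enorm u * enorm v) / enorm w ^+ 4 =
       8 * (enorm w * enorm u) * (enorm w * enorm v) / (enorm w ^+ 2) ^+ 3
       + 2 * (enorm u * enorm v) / (enorm w ^+ 2) ^+ 2 by field; rewrite gt_eqF.
    apply: lerD; apply: ler_wpM2r; rewrite ?invr_ge0 ?exprn_ge0 //.
      by apply: ler_pM => //; rewrite ?mulr_ge0 ?ler_pM2l.
    by rewrite ler_pM2l.
  move=> /(ler_wpM2r n1) /le_trans; apply.
  by apply: eqr_le; field; rewrite gt_eqF.
have hC (x y : 'rV[R]_d) : enorm ((2 * dot w x / (enorm w ^+ 2) ^+ 2) *: y) <=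
    2 / enorm w ^+ 3 * (enorm x * enorm y).
  rewrite enormZ !normrM !normfV !normrX !(ger0_norm n1) normr_nat.
  have -> : 2 / enorm w ^+ 3 * (enorm x * enorm y) =
     2 * (enorm w * enorm x) / (enorm w ^+ 2) ^+ 2 * enorm y.
    by field; rewrite gt_eqF.
  apply: ler_wpM2r; first exact: enorm_ge0.
  apply: ler_wpM2r; rewrite ?invr_ge0 ?exprn_ge0 //.
  by rewrite ler_pM2l // ler_dot_enorm.
have hB := hC u v; have := hC v u; rewrite -/C -/B in hB * => hCC.
apply: le_trans (ler_enormB _ _) _; apply: le_trans (lerD (ler_enormB _ _) (lexx _)) _.
apply: le_trans (lerD (lerD hA hB) hCC) _.
by apply: eqr_le; ring.
Qed.

End InversionDerivative.

(** * Poles and the first two inclusions *)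

Section Poles.
Variables (R : realType) (d N : nat).
Implicit Types (f g : hat R d -> hat R d) (x : 'rV[R]_d) (p : hat R d)
  (Phi : 'I_N -> hat R d -> hat R d).

Lemma nform_pole f z : nform f -> (f z = None) <-> (z = pole f).
Proof.
case=> [l O b l0 hO|l O b q l0 hO].
  by rewrite pole_similarity; case: z.
rewrite pole_inversion; case: z => [x|] //=; case: eqP => [->//|xq] //.
by split=> // -[].
Qed.

(** The norm of the differential at x of a Moebius map with pole p, up to a constant factor. *)
Definition pole_weight p x : R :=
  if p is Some q then (dot (x - q) (x - q))^-1 else 1.

Lemma pole_weight_gt0 p x : Some x <> p -> 0 < pole_weight p x.
Proof.
case: p => [q|] /= xq; last exact: ltr01.
rewrite invr_gt0 dot_gt0 subr_eq0; apply/eqP => xE; apply: xq.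
by rewrite xE.
Qed.

Lemma near_pole p x : Some x <> p -> \forall y \near x, Some y <> p.
Proof.
case: p => [q|_]; last by apply: (@filterE _ (nbhs x)).
move=> xq; have /near_neq : x != q by apply/eqP => xE; apply: xq; rewrite xE.
by apply: filterS => y /eqP yq [].
Qed.

Lemma nform_opnorm f : (0 < d)%N -> nform f ->
  exists2 l, 0 < l & forall x, Some x <> pole f ->
    opnorm ('d (fin f) x) = l * pole_weight (pole f) x.
Proof.
move=> d0 [l O b l0 hO|l O b q l0 hO]; exists l => // x.
  rewrite pole_similarity mulr1 => _; apply: opnorm_conformal => // [|u].
    exact: ltW.
  by rewrite (is_diff_diff (is_diff_similarity _ _ _ _)) enormZ enorm_orth // gtr0_norm.
rewrite pole_inversion => xq.
have {}xq : x != q by apply/eqP => xE; apply: xq; rewrite xE.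
apply: opnorm_conformal => // [|u].
  by rewrite mulr_ge0 ?ltW //= invr_gt0 dot_gt0 subr_eq0.
rewrite (is_diff_diff (is_diff_inversion _ _ _ xq)) enormZ enorm_orth //.
by rewrite gtr0_norm // enorm_invd ?subr_eq0 //= mulrA.
Qed.

Lemma nform_id : nform (id : hat R d -> hat R d).
Proof. by rewrite -similarity1; left; [exact: ltr01|exact: orthogonal1]. Qed.

(** [fword] appends letters at the end that acts last, while poles are computed by removing the
    letter that acts first. *)
Lemma fword_cons Phi i s : fword Phi (i :: s) = fword Phi s \o Phi i.
Proof.
have foldE g : foldl (fun f j => Phi j \o f) g s = fword Phi s \o g.
  rewrite /fword; elim/last_ind: s g => //= s j IH g.
  by rewrite !foldl_rcons IH compA.
by rewrite /fword /= foldE.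
Qed.

Lemma nform_fword Phi s : (forall i, nform (Phi i)) -> nform (fword Phi s).
Proof.
move=> h; elim: s => [|i s IH]; first exact: nform_id.
by rewrite fword_cons; exact: nform_comp.
Qed.

Lemma derive_addr_cst (V W : normedModType R) (f : V -> W) (c : W) (x v : V) :
  'D_v (fun y => c + f y) x = 'D_v f x.
Proof.
rewrite /derive; congr (lim _).
have -> : (fun h : R => h^-1 *: (((fun y => c + f y) \o shift x) (h *: v) - (c + f x))) =
    (fun h : R => h^-1 *: ((f \o shift x) (h *: v) - f x)).
  by apply/funext => h /=; rewrite opprD addrACA subrr add0r.
by [].
Qed.

(** Near x both norms are constants times the same [pole_weight]; the logarithm turns the constants
    into summands, which the gradient kills. *)
Lemma eq_pole_gradient f g x : (0 < d)%N -> nform f -> nform g ->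
  pole f = pole g -> Some x <> pole f ->
  gradient (fun y => ln (opnorm ('d (fin f) y))) x =
  gradient (fun y => ln (opnorm ('d (fin g) y))) x.
Proof.
move=> d0 nf ng fg xf.
suff H h : nform h -> pole h = pole f ->
    gradient (fun y => ln (opnorm ('d (fin h) y))) x =
    gradient (fun y => ln (pole_weight (pole f) y)) x.
  exact: etrans (H f nf erefl) (esym (H g ng (esym fg))).
move=> nh hf; have [l l0 hl] := nform_opnorm d0 nh.
apply/rowP => k; rewrite !mxE.
rewrite -[RHS](derive_addr_cst _ (ln l)); apply: near_eq_derive.
apply: filterS (near_pole xf) => y yf.
by have := hl y; rewrite hf => /(_ yf) ->; rewrite lnM ?posrE // pole_weight_gt0.
Qed.

Lemma fword_closure Phi (Omega Omega' : set 'rV[R]_d) s x :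
  cifs Omega Omega' Phi -> closure Omega x ->
  fword Phi s (Some x) <> None.
Proof.
move=> hPhi; elim: s x => [|i s IH] x Kx //; rewrite fword_cons /=.
have [_ _ h _] := hPhi i; have [y Oy ->] := h x Kx.
by apply: IH; exact: subset_closure.
Qed.

Lemma cifs_nform Phi (Omega Omega' : set 'rV[R]_d) i :
  cifs Omega Omega' Phi -> nform (Phi i).
Proof. by move=> /(_ i)[+ _ _ _]; exact: moebius_nform. Qed.

(** Two words with the same pole would have equal gradients on the closure, hence be a pair at
    distance 0, against the positive infimum. *)
Lemma GT_subset_GTfin (Omega Omega' : set 'rV[R]_d) : (0 < d)%N ->
  Omega !=set0 -> @GT R d N Omega Omega' `<=` @GTfin R d N Omega Omega'.
Proof.
move=> d0 [x0 Ox0] Phi [hPhi hinf]; split=> // s t hZ pst.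
have nf u : nform (fword Phi u) by apply: nform_fword => i; exact: cifs_nform hPhi.
have Kx0 : closure Omega x0 by exact: subset_closure.
have TE x : closure Omega x -> Tfin Phi s x = Tfin Phi t x.
  move=> Kx; apply: eq_pole_gradient => //.
  by move=> /nform_pole-/(_ (nf s)); exact: fword_closure hPhi Kx.
have dist_eq0 : dist0 (closure Omega) (Tfin Phi s) (Tfin Phi t) = 0%E.
  rewrite /dist0 /supnorm.
  have -> : [set (enorm (Tfin Phi s x - Tfin Phi t x))%:E | x in closure Omega] =
      [set 0%E].
    apply/seteqP; split=> [_ [x Kx <-]|_ ->] /=.
      by rewrite (TE x Kx) subrr enorm0.
    (* The point x0 makes the set of values nonempty, so that its supremum is 0 rather than the
       bottom value of the extended reals. *)
    by exists x0; [exact: Kx0|rewrite (TE x0 Kx0) subrr enorm0].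
  by rewrite ereal_sup1.
suff : (ereal_inf
      [set dist0 (closure Omega) (Tword Omega Phi w.1) (Tword Omega Phi w.2)
      | w in @Zpairs N] <= 0)%E by rewrite leNgt hinf.
apply: ereal_inf_lbound; by exists (FinWord s, FinWord t); [exact: hZ|exact: dist_eq0].
Qed.

Lemma GTfin_subset_Sstar (Omega Omega' : set 'rV[R]_d) :
  @GTfin R d N Omega Omega' `<=` @Sstar R d N Omega Omega'.
Proof.
move=> Phi [hPhi h]; split=> // i j ij.
by apply: (h [:: i] [:: j]); split=> //= -[].
Qed.

End Poles.

(** * Openness *)

Section Openness.
Variables (R : realType) (d N : nat).
Implicit Types (f g : hat R d -> hat R d) (x u v : 'rV[R]_d) (p : hat R d)
  (Phi Psi : 'I_N -> hat R d -> hat R d) (K : set 'rV[R]_d).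

(* The gradient of log ||Df|| at x for a Moebius transformation with pole p. *)
Definition pole_grad p x : 'rV[R]_d :=
  if p is Some q then (- 2 / dot (x - q) (x - q)) *: (x - q) else 0.

(** The map w |-> -2 w / |w|^2 is an involution of the nonzero vectors, so it is injective and never
    takes the value 0 reserved for the pole at infinity. *)
Lemma pole_grad_inj x p p' : Some x <> p -> Some x <> p' ->
  pole_grad p x = pole_grad p' x -> p = p'.
Proof.
have E q : Some x <> Some q :> hat R d -> x - q != 0.
  by move=> h; rewrite subr_eq0; apply/eqP => xq; apply: h; rewrite xq.
have G0 (w : 'rV[R]_d) : w != 0 -> (- 2 / dot w w) *: w != 0 :> 'rV[R]_d.
  by move=> w0; rewrite scaler_eq0 mulf_eq0 oppr_eq0 pnatr_eq0 invr_eq0 dot_eq0 (negbTE w0).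
have GI (w : 'rV[R]_d) : w != 0 -> let t := (- 2 / dot w w) *: w in w = (- 2 / dot t t) *: t.
  rewrite -dot_eq0 => w0 t; rewrite /t !dot_lin scalerA.
  by apply/rowP => k; rewrite !mxE; field.
case: p => [q|]; case: p' => [q'|] //=.
- move=> /E w0 /E w'0 h; congr Some; apply: (addrI (- x)); apply: oppr_inj.
  by rewrite !opprD opprK (GI _ w0) (GI _ w'0) h.
- by move=> /E w0 _ h; have := G0 _ w0; rewrite h eqxx.
- by move=> _ /E w0 h; have := G0 _ w0; rewrite -h eqxx.
Qed.

(** Differentiating |Df v|^2 = ||Df||^2 |v|^2 along u gives this identity. It recovers the gradient
    of log ||Df||, hence the pole, from the first two derivatives at one point. *)
Lemma nform_diff2 f x u v : nform f -> Some x <> pole f ->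
  dot (diff2 (fin f) x u v) ('d (fin f) x v) =
  dot (pole_grad (pole f) x) u * dot ('d (fin f) x v) ('d (fin f) x v).
Proof.
case=> [l O b l0 hO|l O b q l0 hO].
  by rewrite pole_similarity /= diff2_similarity !dot0l mul0r.
rewrite pole_inversion /= => xq.
have {}xq : x != q by apply/eqP => xE; apply: xq; rewrite xE.
have w0 : dot (x - q) (x - q) != 0 by rewrite dot_eq0 subr_eq0.
rewrite diff2_inversion // (is_diff_diff (is_diff_inversion _ _ _ xq)).
rewrite !dotZl !dotZr !dot_orth // dot_invd2 ?subr_eq0 // dot_invd ?subr_eq0 //.
by field.
Qed.

Lemma nform_diff_neq0 f x v : nform f -> Some x <> pole f -> v != 0 ->
  'd (fin f) x v != 0.
Proof.
case=> [l O b l0 hO|l O b q l0 hO].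
  move=> _ v0.
  rewrite -enorm_eq0 (is_diff_diff (is_diff_similarity _ _ _ _)) enormZ enorm_orth //.
  by rewrite mulf_eq0 normr_eq0 gt_eqF //= enorm_eq0.
rewrite pole_inversion /= => xq v0.
have {}xq : x != q by apply/eqP => xE; apply: xq; rewrite xE.
rewrite -enorm_eq0 (is_diff_diff (is_diff_inversion _ _ _ xq)) enormZ enorm_orth //.
rewrite mulf_eq0 normr_eq0 gt_eqF //= enorm_invd ?subr_eq0 //.
by rewrite mulf_eq0 invr_eq0 dot_eq0 subr_eq0 (negbTE xq) enorm_eq0.
Qed.

(** A closed set missing the finite pole q stays at some distance e > 0 from it, and the derivatives
    of an inversion at x are bounded by powers of 1/|x - q|. *)
Lemma nform_bounded f K : nform f -> closed K ->
  (forall x, K x -> Some x <> pole f) ->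
  exists2 C, 0 <= C & forall x, K x ->
   (forall u, enorm u <= 1 -> enorm ('d (fin f) x u) <= C) /\
   (forall u v, enorm u <= 1 -> enorm v <= 1 -> enorm (diff2 (fin f) x u v) <= C).
Proof.
case=> [l O b l0 hO|l O b q l0 hO] clK.
  move=> _; exists l => [|x Kx]; first exact: ltW.
  split=> [u hu|u v hu hv].
    rewrite (is_diff_diff (is_diff_similarity _ _ _ _)) enormZ enorm_orth //.
    by rewrite gtr0_norm // ler_piMr // ltW.
  by rewrite diff2_similarity enorm0 ltW.
rewrite pole_inversion => hK.
have Kq : ~ K q by move=> /hK.
have [e e0 he] : exists2 e : R, 0 < e & forall x, K x -> e <= enorm (x - q).
  have : nbhs q (~` K) by apply: open_nbhs_nbhs; split=> //; exact: closed_openC.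
  move=> /nbhs_ballP [e /= e0 he]; exists e => // x Kx.
  rewrite leNgt; apply/negP => xq; apply: (he x) => //.
  rewrite -ball_normE /= -normrN opprB.
  exact: le_lt_trans (ler_norm_enorm _) xq.
(* The first summand bounds the differential, the second one the second derivative. *)
exists (l * (e ^+ 2)^-1 + l * (14 / e ^+ 3)).
  by rewrite addr_ge0 // mulr_ge0 ?ltW // ?invr_gt0 ?divr_gt0 ?exprn_gt0.
move=> x Kx; have xq : x != q by apply: contra_notN Kq => /eqP <-.
have w0 : 0 < enorm (x - q) by rewrite enorm_gt0 subr_eq0.
have l0' := ltW l0.
split=> [u hu|u v hu hv].
  rewrite (is_diff_diff (is_diff_inversion _ _ _ xq)) enormZ enorm_orth //.
  rewrite gtr0_norm // enorm_invd ?subr_eq0 // -sqr_enorm.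
  apply: (@le_trans _ _ (l * (e ^+ 2)^-1)); last first.
    by rewrite lerDl mulr_ge0 // ltW // divr_gt0 ?exprn_gt0.
  rewrite ler_wpM2l // -[leRHS]mulr1 ler_pM ?invr_ge0 ?exprn_ge0 ?enorm_ge0 //.
  rewrite lef_pV2 ?posrE ?exprn_gt0 // lerXn2r ?nnegrE ?enorm_ge0 ?he //; exact: ltW.
rewrite diff2_inversion // enormZ enorm_orth // gtr0_norm //.
apply: (@le_trans _ _ (l * (14 / e ^+ 3))); last first.
  by rewrite lerDr mulr_ge0 // ltW // invr_gt0 exprn_gt0.
rewrite ler_wpM2l // (le_trans (enorm_invd2 _ _ _)) ?subr_eq0 // -[leRHS]mulr1.
apply: ler_pM; rewrite ?mulr_ge0 ?invr_ge0 ?exprn_ge0 ?enorm_ge0 //; last first.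
  by rewrite -[leRHS]mulr1 ler_pM ?enorm_ge0.
rewrite ler_pM2l // lef_pV2 ?posrE ?exprn_gt0 // lerXn2r ?nnegrE ?enorm_ge0 ?he //.
exact: ltW.
Qed.

Lemma supnorm_ge K (h : 'rV[R]_d -> R) x : K x -> ((h x)%:E <= supnorm K h)%E.
Proof. by move=> Kx; apply: ereal_sup_ubound; exists x. Qed.

Lemma supnorm_le K (h : 'rV[R]_d -> R) c : (forall x, K x -> h x <= c) ->
  (supnorm K h <= c%:E)%E.
Proof. by move=> hc; apply: ge_ereal_sup => _ [x Kx <-]; rewrite lee_fin hc. Qed.

Lemma dist_ge0 K f g : K !=set0 ->
  [/\ (0 <= dist0 K (fin f) (fin g))%E, (0 <= dist1 K (fin f) (fin g))%E
    & (0 <= dist2 K (fin f) (fin g))%E].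
Proof.
move=> [x Kx]; split; apply: le_trans (supnorm_ge _ Kx); rewrite lee_fin.
- exact: enorm_ge0.
- exact: opnorm_ge0.
- exact: opnorm2_ge0.
Qed.

(** On a nonempty closure the three distances are nonnegative, so that each is at most their sum. *)
Lemma d2_lt Phi Psi (Omega : set 'rV[R]_d) (e : R) : (d2 Omega Phi Psi < e%:E)%E ->
  forall i x, closure Omega x ->
  opnorm (fun u => 'd (fin (Phi i)) x u - 'd (fin (Psi i)) x u) < e /\
  opnorm2 (fun u v => diff2 (fin (Phi i)) x u v - diff2 (fin (Psi i)) x u v) < e.
Proof.
rewrite /d2 => /bigmax_ltP[_ h] i x Kx; have {h} := h i isT.
have [h0 h1 h2] := @dist_ge0 (closure Omega) (Phi i) (Psi i) (ex_intro _ x Kx).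
move=> h; rewrite -!lte_fin; split; apply: le_lt_trans h.
  have s1 := supnorm_ge (fun x =>
     opnorm (fun u => 'd (fin (Phi i)) x u - 'd (fin (Psi i)) x u)) Kx.
  apply: le_trans s1 _; rewrite -addeA; apply: le_trans (leeDr _ h0).
  exact: leeDl.
have s2 := supnorm_ge (fun x =>
   opnorm2 (fun u v => diff2 (fin (Phi i)) x u v - diff2 (fin (Psi i)) x u v)) Kx.
by apply: le_trans s2 _; apply: leeDr; apply: adde_ge0.
Qed.

Lemma d2_le Phi Psi (Omega : set 'rV[R]_d) (e : R) : 0 <= e ->
  (forall i x, closure Omega x ->
  [/\ enorm (fin (Phi i) x - fin (Psi i) x) <= e,
  opnorm (fun u => 'd (fin (Phi i)) x u - 'd (fin (Psi i)) x u) <= e &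
  opnorm2 (fun u v => diff2 (fin (Phi i)) x u v - diff2 (fin (Psi i)) x u v) <= e]) ->
  (d2 Omega Phi Psi <= (e *+ 3)%:E)%E.
Proof.
move=> e0 h; apply/bigmax_leP; split; first by rewrite lee_fin mulrn_wge0.
move=> i _; rewrite !mulrS mulr0n addr0 addrA !EFinD.
by apply: leeD; [apply: leeD|]; apply: supnorm_le => x /(h i)[].
Qed.

Lemma cvg_dot (T : Type) (F : set_system T) {FF : Filter F} (f g : T -> 'rV[R]_d) a b :
  f @ F --> a -> g @ F --> b -> dot (f t) (g t) @[t --> F] --> dot a b.
Proof.
move=> fa gb; under eq_fun do rewrite dotE.
rewrite dotE; apply: cvg_big => [|k _]; first exact: add_continuous.
apply: cvgM.
  apply: (@cvg_comp _ _ _ f (fun M : 'rV[R]_d => M 0 k) _ _ _ fa).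
  exact: coord_continuous.
apply: (@cvg_comp _ _ _ g (fun M : 'rV[R]_d => M 0 k) _ _ _ gb).
exact: coord_continuous.
Qed.

(** Distinct poles have distinct gradients of log ||Df|| at x0. After cross-multiplication this says
    F <> 0 for a continuous function F of the derivatives at x0, and this persists under a small
    change in [d2]. *)
Lemma Sstar_open (Omega Omega' : set 'rV[R]_d) Phi : (0 < d)%N ->
  Omega !=set0 -> closure Omega `<=` Omega' -> Sstar Omega Omega' Phi ->
  exists2 eps : R, 0 < eps & forall Psi, cifs Omega Omega' Psi ->
    (d2 Omega Phi Psi < eps%:E)%E -> Sstar Omega Omega' Psi.
Proof.
move=> d0 [x0 Ox0] hsub [hPhi hp].
have Kx0 : closure Omega x0 by exact: subset_closure.
have nopole Psi i : cifs Omega Omega' Psi -> Some x0 <> pole (Psi i).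
  move=> hPsi /nform_pole-/(_ (cifs_nform i hPsi)).
  by have [_ h _ _] := hPsi i; apply: h; exact: hsub.
pose e0 : 'rV[R]_d := delta_mx 0 (Ordinal d0).
have e0_neq0 : e0 != 0 by rewrite -enorm_eq0 enorm_delta oner_eq0.
pose A Psi i : 'rV[R]_d := 'd (fin (Psi i)) x0 e0.
pose B Psi i k := diff2 (fin (Psi i)) x0 (delta_mx 0 k) e0.
have key i j : \forall e \near (0 : R)^'+, i <> j ->
    forall Psi, cifs Omega Omega' Psi -> (d2 Omega Phi Psi < e%:E)%E ->
    pole (Psi i) <> pole (Psi j).
  have [->|/eqP ij] := eqVneq i j; first by apply: nearW.
  have : pole_grad (pole (Phi i)) x0 != pole_grad (pole (Phi j)) x0.
    apply/eqP => /(pole_grad_inj (nopole _ i hPhi) (nopole _ j hPhi)).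
    exact: hp.
  move=> /eqP/rowP/existsNP[k hk].
  (* The entries of t stand for D^2 and D of generator i, then D and D^2 of generator j, in fixed
     directions. F is the difference of the k-th gradient coordinates multiplied by both squared
     lengths, so no division occurs. *)
  pose F (t : 'rV[R]_d * 'rV[R]_d * 'rV[R]_d * 'rV[R]_d) :=
    dot t.1.1.1 t.1.1.2 * dot t.1.2 t.1.2 - dot t.2 t.1.2 * dot t.1.1.2 t.1.1.2.
  pose D Psi := (B Psi i k, A Psi i, A Psi j, B Psi j k).
  have cross (a1 a2 b1 b2 : 'rV[R]_d) (g1 g2 : R) : dot b1 a1 = g1 * dot a1 a1 ->
      dot b2 a2 = g2 * dot a2 a2 ->
      F (b1, a1, a2, b2) = (g1 - g2) * dot a1 a1 * dot a2 a2.
    by rewrite /F /= => -> ->; ring.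
  have Deq Psi : cifs Omega Omega' Psi -> F (D Psi) =
      (pole_grad (pole (Psi i)) x0 0 k - pole_grad (pole (Psi j)) x0 0 k)
      * dot (A Psi i) (A Psi i) * dot (A Psi j) (A Psi j).
    move=> hPsi.
    have hl l : dot (B Psi l k) (A Psi l) =
        pole_grad (pole (Psi l)) x0 0 k * dot (A Psi l) (A Psi l).
      rewrite -dot_delta; apply: nform_diff2 (nopole Psi l hPsi).
      exact: cifs_nform hPsi.
    have h := cross (A Psi i) (A Psi j) (B Psi i k) (B Psi j k) _ _ (hl i) (hl j).
    exact: h.
  have FD : F (D Phi) != 0.
    rewrite Deq // !mulf_neq0 ?dot_eq0 //; last 2 first.
    - by apply: nform_diff_neq0 => //; [exact: cifs_nform hPhi|exact: nopole].
    - by apply: nform_diff_neq0 => //; [exact: cifs_nform hPhi|exact: nopole].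
    by rewrite subr_eq0; apply/eqP.
  have cF : F t @[t --> D Phi] --> F (D Phi).
    have f1 (U V : topologicalType) : continuous (@fst U V) by move=> p; exact: cvg_fst.
    have f2 (U V : topologicalType) : continuous (@snd U V) by move=> p; exact: cvg_snd.
    have c4 : t.2 @[t --> D Phi] --> B Phi j k := f2 _ _ (D Phi).
    have c0 : t.1 @[t --> D Phi] --> (D Phi).1 := f1 _ _ (D Phi).
    have c3 : t.1.2 @[t --> D Phi] --> A Phi j.
      exact: (@cvg_comp _ _ _ fst snd _ _ _ c0 (f2 _ _ _)).
    have c12 : t.1.1 @[t --> D Phi] --> (B Phi i k, A Phi i).
      exact: (@cvg_comp _ _ _ fst fst _ _ _ c0 (f1 _ _ _)).
    have c1 : t.1.1.1 @[t --> D Phi] --> B Phi i k.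
      exact: (@cvg_comp _ _ _ (fst \o fst) fst _ _ _ c12 (f1 _ _ _)).
    have c2 : t.1.1.2 @[t --> D Phi] --> A Phi i.
      exact: (@cvg_comp _ _ _ (fst \o fst) snd _ _ _ c12 (f2 _ _ _)).
    exact: (cvgB (cvgM (cvg_dot c1 c2) (cvg_dot c3 c3))
                 (cvgM (cvg_dot c4 c3) (cvg_dot c2 c2))).
  have : \forall t \near D Phi, F t != 0 by exact: cvgr_neq0 cF FD.
  move=> /nbhs_ballP[r /= r0 hr].
  near=> e => _ Psi hPsi he hij.
  have er : e < r by near: e; exact: nbhs_right_lt.
  have hd := d2_lt he.
  (* An operator norm dominates the values only when these are bounded; the bound over the closed
     singleton of x0 provides that. *)
  have bnd (Xi : 'I_N -> hat R d -> hat R d) l : cifs Omega Omega' Xi -> exists C,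
    (forall u, enorm u <= 1 -> enorm ('d (fin (Xi l)) x0 u) <= C) /\
    (forall u v, enorm u <= 1 -> enorm v <= 1 -> enorm (diff2 (fin (Xi l)) x0 u v) <= C).
    move=> hXi; have cl : closed [set x0].
      rewrite -[X in closed X]setCK closedC openE => y /eqP/near_neq.
      by apply: filterS => z /eqP.
    have [|C C0 hC] := nform_bounded (cifs_nform l hXi) cl.
      by move=> y yx; rewrite (yx : y = x0); exact: (nopole Xi l hXi).
    by exists C; exact: hC.
  have e01 k' : enorm (delta_mx 0 k' : 'rV[R]_d) <= 1 by rewrite enorm_delta.
  have hA l : `|A Phi l - A Psi l| < r.
    apply: le_lt_trans (ler_norm_enorm _) _; apply: lt_trans er.
    apply: le_lt_trans (hd l x0 Kx0).1.
    have [C [hC _]] := bnd _ l hPhi; have [C' [hC' _]] := bnd _ l hPsi.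
    apply: (@le_opnorm _ _ (fun u => 'd (fin (Phi l)) x0 u - 'd (fin (Psi l)) x0 u) (C + C')) => [u hu|].
      by apply: le_trans (ler_enormB _ _) _; apply: lerD; [exact: hC|exact: hC'].
    exact: e01.
  have hB l : `|B Phi l k - B Psi l k| < r.
    apply: le_lt_trans (ler_norm_enorm _) _; apply: lt_trans er.
    apply: le_lt_trans (hd l x0 Kx0).2.
    have [C [_ hC]] := bnd _ l hPhi; have [C' [_ hC']] := bnd _ l hPsi.
    apply: (@le_opnorm2 _ _ (fun u v => diff2 (fin (Phi l)) x0 u v - diff2 (fin (Psi l)) x0 u v) (C + C')) => [u v hu hv||].
    - by apply: le_trans (ler_enormB _ _) _; apply: lerD; [exact: hC|exact: hC'].
    - exact: e01.
    - exact: e01.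
  have : F (D Psi) != 0.
    apply: hr; split; [split; [split|]|]; rewrite -ball_normE /=.
    - exact: hB.
    - exact: hA.
    - exact: hA.
    - exact: hB.
  by rewrite Deq // hij subrr !mul0r eqxx.
(* There are finitely many pairs of indices, so one radius serves all of them. *)
have : \forall e \near (0 : R)^'+, forall ij : 'I_N * 'I_N, ij.1 <> ij.2 ->
    forall Psi, cifs Omega Omega' Psi -> (d2 Omega Phi Psi < e%:E)%E ->
    pole (Psi ij.1) <> pole (Psi ij.2).
  by apply: filter_forall => -[i j]; exact: key.
move=> /(filterI (nbhs_right_gt (0 : R))) /filter_ex[e [/= e_gt0 he]].
exists e => // Psi hPsi hd; split=> // i j ij.
exact: (he (i, j)).
Unshelve. all: by end_near. Qed.

End Openness.

(** * Perturbations *)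

Section PerturbedMap.
Variables (R : realType) (d : nat).
Implicit Types (f : hat R d -> hat R d) (x u v : 'rV[R]_d).

Lemma fin_similarity_comp f l O b x : f (Some x) <> None ->
  fin (similarity l O b \o f) x = l *: (fin f x *m O^T) + b.
Proof. by rewrite /fin /=; case: (f (Some x)). Qed.

Lemma scale_mulmx_comp (l l' : R) (O O' : 'M[R]_d) u :
  (l * l') *: (u *m (O *m O')^T) = l *: ((l' *: (u *m O'^T)) *m O^T).
Proof. by rewrite -scalemxAl scalerA trmx_mul mulmxA. Qed.

Lemma diff_similarity_comp f l O b x u : nform f -> Some x <> pole f ->
  'd (fin (similarity l O b \o f)) x u = l *: ('d (fin f) x u *m O^T).
Proof.
case=> [l' O' b' l'0 hO' _|l' O' b' q l'0 hO'].
  have E := is_diff_diff (is_diff_similarity l' O' b' x) u.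
  rewrite (similarity_comp l O b l' O' b').
  apply: etrans (is_diff_diff (is_diff_similarity _ _ _ x) u) _.
  exact: etrans (scale_mulmx_comp _ _ _ _ _) (esym (congr1 (fun z => l *: (z *m O^T)) E)).
rewrite pole_inversion => xq.
have {}xq : x != q by apply/eqP => xE; apply: xq; rewrite xE.
have E := is_diff_diff (is_diff_inversion l' O' b' xq) u.
rewrite compA (similarity_comp l O b l' O' b').
apply: etrans (is_diff_diff (is_diff_inversion _ _ _ xq) u) _.
exact: etrans (scale_mulmx_comp _ _ _ _ _) (esym (congr1 (fun z => l *: (z *m O^T)) E)).
Qed.

Lemma diff2_similarity_comp f l O b x u v : nform f -> Some x <> pole f ->
  diff2 (fin (similarity l O b \o f)) x u v = l *: (diff2 (fin f) x u v *m O^T).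
Proof.
case=> [l' O' b' l'0 hO' _|l' O' b' q l'0 hO'].
  have E := diff2_similarity l' O' b' x u v.
  rewrite (similarity_comp l O b l' O' b').
  apply: etrans (diff2_similarity _ _ _ x u v) _.
  by apply: esym; apply: etrans (congr1 (fun z => l *: (z *m O^T)) E) _; rewrite mul0mx scaler0.
rewrite pole_inversion => xq.
have {}xq : x != q by apply/eqP => xE; apply: xq; rewrite xE.
have E := diff2_inversion l' O' b' u v xq.
rewrite compA (similarity_comp l O b l' O' b').
apply: etrans (diff2_inversion _ _ _ u v xq) _.
exact: etrans (scale_mulmx_comp _ _ _ _ _) (esym (congr1 (fun z => l *: (z *m O^T)) E)).
Qed.

Lemma pole_similarity_comp f l O b : nform f ->
  pole (similarity l O b \o f) = pole f.
Proof.
move=> nf; apply: pole_eq => /=; first by rewrite (proj2 (nform_pole _ nf)).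
by move=> z; case E : (f z) => [//|] _; apply/nform_pole.
Qed.

(** Right multiplication by this matrix is the linear part of the similarity minus the identity. *)
Definition mx_defect (l : R) (O : 'M[R]_d) := l *: O^T - 1%:M.

Lemma ler_enorm_mulmx u (M : 'M[R]_d) e : (forall j k, `|M j k| <= e) ->
  enorm (u *m M) <= d%:R * Num.sqrt d%:R * e * enorm u.
Proof.
move=> hM; case: (posnP d) => [d0|d0].
  rewrite enormE dotE big1 ?sqrtr0; first by rewrite [in d%:R]d0 !mul0r.
  by move=> k _; have := ltn_ord k; rewrite {2}d0.
have e0 : 0 <= e by apply: le_trans (hM (Ordinal d0) (Ordinal d0)).
apply: le_trans (ler_enorm_norm _) _.
have -> : d%:R * Num.sqrt d%:R * e * enorm u =
  Num.sqrt d%:R * (d%:R * (enorm u * e)) by ring.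
apply: ler_wpM2l; first exact: sqrtr_ge0.
rewrite [leLHS]/Num.Def.normr /= mx_normrE; apply/bigmax_leP; split.
  by rewrite !mulr_ge0 ?enorm_ge0.
move=> [i k] _ /=; rewrite ord1 mxE; apply: le_trans (ler_norm_sum _ _ _) _.
apply: (@le_trans _ _ (\sum_(j < d) enorm u * e)).
  apply: ler_sum => j _; rewrite normrM ler_pM //; exact: ler_coord_enorm.
by rewrite sumr_const card_ord mulr_natl.
Qed.

(** The first two bounds make the perturbation small in [d2]; the bound on the ratio preserves the
    contraction condition. *)
Lemma near_identity (N : nat) (e : R) : 0 < e ->
  nbhs (@idtuple R d N) [set alpha : afftuple R d N | forall i : 'I_N,
    [/\ forall j k, `|mx_defect (alpha i).1.1 (alpha i).1.2 j k| <= e,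
        enorm (alpha i).2 <= e & (alpha i).1.1 <= 1 + e]].
Proof.
move=> e0; have FF : Filter (nbhs (@idtuple R d N)) by exact: nbhs_filter.
apply: (@filter_forall _ _ (fun i (alpha : afftuple R d N) => [/\ _, _ & _]) _ FF) => i.
have ci : (fun alpha : afftuple R d N => alpha i) @ @idtuple R d N --> ((1, 1%:M, 0) : (R * 'M[R]_d * 'rV[R]_d)%type).
  exact: (@proj_continuous _ (fun=> (R * 'M[R]_d * 'rV[R]_d)%type) i (@idtuple R d N)).
have f1 (U V : topologicalType) : continuous (@fst U V) by move=> p; exact: cvg_fst.
have f2 (U V : topologicalType) : continuous (@snd U V) by move=> p; exact: cvg_snd.
have c1 : (fun alpha : afftuple R d N => (alpha i).1) @ @idtuple R d N --> ((1, 1%:M) : (R * 'M[R]_d)%type).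
  exact: (@cvg_comp _ _ _ _ fst _ _ _ ci (f1 _ _ _)).
have cv : (fun alpha : afftuple R d N => (alpha i).2) @ @idtuple R d N --> (0 : 'rV[R]_d).
  exact: (@cvg_comp _ _ _ _ snd _ _ _ ci (f2 _ _ _)).
have cl : (fun alpha : afftuple R d N => (alpha i).1.1) @ @idtuple R d N --> (1 : R).
  exact: (@cvg_comp _ _ _ _ fst _ _ _ c1 (f1 _ _ _)).
have cO : (fun alpha : afftuple R d N => (alpha i).1.2) @ @idtuple R d N --> (1%:M : 'M[R]_d).
  exact: (@cvg_comp _ _ _ _ snd _ _ _ c1 (f2 _ _ _)).
pose jkP (jk : 'I_d * 'I_d) (alpha : afftuple R d N) :=
  `|mx_defect (alpha i).1.1 (alpha i).1.2 jk.1 jk.2| <= e.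
have h1 : nbhs (@idtuple R d N) [set alpha | forall jk, jkP jk alpha].
  apply: (@filter_forall _ _ jkP _ FF) => -[j k].
  have cjk : (fun alpha : afftuple R d N => (alpha i).1.2 k j) @ @idtuple R d N --> (1%:M : 'M[R]_d) k j.
    apply: (@cvg_comp _ _ _ _ (fun M : 'M[R]_d => M k j) _ _ _ cO).
    exact: coord_continuous.
  have : (fun alpha : afftuple R d N => mx_defect (alpha i).1.1 (alpha i).1.2 j k) @ @idtuple R d N --> (0 : R).
    have H := cvgB (cvgM cl cjk) (cvg_cst ((1%:M : 'M[R]_d) k j)).
    rewrite mul1r subrr in H.
    have -> : (fun alpha : afftuple R d N => mx_defect (alpha i).1.1 (alpha i).1.2 j k) =
       (fun alpha => (alpha i).1.1 * (alpha i).1.2 k j - (1%:M : 'M[R]_d) k j).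
      by apply/funext => alpha; rewrite /mx_defect !mxE eq_sym.
    exact: H.
  by move=> /cvgr0_norm_le; apply.
have h2 : nbhs (@idtuple R d N) [set alpha : afftuple R d N | enorm (alpha i).2 <= e].
  have H : (fun alpha : afftuple R d N => dot (alpha i).2 (alpha i).2) @ @idtuple R d N --> (0 : R).
    by rewrite -(dot0l (0 : 'rV[R]_d)); exact: (cvg_dot cv cv).
  have : nbhs (@idtuple R d N) [set alpha : afftuple R d N |
      `|dot (alpha i).2 (alpha i).2| <= e ^+ 2].
    by move: H => /cvgr0_norm_le; apply; exact: exprn_gt0.
  apply: filterS => alpha /=.
  rewrite ger0_norm ?dot_ge0 // -sqr_enorm.
  by rewrite ler_pXn2r ?nnegrE ?enorm_ge0 // ltW.
have h3 : nbhs (@idtuple R d N) [set alpha : afftuple R d N | (alpha i).1.1 <= 1 + e].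
  by apply: cvgr_le cl _ _; rewrite ltrDl.
by apply: filterS3 h1 h2 h3 => alpha a1 a2 a3; split=> // j k; exact: (a1 (j, k)).
Qed.

End PerturbedMap.

(** * Uniform margins and bounds over the closure of the domain *)

Section Perturbation.
Variables (R : realType) (d N : nat).
Implicit Types (f : hat R d -> hat R d) (x u v : 'rV[R]_d)
  (Phi : 'I_N -> hat R d -> hat R d) (K Omega : set 'rV[R]_d).

Lemma nform_differentiable f x : nform f -> Some x <> pole f ->
  differentiable (fin f) x.
Proof.
case=> [l O b l0 hO|l O b q l0 hO].
  by move=> _; exact: (ex_diff (is_diff_def := is_diff_similarity l O b x)).
rewrite pole_inversion => xq.
have {}xq : x != q by apply/eqP => xE; apply: xq; rewrite xE.
exact: (ex_diff (is_diff_def := is_diff_inversion l O b xq)).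
Qed.

Lemma pole_weight_continuous (p : hat R d) x : Some x <> p ->
  {for x, continuous (pole_weight p)}.
Proof.
case: p => [q|] xq; last exact: (@cst_continuous _ _ (1 : R) x).
have {}xq : dot (x - q) (x - q) != 0.
  by rewrite dot_eq0 subr_eq0; apply/eqP => xE; apply: xq; rewrite xE.
apply: differentiable_continuous.
exact: (ex_diff (is_diff_def := is_diff_funV (is_diff_fun_sqdist q x) xq)).
Qed.

(** Compactness makes the distance of the image to the complement of Omega uniform. Stated as a
    property of small e, it can be intersected over the finitely many generators. *)
Lemma compact_image_margin f K Omega : nform f ->
  (forall x, K x -> Some x <> pole f) -> compact K -> open Omega ->
  (forall x, K x -> Omega (fin f x)) ->
  \forall e \near (0 : R)^'+,
    forall x, K x -> forall y, enorm (y - fin f x) < e -> Omega y.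
Proof.
move=> nf hK cK oO hO.
apply: ((iffLR (compact_near_coveringP K)) cK R (0^'+)
  (fun e x => forall y, enorm (y - fin f x) < e -> Omega y)) => x Kx.
have [r /= r0 hr] : nbhs_ball (fin f x) Omega.
  by apply/nbhs_ballP; apply: open_nbhs_nbhs; split; [exact: oO|exact: hO].
have cf := differentiable_continuous (nform_differentiable nf (hK x Kx)).
have r2 : 0 < r / 2 by rewrite divr_gt0.
have h1 : nbhs x [set x' | `|fin f x - fin f x'| < r / 2].
  by move/cvgr_dist_lt : cf; apply.
exists ([set x' | `|fin f x - fin f x'| < r / 2], [set e | e < r / 2]).
  by split=> //=; exact: nbhs_right_lt.
move=> [x' e] /= [hx' he] y hy; apply: hr; rewrite -ball_normE /=.
rewrite -(subrK (fin f x') (fin f x)) -addrA (splitr r).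
apply: le_lt_trans (ler_normD _ _) _; apply: ltrD => //.
rewrite -normrN opprB; apply: le_lt_trans (ler_norm_enorm _) _.
exact: lt_trans hy he.
Qed.

(** The norm of the differential is replaced by its explicit value, a constant times [pole_weight],
    which is continuous off the pole; compactness then gives the uniform gap. *)
Lemma compact_opnorm_margin f K : (0 < d)%N -> nform f ->
  (forall x, K x -> Some x <> pole f) -> compact K ->
  (forall x, K x -> opnorm ('d (fin f) x) < 1) ->
  \forall e \near (0 : R)^'+, forall x, K x -> opnorm ('d (fin f) x) < 1 - e.
Proof.
move=> d0 nf hK cK h1; have [l l0 hl] := nform_opnorm d0 nf.
have : \forall e \near (0 : R)^'+, K `<=` [set x | l * pole_weight (pole f) x < 1 - e].
  apply: ((iffLR (compact_near_coveringP K)) cK R (0^'+)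
    (fun e x => l * pole_weight (pole f) x < 1 - e)) => x Kx.
  have := h1 x Kx; rewrite hl //; last exact: hK.
  set m := l * _ => m1; have m2 : 0 < (1 - m) / 2 by lra.
  have mE : (1 + m) / 2 = m + (1 - m) / 2 by lra.
  have cw : l * pole_weight (pole f) y @[y --> x] --> m.
    exact: (cvgM (cvg_cst l) (pole_weight_continuous (hK x Kx))).
  have hw : nbhs x [set y | l * pole_weight (pole f) y < (1 + m) / 2].
    by apply: cvgr_lt cw _ _; lra.
  exists ([set y | l * pole_weight (pole f) y < (1 + m) / 2], [set e | e < (1 - m) / 2]).
    by split=> //=; exact: nbhs_right_lt.
  by move=> [y e] /= [hy he]; lra.
by apply: filterS => e he x Kx; rewrite hl; [exact: he|exact: hK].
Qed.

Lemma perturb_fin_dist f l O b x e C : f (Some x) <> None ->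
  (forall j k, `|mx_defect l O j k| <= e) -> enorm b <= e ->
  enorm (fin f x) <= C ->
  enorm (fin (similarity l O b \o f) x - fin f x) <=
    e * (d%:R * Num.sqrt d%:R * C + 1).
Proof.
move=> hf hM hb hC; rewrite fin_similarity_comp //.
have -> : l *: (fin f x *m O^T) + b - fin f x = fin f x *m mx_defect l O + b.
  by rewrite /mx_defect mulmxBr mulmx1 -scalemxAr addrAC.
apply: le_trans (ler_enormD _ _) _; rewrite mulrDr mulr1; apply: lerD => //.
apply: le_trans (ler_enorm_mulmx _ hM) _; rewrite mulrAC [leRHS]mulrC.
rewrite -!mulrA ler_wpM2l // ler_wpM2l ?sqrtr_ge0 // ler_wpM2r //.
exact: le_trans (enorm_ge0 _) hb.
Qed.

Lemma scale_mulmx_defect l (O : 'M[R]_d) (z : 'rV[R]_d) e C : 0 <= e ->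
  (forall j k, `|mx_defect l O j k| <= e) -> enorm z <= C ->
  enorm (l *: (z *m O^T) - z) <= e * (d%:R * Num.sqrt d%:R * C + 1).
Proof.
move=> e0 hM hC.
have -> : l *: (z *m O^T) - z = z *m mx_defect l O.
  by rewrite /mx_defect mulmxBr mulmx1 -scalemxAr.
apply: le_trans (ler_enorm_mulmx _ hM) _; rewrite mulrAC mulrC ler_wpM2l //.
apply: (@le_trans _ _ (d%:R * Num.sqrt d%:R * C)); last by rewrite lerDl.
by rewrite ler_wpM2l // mulr_ge0 ?sqrtr_ge0.
Qed.

Lemma cifs_pole Phi Omega (Omega' : set 'rV[R]_d) i x : closure Omega `<=` Omega' ->
  cifs Omega Omega' Phi -> closure Omega x -> Some x <> pole (Phi i).
Proof.
move=> hsub hPhi Kx /nform_pole-/(_ (cifs_nform i hPhi)).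
by have [_ h _ _] := hPhi i; apply: h; exact: hsub.
Qed.

Lemma cifs_fin Phi Omega (Omega' : set 'rV[R]_d) i x :
  cifs Omega Omega' Phi -> closure Omega x -> Omega (fin (Phi i) x).
Proof.
by move=> /(_ i)[_ _ h _] /h[y Oy E]; rewrite /fin E.
Qed.

(** Values are bounded because the closure is mapped into the bounded Omega; the finitely many
    bounds on derivatives are added up into one constant. *)
Lemma cifs_bounded Phi Omega (Omega' : set 'rV[R]_d) : bounded_set Omega ->
  closure Omega `<=` Omega' -> cifs Omega Omega' Phi ->
  exists2 C, 0 <= C & forall i x, closure Omega x ->
   [/\ enorm (fin (Phi i) x) <= C,
    (forall u, enorm u <= 1 -> enorm ('d (fin (Phi i)) x u) <= C) &
    (forall u v, enorm u <= 1 -> enorm v <= 1 ->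
       enorm (diff2 (fin (Phi i)) x u v) <= C)].
Proof.
move=> [M [_ hM]] hsub hPhi.
have M1 y : Omega y -> enorm y <= Num.sqrt d%:R * (`|M| + 1).
  move=> Oy; apply: le_trans (ler_enorm_norm _) _.
  rewrite ler_wpM2l ?sqrtr_ge0 //; apply: (hM (`|M| + 1)) => //.
  by rewrite (le_lt_trans (ler_norm _)) // ltrDl.
have M0 : 0 <= Num.sqrt d%:R * (`|M| + 1) :> R.
  by rewrite mulr_ge0 ?sqrtr_ge0 ?addr_ge0.
have /choice[C hC] : forall i : 'I_N, exists C, 0 <= C /\
    forall x, closure Omega x ->
     (forall u, enorm u <= 1 -> enorm ('d (fin (Phi i)) x u) <= C) /\
     (forall u v, enorm u <= 1 -> enorm v <= 1 ->
       enorm (diff2 (fin (Phi i)) x u v) <= C).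
  move=> i; have [|C C0 hC] := nform_bounded (cifs_nform i hPhi) (@closed_closure _ Omega).
    by move=> x Kx; exact: cifs_pole hsub hPhi Kx.
  by exists C.
have Cle i : C i <= Num.sqrt d%:R * (`|M| + 1) + \sum_j C j.
  rewrite (bigD1 i) //= addrCA lerDl addr_ge0 // sumr_ge0 // => j _.
  by have [] := hC j.
exists (Num.sqrt d%:R * (`|M| + 1) + \sum_j C j).
  by rewrite addr_ge0 // sumr_ge0 // => j _; have [] := hC j.
move=> i x Kx; have [_ /(_ x Kx)[h1 h2]] := hC i; split.
- apply: le_trans (M1 _ (cifs_fin i hPhi Kx)) _.
  by rewrite lerDl sumr_ge0 // => j _; have [] := hC j.
- by move=> u hu; apply: le_trans (h1 u hu) _.
- by move=> u v hu hv; apply: le_trans (h2 u v hu hv) _.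
Qed.

(** Post-composition changes f and its derivatives by their product with the defect matrix, and f
    also by the translation; with everything bounded on the closure, the change is linear in e. *)
Lemma perturb_d2_le Phi Omega (Omega' : set 'rV[R]_d) : bounded_set Omega ->
  closure Omega `<=` Omega' -> cifs Omega Omega' Phi ->
  exists2 C, 0 < C & forall e (alpha : afftuple R d N), 0 <= e ->
   (forall i : 'I_N, [/\ forall j k, `|mx_defect (alpha i).1.1 (alpha i).1.2 j k| <= e,
        enorm (alpha i).2 <= e & (alpha i).1.1 <= 1 + e]) ->
   forall i x, closure Omega x ->
  [/\ enorm (fin (perturb alpha Phi i) x - fin (Phi i) x) <= e * C,
  opnorm (fun u => 'd (fin (perturb alpha Phi i)) x u - 'd (fin (Phi i)) x u) <= e * C &
  opnorm2 (fun u v => diff2 (fin (perturb alpha Phi i)) x u v - diff2 (fin (Phi i)) x u v) <= e * C].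
Proof.
move=> hb hsub hPhi; have [C C0 hC] := cifs_bounded hb hsub hPhi.
exists (d%:R * Num.sqrt d%:R * C + 1).
  by rewrite ltr_wpDl // !mulr_ge0 ?sqrtr_ge0.
move=> e alpha e0 hal i x Kx; have [hM hv _] := hal i.
have [c1 c2 c3] := hC i x Kx.
have np := cifs_pole (i := i) hsub hPhi Kx.
have nf := cifs_nform i hPhi.
split.
- apply: perturb_fin_dist => //; have [_ h _ _] := hPhi i; exact: h (hsub _ Kx).
- apply: opnorm_le => u hu.
  have E := diff_similarity_comp (alpha i).1.1 (alpha i).1.2 (alpha i).2 u nf np.
  have := scale_mulmx_defect e0 hM (c2 u hu).
  by apply: le_trans; apply: eqr_le; congr (enorm (_ - _)).
- apply: opnorm2_le => u v hu hv'.
  have E := diff2_similarity_comp (alpha i).1.1 (alpha i).1.2 (alpha i).2 u v nf np.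
  have := scale_mulmx_defect e0 hM (c3 u v hu hv').
  by apply: le_trans; apply: eqr_le; congr (enorm (_ - _)).
Qed.

End Perturbation.

(** * Perturbed systems near the identity tuple *)

Section PerturbationLimits.
Variables (R : realType) (d N : nat).
Implicit Types (Phi : 'I_N -> hat R d -> hat R d) (Omega : set 'rV[R]_d).

Lemma opnormBC (L L' : 'rV[R]_d -> 'rV[R]_d) :
  opnorm (fun u => L u - L' u) = opnorm (fun u => L' u - L u).
Proof. by rewrite /opnorm; congr sup; apply: eq_imagel => u _; exact: enormBC. Qed.

Lemma opnorm2BC (B B' : 'rV[R]_d -> 'rV[R]_d -> 'rV[R]_d) :
  opnorm2 (fun u v => B u v - B' u v) = opnorm2 (fun u v => B' u v - B u v).
Proof.
rewrite /opnorm2; congr sup; apply/seteqP.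
by split=> _ [u hu [v hv <-]]; exists u => //; exists v => //; exact: enormBC.
Qed.

Lemma d2C Phi Psi Omega : d2 Omega Phi Psi = d2 Omega Psi Phi.
Proof.
apply: eq_bigr => i _.
have h0 : dist0 (closure Omega) (fin (Phi i)) (fin (Psi i)) =
    dist0 (closure Omega) (fin (Psi i)) (fin (Phi i)).
  by congr (supnorm _ _); apply/funext => x; exact: enormBC.
have h1 : dist1 (closure Omega) (fin (Phi i)) (fin (Psi i)) =
    dist1 (closure Omega) (fin (Psi i)) (fin (Phi i)).
  apply: (congr1 (supnorm _)); apply/funext => x.
  exact (opnormBC ('d (fin (Phi i)) x) ('d (fin (Psi i)) x)).
have h2 : dist2 (closure Omega) (fin (Phi i)) (fin (Psi i)) =
    dist2 (closure Omega) (fin (Psi i)) (fin (Phi i)).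
  apply: (congr1 (supnorm _)); apply/funext => x.
  exact (opnorm2BC (diff2 (fin (Phi i)) x) (diff2 (fin (Psi i)) x)).
exact: (congr2 adde (congr2 adde h0 h1) h2).
Qed.

Lemma d2_ge0 Phi Psi Omega : (0 <= d2 Omega Phi Psi)%E.
Proof. exact: bigmax_ge_id. Qed.

Lemma near_perturb_d2 Phi Omega (Omega' : set 'rV[R]_d) (e : R) :
  bounded_set Omega -> closure Omega `<=` Omega' -> cifs Omega Omega' Phi -> 0 < e ->
  nbhs (@idtuple R d N) [set alpha | (d2 Omega (perturb alpha Phi) Phi <= e%:E)%E].
Proof.
move=> hb hsub hPhi e0.
have FF : Filter (nbhs (@idtuple R d N)) by exact: nbhs_filter.
have [C C0 hC] := perturb_d2_le hb hsub hPhi.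
have d0 : 0 < e / (C *+ 3) by rewrite divr_gt0 // pmulrn_lgt0.
apply: filterS (near_identity d N d0) => alpha hal /=.
have -> : e = (e / (C *+ 3) * C) *+ 3 by field; rewrite gt_eqF.
apply: d2_le; first by rewrite mulr_ge0 // ltW.
by apply: hC => //; exact: ltW.
Qed.

Lemma perturb_cvg Phi Omega (Omega' : set 'rV[R]_d) :
  bounded_set Omega -> closure Omega `<=` Omega' -> cifs Omega Omega' Phi ->
  d2 Omega (perturb alpha Phi) Phi @[alpha --> @nbhs_id R d N] --> 0%E.
Proof.
move=> hb hsub hPhi.
have FF : Filter (nbhs (@idtuple R d N)) by exact: nbhs_filter.
have FI : Filter (@nbhs_id R d N) by exact: within_filter.
have hn e : 0 < e -> nbhs_id [set alpha | (d2 Omega (perturb alpha Phi) Phi <= e%:E)%E].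
  move=> e0; have := near_perturb_d2 hb hsub hPhi e0.
  by apply: filterS.
apply/fine_cvgP; split.
  apply: filterS (hn 1 ltr01) => alpha /= h.
  by rewrite ge0_fin_numE ?d2_ge0 // (le_lt_trans h) ?ltry.
apply/cvgr0Pnorm_le => e e0; apply: filterS (hn e e0) => alpha /= h.
have fn : d2 Omega (perturb alpha Phi) Phi \is a fin_num.
  by rewrite ge0_fin_numE ?d2_ge0 // (le_lt_trans h) ?ltry.
by rewrite ger0_norm ?fine_ge0 ?d2_ge0 // -lee_fin fineK.
Qed.

Lemma bounded_closure Omega : bounded_set Omega -> bounded_set (closure Omega).
Proof.
move=> [M [Mr hM]]; exists M; split=> // m Mm x Kx.
rewrite /= leNgt; apply/negP => mx.
have r0 : 0 < `|x| - m by rewrite subr_gt0.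
have [y [Oy]] := Kx _ (nbhsx_ballx x _ r0); rewrite -ball_normE /= => xy.
have ym : `|y| <= m by exact: hM Mm _ Oy.
have := ler_normD (x - y) y; rewrite subrK leNgt => /negP; apply.
by rewrite -ltrBrDr (lt_le_trans xy) // lerD2l lerN2.
Qed.

(** Inclusion of the image and contraction both hold with a common margin e on the compact closure;
    parameters within e' of the identity use up less than this margin. *)
Lemma nbhs_perturb_cifs Phi Omega (Omega' : set 'rV[R]_d) : (0 < d)%N -> open Omega ->
  bounded_set Omega -> closure Omega `<=` Omega' -> cifs Omega Omega' Phi ->
  nbhs_id [set alpha : afftuple R d N |
    AsetN alpha /\ cifs Omega Omega' (perturb alpha Phi)].
Proof.
move=> d0 oO hb hsub hPhi.
have [C C0 hC] := perturb_d2_le hb hsub hPhi.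
have np i x : closure Omega x -> Some x <> pole (Phi i).
  exact: cifs_pole hsub hPhi.
have cK : compact (closure Omega).
  apply: bounded_closed_compact; last exact: closed_closure.
  exact: bounded_closure.
have hm : \forall e \near (0 : R)^'+, forall i : 'I_N,
   (forall x, closure Omega x -> forall y, enorm (y - fin (Phi i) x) < e -> Omega y) /\
   (forall x, closure Omega x -> opnorm ('d (fin (Phi i)) x) < 1 - e).
  apply: filter_forall => i; have nf := cifs_nform i hPhi.
  have h1 : forall x, closure Omega x -> opnorm ('d (fin (Phi i)) x) < 1.
    by have [] := hPhi i.
  have m1 := compact_image_margin nf (np i) cK oO (fun x => @cifs_fin _ _ _ _ _ _ i x hPhi).
  have m2 := compact_opnorm_margin d0 nf (np i) cK h1.
  by apply: filterS2 m1 m2.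
move: hm => /(filterI (nbhs_right_gt (0 : R)))/filter_ex[e [/= e0 he]].
(* The bound e / (2C) keeps the displacement below the margin e; the bound e keeps the ratio below 1
   + e. *)
pose e' := Num.min (e / (C *+ 2)) e.
have e'0 : 0 < e' by rewrite lt_min e0 divr_gt0 // pmulrn_lgt0.
have e'e : e' <= e by rewrite ge_min lexx orbT.
have e'C : e' * C < e.
  apply: (@le_lt_trans _ _ (e / (C *+ 2) * C)).
    by apply: ler_wpM2r; [exact: ltW|rewrite ge_min lexx].
  have -> : e / (C *+ 2) * C = e / 2 by field; rewrite gt_eqF.
  by rewrite ltr_pdivrMr // ltr_pMr // ltr1n.
have FF : Filter (nbhs (@idtuple R d N)) by exact: nbhs_filter.
change (nbhs (@idtuple R d N) [set alpha : afftuple R d N |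
  AsetN alpha -> AsetN alpha /\ cifs Omega Omega' (perturb alpha Phi)]).
apply: filterS (near_identity d N e'0) => alpha hal hA; split; first exact: hA.
move=> i.
have [hM hv hl] := hal i; have [l0 hO hdet] := hA i.
have [m1 m2] := he i; have [mob nopo into contr] := hPhi i.
have nf := cifs_nform i hPhi.
split.
- by apply: moebius_comp => //; exact: moebius_similarity.
- by move=> x Ox; rewrite /perturb /=; case: (Phi i (Some x)) (nopo x Ox).
- move=> x Kx; exists (fin (perturb alpha Phi i) x).
    apply: (m1 x Kx); apply: le_lt_trans e'C.
    by have [] := hC e' alpha (ltW e'0) hal i x Kx.
  by rewrite /fin /perturb /=; have [y _ ->] := into x Kx.
(* The ratio is at most 1 + e and the original norm at most 1 - e, and the product 1 - e^2 is below
   1. *)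
- move=> x Kx; apply: (@le_lt_trans _ _ ((1 + e) * (1 - e))); last by nra.
  apply: opnorm_le => u hu.
  have E := diff_similarity_comp (alpha i).1.1 (alpha i).1.2 (alpha i).2 u nf (np i x Kx).
  have -> : enorm ('d (fin (perturb alpha Phi i)) x u) =
      (alpha i).1.1 * enorm ('d (fin (Phi i)) x u).
    apply: etrans (congr1 (@enorm R d) E) _.
    by rewrite enormZ enorm_orth // gtr0_norm.
  apply: ler_pM; [exact: ltW|exact: enorm_ge0| |].
    by apply: le_trans hl _; rewrite lerD2l.
  apply: le_trans (ltW (m2 x Kx)).
  have [D D0 /(_ i x Kx)[_ hD _]] := cifs_bounded hb hsub hPhi.
  exact: (le_opnorm hD hu).
Qed.

End PerturbationLimits.

(** * Ping-pong *)

Section PingPong.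
Variables (R : realType) (d N : nat).
Implicit Types (f : hat R d -> hat R d) (x y c : 'rV[R]_d) (p z : hat R d)
  (Phi : 'I_N -> hat R d -> hat R d).

Definition far c (r : R) z : Prop :=
  if z is Some x then r < enorm (x - c) else True.

(* The preimage of [far c r] under a Moebius map with pole p which, up to
   rotations and the dilation factor L, is an inversion sending infinity to c,
   or a similarity fixing c. *)
Definition pole_region p c (r L : R) z : Prop :=
  match p, z with
  | None, None => True
  | None, Some x => r < L * enorm (x - c)
  | Some q, None => False
  | Some q, Some x => r * enorm (x - q) < L
  end.

(** The factor L is the product of the two ratios and does not involve the translation. Hence, for a
    similarity, the contraction known for the original translation still holds for the new one. *)
Lemma far_preimage f (l : R) (O : 'M[R]_d) : (0 < d)%N -> nform f -> 0 < l ->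
  Defs.orthogonal O ->
  exists L : R, [/\ 0 < L,
    pole f = None -> forall b x, opnorm ('d (fin (similarity l O b \o f)) x) = L
    & forall c, exists v, forall r z, 0 < r ->
        far c r (similarity l O v (f z)) -> pole_region (pole f) c r L z].
Proof.
move=> d0 [l' O' b' l'0 hO'|l' O' b' q l'0 hO'] l0 hO; exists (l * l').
  have hOO := orthogonalM hO hO'.
  split=> [|_ b x|c]; first exact: mulr_gt0.
    rewrite (similarity_comp l O b l' O' b'); apply: opnorm_conformal => // [|u].
      exact/ltW/mulr_gt0.
    have E := is_diff_diff (is_diff_similarity (l * l') (O *m O') (l *: (b' *m O^T) + b) x) u.
    apply: etrans (congr1 (@enorm R d) E) _.
    by rewrite enormZ enorm_orth // gtr0_norm // mulr_gt0.
  (* This translation makes c a fixed point of the composed similarity. *)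
  exists (c - (l * l') *: (c *m (O *m O')^T) - l *: (b' *m O^T)) => r z r0.
  rewrite pole_similarity -[similarity l O _ _]/((similarity l O _ \o similarity l' O' b') z).
  rewrite similarity_comp; case: z => [x|] //=.
  have -> : (l * l') *: (x *m (O *m O')^T) + (l *: (b' *m O^T) +
      (c - (l * l') *: (c *m (O *m O')^T) - l *: (b' *m O^T))) - c =
      (l * l') *: ((x - c) *m (O *m O')^T).
    rewrite mulmxBl; move: (x *m _) (c *m _) (b' *m _) => X Y Z.
    by apply/rowP => k; rewrite !mxE; ring.
  by rewrite enormZ enorm_orth // gtr0_norm // mulr_gt0.
have hOO := orthogonalM hO hO'.
rewrite pole_inversion; split=> // [|c]; first exact: mulr_gt0.
(* The inversion sends infinity to q, and this translation makes the similarity send q to c. *)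
exists (c - (l * l') *: (q *m (O *m O')^T) - l *: (b' *m O^T)) => r z r0.
set S := similarity l O _.
rewrite -[S _]/((S \o similarity l' O' b') (inversion q 1 z)) /S similarity_comp {S}.
have E y : (l * l') *: (y *m (O *m O')^T) + (l *: (b' *m O^T) +
    (c - (l * l') *: (q *m (O *m O')^T) - l *: (b' *m O^T))) - c =
    (l * l') *: ((y - q) *m (O *m O')^T).
  rewrite mulmxBl; move: (y *m _) (q *m _) (b' *m _) => X Y Z.
  by apply/rowP => k; rewrite !mxE; ring.
case: z => [x|] /=; last first.
  by rewrite E subrr mul0mx scaler0 enorm0 ltNge ltW.
case: eqP => [->|/eqP xq] /=; first by rewrite subrr enorm0 mulr0 => _; exact: mulr_gt0.
have x0 : 0 < enorm (x - q) by rewrite enorm_gt0 subr_eq0.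
rewrite E enormZ enorm_orth // (gtr0_norm (mulr_gt0 l0 l'0)).
rewrite addrAC subrr add0r enormZ expr1n ger0_norm; last first.
  by rewrite divr_ge0 // sqr_ge0.
have -> : 1 / enorm (x - q) ^+ 2 * enorm (x - q) = (enorm (x - q))^-1.
  by field; rewrite gt_eqF.
by rewrite ltr_pdivlMr.
Qed.

Lemma near_pinfty_affine (a b : R) : 0 < a -> \forall t \near +oo, 0 <= a * t + b.
Proof.
move=> a0; near=> t.
have : - b / a <= t by near: t; apply: nbhs_pinfty_ge; exact: num_real.
by rewrite ler_pdivrMr // => h; lra.
Unshelve. all: by end_near. Qed.

(** The centre c = t e_1 goes to infinity, with r = t - Q - 2 and Q a bound for the finite poles.
    The finite poles then own disjoint small balls inside the ball of radius Q + 1 about 0. The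
    region of a similarity is a neighbourhood of infinity; as the ratio is below 1, it lies far from
    c and, for large t, avoids that ball. *)
Lemma pole_regions (p : 'I_N -> hat R d) (L : 'I_N -> R) : (0 < d)%N ->
  (forall i, 0 < L i) -> (forall i, p i = None -> L i < 1) ->
  (forall i j, i <> j -> p i <> p j) ->
  exists c r, [/\ 0 < r,
    forall i z, pole_region (p i) c r (L i) z -> far c r z
    & forall i j z, i <> j ->
        pole_region (p i) c r (L i) z -> ~ pole_region (p j) c r (L j) z].
Proof.
move=> d0 L0 L1 pinj.
pose Q := \sum_i (if p i is Some q then enorm q else 0).
have Qle i q : p i = Some q -> enorm q <= Q.
  move=> E; rewrite /Q (bigD1 i) //= E lerDl sumr_ge0 // => j _.
  by case: (p j) => // a; exact: enorm_ge0.
(* This gives r >= 1. *)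
have ht0 : \forall t \near +oo, 0 <= 1 * t + (- Q - 2 - 1).
  exact: near_pinfty_affine.
(* In terms of r = t - Q - 2: r >= L puts the region of a finite pole in its unit ball; r >= L (t +
   Q + 1) keeps the region of a similarity off the ball of radius Q + 1; |q - q'| r >= L_i + L_j
   separates the balls around two finite poles. *)
have : \forall t \near +oo, forall ij : 'I_N * 'I_N,
   [/\ 0 <= 1 * t + (- Q - 2 - L ij.1),
    p ij.1 = None -> 0 <= (1 - L ij.1) * t + (- Q - 2 - L ij.1 * (Q + 1)) &
    forall q q', p ij.1 = Some q -> p ij.2 = Some q' -> ij.1 <> ij.2 ->
      0 <= enorm (q - q') * t + (enorm (q - q') * (- Q - 2) - (L ij.1 + L ij.2))].
  apply: filter_forall => -[i j] /=.
  have h1 := near_pinfty_affine (- Q - 2 - L i) (@ltr01 R).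
  have h2 : \forall t \near +oo, p i = None ->
      0 <= (1 - L i) * t + (- Q - 2 - L i * (Q + 1)).
    case E : (p i) => [q|]; first exact: nearW.
    have h : 0 < 1 - L i by rewrite subr_gt0; exact: L1.
    by apply: filterS (near_pinfty_affine (- Q - 2 - L i * (Q + 1)) h) => t ht _.
  have h3 : \forall t \near +oo, forall q q', p i = Some q -> p j = Some q' -> i <> j ->
      0 <= enorm (q - q') * t + (enorm (q - q') * (- Q - 2) - (L i + L j)).
    case Ei : (p i) => [q|]; last exact: nearW.
    case Ej : (p j) => [q'|]; last exact: nearW.
    have [->|/eqP ij] := eqVneq i j; first exact: nearW.
    have qq' : 0 < enorm (q - q').
      rewrite enorm_gt0 subr_eq0; apply/eqP => qE.
      by apply: (pinj i j ij); rewrite Ei Ej qE.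
    apply: filterS (near_pinfty_affine (enorm (q - q') * (- Q - 2) - (L i + L j)) qq').
    by move=> t ht a b [<-] [<-].
  by apply: filterS3 h1 h2 h3.
move=> /(filterI ht0)/filter_ex[t [t0 ht]].
have Q0 : 0 <= Q.
  by apply: sumr_ge0 => i _; case: (p i) => // a; exact: enorm_ge0.
pose c : 'rV[R]_d := t *: delta_mx 0 (Ordinal d0).
have ec : enorm c = t.
  by rewrite enormZ enorm_delta mulr1 ger0_norm //; lra.
have r0 : 0 < t - Q - 2 by lra.
have fin_region i q x : p i = Some q -> pole_region (p i) c (t - Q - 2) (L i) (Some x) ->
    enorm (x - q) < 1 /\ enorm q <= Q.
  move=> E; rewrite E /= => h; split; last exact: Qle E.
  have [h1 _ _] := ht (i, i); rewrite /= in h1.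
  rewrite -(ltr_pM2l r0) mulr1; apply: lt_le_trans h _; lra.
exists c, (t - Q - 2); split=> // [i z|i j z ij].
  case Ei : (p i) => [q|]; case: z => [x|] //.
    rewrite -Ei => /(fin_region _ _ _ Ei)[h1 h2] /=.
    have := ler_enorm_dist c q; have := ler_enorm_dist (c - q) (x - q).
    by rewrite opprB addrA subrK (enormBC c x); lra.
  move=> /= /lt_le_trans; apply; rewrite -[leRHS]mul1r.
  by apply: ler_wpM2r; [exact: enorm_ge0|exact/ltW/L1].
case Ei : (p i) => [q|]; case Ej : (p j) => [q'|]; case: z => [x|] //.
- move=> /= h h'.
  have [_ _ /(_ q q' Ei Ej ij) hq] := ht (i, j); rewrite /= in hq.
  have := ler_enormD (q - x) (x - q'); rewrite addrA subrK (enormBC q x) => hd.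
  have := ler_wpM2l (ltW r0) hd; rewrite mulrDr; nra.
- move=> + h; rewrite -Ei => /(fin_region _ _ _ Ei)[h1 h2]; move: h => /=.
  have [_ /(_ Ej) h3 _] := ht (j, i); rewrite /= in h3.
  have := ler_enormD (x - q) (q - c); rewrite addrA subrK.
  have := ler_enormB q c; rewrite ec => h4 h5 h6.
  have := ler_wpM2l (ltW (L0 j)) (le_trans h5 (lerD (ltW h1) (le_trans h4 (lerD h2 (lexx _))))).
  nra.
- move=> + h; rewrite -Ej in h; have [h1 h2] := fin_region _ _ _ Ej h; move=> /=.
  have [_ /(_ Ei) h3 _] := ht (i, j); rewrite /= in h3.
  have := ler_enormD (x - q') (q' - c); rewrite addrA subrK.
  have := ler_enormB q' c; rewrite ec => h4 h5 h6.
  have := ler_wpM2l (ltW (L0 i)) (le_trans h5 (lerD (ltW h1) (le_trans h4 (lerD h2 (lexx _))))).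
  nra.
- by move=> _ [].
- by move=> _ _; apply: (pinj i j ij); rewrite Ei Ej.
- by move=> _ _; apply: (pinj i j ij); rewrite Ei Ej.
Unshelve. all: by end_near. Qed.

Lemma pole_fword_cons Phi i s : (forall i, nform (Phi i)) ->
  Phi i (pole (fword Phi (i :: s))) = pole (fword Phi s).
Proof.
move=> nf; apply/nform_pole; first exact: nform_fword.
have h : fword Phi (i :: s) (pole (fword Phi (i :: s))) = None.
  by apply/nform_pole => //; exact: nform_fword.
by move: h; rewrite {1}fword_cons.
Qed.

Lemma pole_nil Phi : pole (fword Phi [::]) = None.
Proof. by rewrite /fword /= -similarity1 pole_similarity. Qed.

Definition with_translations (alpha : afftuple R d N) (v : 'I_N -> 'rV[R]_d) :
  afftuple R d N := fun i => ((alpha i).1, v i).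

(** A similarity has a differential of constant norm, so contraction at one point already gives the
    ratio below 1 that ping-pong needs. The translations found serve all pairs of words at once. *)
Lemma exists_translations Phi (alpha : afftuple R d N) :
  (0 < d)%N -> (forall i, nform (Phi i)) -> AsetN alpha ->
  (forall i, exists x, opnorm ('d (fin (perturb alpha Phi i)) x) < 1) ->
  (forall i j, i <> j -> pole (Phi i) <> pole (Phi j)) ->
  exists v, forall s t, Zpairs (FinWord s, FinWord t) ->
    pole (fword (perturb (with_translations alpha v) Phi) s) <>
    pole (fword (perturb (with_translations alpha v) Phi) t).
Proof.
move=> d0 nf hA hop pinj.
have /choice[L hL] := fun i => far_preimage d0 (nf i) (let: And3 l0 _ _ := hA i in l0)
   (let: And3 _ hO _ := hA i in hO).
have [||c [r [r0 hfar hdisj]]] := @pole_regions (fun i => pole (Phi i)) L d0 _ _ pinj.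
- by move=> i; have [] := hL i.
- move=> i pi; have [_ /(_ pi (alpha i).2) hx _] := hL i.
  have [x hx1] := hop i; have := hx x; rewrite -/(perturb alpha Phi i).
  by move=> <-.
have /choice[v hv] : forall i, exists v, forall z,
    far c r (similarity (alpha i).1.1 (alpha i).1.2 v (Phi i z)) ->
    pole_region (pole (Phi i)) c r (L i) z.
  by move=> i; have [_ _ /(_ c)[v hv]] := hL i; exists v => z; exact: hv.
exists v; set Psi := perturb _ _.
have nP i : nform (Psi i).
  by have [l0 hO _] := hA i; exact: nform_comp_similarity.
(* The induction starts at the pole infinity of the empty word, which is far from every c. *)
have hreg s : far c r (pole (fword Psi s)) /\ forall i,
    pole_region (pole (Phi i)) c r (L i) (pole (fword Psi (i :: s))).
  have step s' : far c r (pole (fword Psi s')) -> forall i,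
      pole_region (pole (Phi i)) c r (L i) (pole (fword Psi (i :: s'))).
    move=> h i; apply: hv; move: h; rewrite -(pole_fword_cons i s' nP).
    by [].
  elim: s => [|j s [_ IH]]; first by rewrite pole_nil; split=> //; apply: step; rewrite pole_nil.
  have h : far c r (pole (fword Psi (j :: s))) by exact: hfar (IH j).
  by split=> //; exact: step.
move=> [|i s] [|j t] [] //= _ _ ij E.
have ij' : i <> j by move=> ij'; apply: ij; rewrite ij'.
apply: (hdisj i j (pole (fword Psi (i :: s))) ij'); first exact: (hreg s).2.
by rewrite E; exact: (hreg t).2.
Qed.

End PingPong.

(** * Polynomials in the parameters *)

Section Polynomials.
Variables (R : realType) (d N : nat).
Local Notation AN := (afftuple R d N).

Inductive affcoord :=
| CoordL of 'I_N
| CoordO of 'I_N & 'I_d & 'I_d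
| CoordV of 'I_N & 'I_d.

Definition coord_val (c : affcoord) (alpha : AN) : R :=
  match c with
  | CoordL i => (alpha i).1.1
  | CoordO i j k => (alpha i).1.2 j k
  | CoordV i k => (alpha i).2 0 k
  end.

(** Polynomials are kept as syntax, so that evaluation, formal derivatives and restriction to a line
    are structural recursions and derivatives can be iterated. Only translation coordinates are
    differentiated. *)
Inductive pexpr :=
| PConst of R
| PCoord of affcoord
| PAdd of pexpr & pexpr
| PMul of pexpr & pexpr.

Fixpoint peval (e : pexpr) (alpha : AN) : R :=
  match e with
  | PConst c => c
  | PCoord c => coord_val c alpha
  | PAdd e1 e2 => peval e1 alpha + peval e2 alpha
  | PMul e1 e2 => peval e1 alpha * peval e2 alpha
  end.

Fixpoint pderiv (ik : 'I_N * 'I_d) (e : pexpr) : pexpr :=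
  match e with
  | PConst _ => PConst 0
  | PCoord (CoordV j l) => PConst ((j, l) == ik)%:R
  | PCoord _ => PConst 0
  | PAdd e1 e2 => PAdd (pderiv ik e1) (pderiv ik e2)
  | PMul e1 e2 => PAdd (PMul (pderiv ik e1) e2) (PMul e1 (pderiv ik e2))
  end.

Definition translate (alpha : AN) (w : 'I_N -> 'rV[R]_d) (t : R) : AN :=
  fun i => ((alpha i).1, (alpha i).2 + t *: w i).

(** The restriction of the expression to the line of translations t |-> alpha + t w, as a univariate
    polynomial in t. *)
Fixpoint line_poly (alpha : AN) (w : 'I_N -> 'rV[R]_d) (e : pexpr) : {poly R} :=
  match e with
  | PConst c => c%:P
  | PCoord (CoordV i k) => ((alpha i).2 0 k)%:P + (w i 0 k) *: 'X
  | PCoord c => (coord_val c alpha)%:P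
  | PAdd e1 e2 => line_poly alpha w e1 + line_poly alpha w e2
  | PMul e1 e2 => line_poly alpha w e1 * line_poly alpha w e2
  end.

Lemma line_polyE alpha w e t :
  (line_poly alpha w e).[t] = peval e (translate alpha w t).
Proof.
elim: e => [c|c|e1 IH1 e2 IH2|e1 IH1 e2 IH2] /=; rewrite ?hornerE //=.
- case: c => [i|i j k|i k] /=; rewrite ?hornerE //.
  by rewrite !mxE mulrC.
- by rewrite IH1 IH2.
- by rewrite IH1 IH2.
Qed.

Lemma line_poly_deriv alpha w e :
  (line_poly alpha w e)^`() =
  \sum_ik (w ik.1 0 ik.2) *: line_poly alpha w (pderiv ik e).
Proof.
elim: e => [c|c|e1 IH1 e2 IH2|e1 IH1 e2 IH2] /=.
- by rewrite derivC big1 // => ik _; rewrite polyC0 scaler0.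
- case: c => [i|i j k|i k] /=; rewrite ?derivC.
  + by rewrite big1 // => ik _; rewrite polyC0 scaler0.
  + by rewrite big1 // => ik _; rewrite polyC0 scaler0.
  rewrite derivD derivC add0r derivZ derivX (bigD1 (i, k)) //= eqxx.
  rewrite big1 ?addr0 // => ik; rewrite eq_sym => /negbTE ->.
  by rewrite polyC0 scaler0.
- by rewrite derivD IH1 IH2 -big_split; apply: eq_bigr => ik _; rewrite scalerDr.
- rewrite derivM IH1 IH2 mulr_suml mulr_sumr -big_split.
  by apply: eq_bigr => ik _; rewrite scalerDr scalerAl scalerAr.
Qed.

(** The derivatives at 0 of the restriction to the line are linear combinations of iterated
    translation derivatives at alpha. If all of these vanished, the restriction would be the zero
    polynomial, against its value at t = 1. *)
Lemma jet_neq0 alpha w e : peval e (translate alpha w 1) != 0 ->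
  exists b : seq ('I_N * 'I_d), peval (foldr pderiv e b) alpha != 0.
Proof.
move=> he; apply: contrapT => hn.
have jet0 n e' : (forall b, peval (foldr pderiv e' b) alpha = 0) ->
    (line_poly alpha w e')^`(n).[0] = 0.
  elim: n e' => [|n IH] e' h.
    rewrite derivn0 line_polyE.
    suff -> : translate alpha w 0 = alpha by exact: (h [::]).
    apply/funext => i; rewrite /translate scale0r addr0.
    by case: (alpha i).
  rewrite derivSn line_poly_deriv linear_sum horner_sum big1 //= => ik _.
  rewrite linearZ hornerZ IH ?mulr0 // => b.
  by have := h (rcons b ik); rewrite foldr_rcons.
have h0 b : peval (foldr pderiv e b) alpha = 0.
  by apply/eqP; apply: contrapT => hb; apply: hn; exists b; apply/negP.
(* The n-th derivative at 0 is n! times the n-th coefficient. *)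
have p0 : line_poly alpha w e = 0.
  apply/polyP => n; rewrite coef0; have := jet0 n e h0.
  rewrite horner_coef0 coef_derivn addn0 ffactnn => /eqP.
  by rewrite mulrn_eq0 -leqn0 leqNgt fact_gt0 /= => /eqP.
by move: he; rewrite -line_polyE p0 horner0 eqxx.
Qed.

(** Along the successive derivatives listed in b the value at alpha starts at 0 and ends nonzero, so
    some single differentiation passes from zero to nonzero. *)
Lemma exists_transversal_jet alpha w e : peval e alpha = 0 ->
  peval e (translate alpha w 1) != 0 ->
  exists b ik, peval (foldr pderiv e b) alpha = 0 /\
    peval (pderiv ik (foldr pderiv e b)) alpha != 0.
Proof.
move=> e0 /jet_neq0[b]; elim: b => [|ik b IH] /=; first by rewrite e0 eqxx.
move=> h; have [hb|hb] := eqVneq (peval (foldr pderiv e b) alpha) 0.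
  by exists b, ik.
exact: IH.
Qed.

Definition polyfun (F : AN -> R) := exists e, F = peval e.

Lemma polyfun_cst c : polyfun (fun=> c).
Proof. by exists (PConst c). Qed.

Lemma polyfun_coord c : polyfun (coord_val c).
Proof. by exists (PCoord c). Qed.

Lemma polyfunD F G : polyfun F -> polyfun G -> polyfun (fun a => F a + G a).
Proof. by move=> [e ->] [e' ->]; exists (PAdd e e'). Qed.

Lemma polyfunM F G : polyfun F -> polyfun G -> polyfun (fun a => F a * G a).
Proof. by move=> [e ->] [e' ->]; exists (PMul e e'). Qed.

Lemma polyfunB F G : polyfun F -> polyfun G -> polyfun (fun a => F a - G a).
Proof.
move=> hF hG; have := polyfunD hF (polyfunM (polyfun_cst (-1)) hG).
by congr polyfun; apply/funext => a; rewrite mulN1r.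
Qed.

Lemma polyfun_sum (I : Type) (r : seq I) (F : I -> AN -> R) :
  (forall i, polyfun (F i)) -> polyfun (fun a => \sum_(i <- r) F i a).
Proof.
move=> h; elim: r => [|i r IH].
  by under eq_fun do rewrite big_nil; exact: polyfun_cst.
by under eq_fun do rewrite big_cons; exact: polyfunD.
Qed.

Definition polyvec (F : AN -> 'rV[R]_d) := forall k, polyfun (fun a => F a 0 k).

Lemma polyvec_cst v : polyvec (fun=> v).
Proof. by move=> k; exact: polyfun_cst. Qed.

Lemma polyvecD F G : polyvec F -> polyvec G -> polyvec (fun a => F a + G a).
Proof.
move=> hF hG k; have := polyfunD (hF k) (hG k).
by congr polyfun; apply/funext => a; rewrite mxE.
Qed.

Lemma polyvecZ f F : polyfun f -> polyvec F -> polyvec (fun a => f a *: F a).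
Proof.
move=> hf hF k; have := polyfunM hf (hF k).
by congr polyfun; apply/funext => a; rewrite mxE.
Qed.

Lemma polyvecB F G : polyvec F -> polyvec G -> polyvec (fun a => F a - G a).
Proof.
move=> hF hG k; have := polyfunB (hF k) (hG k).
by congr polyfun; apply/funext => a; rewrite !mxE.
Qed.

Lemma polyfun_dot F G : polyvec F -> polyvec G -> polyfun (fun a => dot (F a) (G a)).
Proof.
move=> hF hG; have := polyfun_sum (index_enum 'I_d) (fun k => polyfunM (hF k) (hG k)).
by congr polyfun; apply/funext => a; rewrite dotE.
Qed.

Lemma polyvec_mulmx F (O : AN -> 'M[R]_d) : polyvec F ->
  (forall j k, polyfun (fun a => O a j k)) -> polyvec (fun a => F a *m O a).
Proof.
move=> hF hO k.
have := polyfun_sum (index_enum 'I_d) (fun j => polyfunM (hF j) (hO j k)).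
by congr polyfun; apply/funext => a; rewrite mxE.
Qed.

End Polynomials.

(** * Poles in the light cone model *)

Section HomogeneousCoordinates.
Variables (R : realType) (d N : nat).
Local Notation AN := (afftuple R d N).
Local Notation triple := (R * 'rV[R]_d * R)%type.
Implicit Types (X Y : triple) (z : hat R d).

(* The finite point x has the homogeneous coordinates (1, x, |x|^2), the point
   at infinity (0, 0, 1): the light cone model of the conformal sphere. *)
Definition represents X z : Prop :=
  match z with
  | Some x => [/\ X.1.1 != 0, X.1.2 = X.1.1 *: x & X.2 = X.1.1 * dot x x]
  | None => [/\ X.1.1 = 0, X.1.2 = 0 & X.2 != 0]
  end.

(** The Lorentz form whose null vectors are the light cone w u = |x|^2. On representatives of finite
    points x and y it equals w w' |x - y|^2, so its vanishing expresses equality of points, infinity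
    included. *)
Definition lorentz X Y : R := X.1.1 * Y.2 + X.2 * Y.1.1 - 2 * dot X.1.2 Y.1.2.

Lemma lorentz_eq0 X Y z z' : represents X z -> represents Y z' ->
  lorentz X Y = 0 <-> z = z'.
Proof.
rewrite /lorentz; case: z => [x|]; case: z' => [y|] /= [w0 xE uE] [w'0 yE u'E].
- rewrite xE uE yE u'E dotZl dotZr.
  have -> : X.1.1 * (Y.1.1 * dot y y) + X.1.1 * dot x x * Y.1.1 -
      2 * (X.1.1 * (Y.1.1 * dot x y)) =
      X.1.1 * Y.1.1 * dot (x - y) (x - y).
    by rewrite !dot_lin (dotC y x); ring.
  split=> [/eqP|[->]]; last by rewrite subrr dot0l mulr0.
  by rewrite !mulf_eq0 (negbTE w0) (negbTE w'0) /= dot_eq0 subr_eq0 => /eqP ->.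
- rewrite w'0 yE dot0r !mulr0 subr0 addr0; split=> // /eqP.
  by rewrite mulf_eq0 (negbTE w0) (negbTE u'E).
- rewrite w0 xE dot0l mul0r mulr0 subr0 add0r; split=> // /eqP.
  by rewrite mulf_eq0 (negbTE uE) (negbTE w'0).
- by rewrite w0 xE w'0 dot0l !mulr0 mul0r subr0 addr0.
Qed.

(** The lift of the inverse similarity, scaled by l^2 to clear denominators: (w, w y, w |y|^2) with
    y = l x O^T + b goes to l^2 w (1, x, |x|^2). It is polynomial in l, O and b. *)
Definition lift_similarity (l : R) (O : 'M[R]_d) (b : 'rV[R]_d) X : triple :=
  (l * l * X.1.1, l *: ((X.1.2 - X.1.1 *: b) *m O),
   X.2 - 2 * dot X.1.2 b + X.1.1 * dot b b).

Lemma represents_similarity l O b X z : 0 < l -> Defs.orthogonal O ->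
  represents X (similarity l O b z) -> represents (lift_similarity l O b X) z.
Proof.
move=> l0 hO; have l1 : l != 0 by rewrite gt_eqF.
case: z => [x|] /= [w0 xE uE].
  split; first by rewrite !mulf_neq0.
    rewrite xE scalerDr addrK -scalerA scalerA -!scalemxAl -mulmxA (orthogonalK hO).
    rewrite mulmx1 !scalerA; congr (_ *: _); ring.
  rewrite uE xE; set y := x *m O^T.
  have yy : dot y y = dot x x by exact: dot_orth.
  by rewrite !dot_lin yy (dotC b y); ring.
by rewrite w0 xE scale0r subr0 mul0mx scaler0 dot0l !mulr0 mul0r subr0 addr0.
Qed.

(** Translation by -q, exchange of the first and last coordinates, which is the unit inversion at 0,
    and translation back by q. *)
Definition lift_inversion (q : 'rV[R]_d) X : triple :=
  let y := X.1.2 - X.1.1 *: q in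
  let u := X.2 - 2 * dot X.1.2 q + X.1.1 * dot q q in
  (u, y + u *: q, X.1.1 + 2 * dot y q + u * dot q q).

Lemma represents_inversion q X z :
  represents X (inversion q 1 z) -> represents (lift_inversion q X) z.
Proof.
case: z => [x|] /=; last first.
  rewrite /lift_inversion => -[w0 xE uE] /=.
  have u0 : X.2 - 2 * dot X.1.2 q + X.1.1 * dot q q = 0.
    by rewrite xE uE dotZl; ring.
  by rewrite u0 xE subrr scale0r addr0 dot0l mulr0 mul0r !addr0.
rewrite /lift_inversion; case: eqP => [->|/eqP xq] /= [w0 xE uE].
  by rewrite w0 xE scale0r subr0 dot0l !mulr0 !mul0r subr0 !addr0 !add0r.
have n0 : dot (x - q) (x - q) != 0 by rewrite dot_eq0 subr_eq0.
move: xE uE; rewrite expr1n mul1r sqr_enorm; set n := dot (x - q) (x - q) in n0 *.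
set w := X.1.1 in w0 *; move=> xE uE.
have xqE : x = x - q + q by rewrite subrK.
move: (x - q) @n xqE n0 xE uE => y n xqE n0 xE uE.
have u1 : X.2 - 2 * dot X.1.2 q + w * dot q q = w / n.
  by rewrite xE uE !dot_lin /n (dotC q y); field.
rewrite u1; split.
- by rewrite mulf_neq0 // invr_neq0.
- by rewrite xE xqE; apply/rowP => k; rewrite !mxE; field.
- have -> : X.1.2 - w *: q = (w / n) *: y.
    by rewrite xE; apply/rowP => k; rewrite !mxE; field.
  by rewrite xqE -/w !dot_lin (dotC q y) -/n; field.
Qed.

Definition polytriple (F : AN -> triple) :=
  [/\ polyfun (fun a => (F a).1.1), polyvec (fun a => (F a).1.2)
    & polyfun (fun a => (F a).2)].

Lemma polytriple_similarity F (l : AN -> R) (O : AN -> 'M[R]_d) b :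
  polytriple F -> polyfun l -> (forall j k, polyfun (fun a => O a j k)) ->
  polyvec b -> polytriple (fun a => lift_similarity (l a) (O a) (b a) (F a)).
Proof.
move=> [hw hx hu] hl hO hb; split=> /=.
- exact: (polyfunM (polyfunM hl hl) hw).
- exact: (polyvecZ hl (polyvec_mulmx (polyvecB hx (polyvecZ hw hb)) hO)).
- exact: (polyfunD (polyfunB hu (polyfunM (polyfun_cst _ _ 2) (polyfun_dot hx hb)))
          (polyfunM hw (polyfun_dot hb hb))).
Qed.

Lemma polytriple_inversion F q :
  polytriple F -> polytriple (fun a => lift_inversion q (F a)).
Proof.
move=> [hw hx hu]; have hq := polyvec_cst N q.
have hy := polyvecB hx (polyvecZ hw hq).
have hv := polyfunD (polyfunB hu (polyfunM (polyfun_cst _ _ 2) (polyfun_dot hx hq)))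
          (polyfunM hw (polyfun_dot hq hq)).
split=> /=; first exact: hv.
  exact: (polyvecD hy (polyvecZ hv hq)).
exact: (polyfunD (polyfunD hw (polyfunM (polyfun_cst _ _ 2) (polyfun_dot hy hq)))
          (polyfunM hv (polyfun_dot hq hq))).
Qed.

Lemma polytriple_nform F f : nform f -> polytriple F ->
  exists2 G, polytriple G &
    forall a z, represents (F a) (f z) -> represents (G a) z.
Proof.
move=> nf hF; have cO (O : 'M[R]_d) j k : polyfun (fun _ : AN => O j k).
  exact: polyfun_cst.
case: nf => [l O b l0 hO|l O b q l0 hO].
  exists (fun a => lift_similarity l O b (F a)).
    by apply: polytriple_similarity => //; [exact: polyfun_cst|exact: polyvec_cst].
  by move=> a z; exact: represents_similarity.
exists (fun a => lift_inversion q (lift_similarity l O b (F a))).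
  apply: polytriple_inversion.
  by apply: polytriple_similarity => //; [exact: polyfun_cst|exact: polyvec_cst].
move=> a z h; apply: represents_inversion.
exact: represents_similarity.
Qed.

(** The triple is polynomial in all parameters, but represents the pole only on A^N, where
    transposing O inverts it and ratios are positive. *)
Lemma polytriple_pole (Phi : 'I_N -> hat R d -> hat R d) s :
  (forall i, nform (Phi i)) ->
  exists2 F, polytriple F & forall a, AsetN a ->
    represents (F a) (pole (fword (perturb a Phi) s)).
Proof.
move=> nf; elim: s => [|i s [F hF hr]].
  exists (fun=> (0, 0, 1)).
    by split; [exact: polyfun_cst|exact: polyvec_cst|exact: polyfun_cst].
  by move=> a _; rewrite pole_nil /=; split=> //; exact: oner_neq0.
pose F1 (a : AN) := lift_similarity (a i).1.1 (a i).1.2 (a i).2 (F a).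
have hF1 : polytriple F1.
  apply: polytriple_similarity => //.
  - exact: (@polyfun_coord R d N (@CoordL d N i)).
  - by move=> j k; exact: (@polyfun_coord R d N (@CoordO d N i j k)).
  - by move=> k; exact: (@polyfun_coord R d N (@CoordV d N i k)).
have [G hG hGr] := polytriple_nform (nf i) hF1.
exists G => // a ha; apply: hGr; have [l0 hO _] := ha i.
apply: represents_similarity => //.
have nP j : nform (perturb a Phi j).
  by have [l0' hO' _] := ha j; exact: nform_comp_similarity.
have := hr a ha; rewrite -(pole_fword_cons i s nP).
by [].
Qed.

Lemma pole_coincidence_polynomial (Phi : 'I_N -> hat R d -> hat R d) s t :
  (forall i, nform (Phi i)) ->
  exists e : pexpr R d N, forall a, AsetN a -> peval e a = 0 <->
    pole (fword (perturb a Phi) s) = pole (fword (perturb a Phi) t).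
Proof.
move=> nf; have [F [hw hx hu] hF] := polytriple_pole s nf.
have [G [hw' hx' hu'] hG] := polytriple_pole t nf.
have [e he] := polyfunB (polyfunD (polyfunM hw hu') (polyfunM hu hw'))
  (polyfunM (polyfun_cst _ _ 2) (polyfun_dot hx hx')).
exists e => a ha; rewrite -he; exact: lorentz_eq0 (hF a ha) (hG a ha).
Qed.

End HomogeneousCoordinates.

(** * Null sets *)

Section NullSets.
Variables (R : realType) (m : nat).
Hypothesis m_gt0 : (0 < m)%N.
Implicit Types (a b x y : 'rV[R]_m) (E F : set 'rV[R]_m).

Definition volume a b : R := \prod_(i < m) (b 0 i - a 0 i).

Lemma volume_ge0 a b : (forall i, a 0 i <= b 0 i) -> 0 <= volume a b.
Proof. by move=> ab; apply: prodr_ge0 => i _; rewrite subr_ge0. Qed.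

Lemma volume_refl a : volume a a = 0.
Proof.
apply/eqP; rewrite prodf_seq_eq0; apply/hasP; exists (Ordinal m_gt0) => /=.
  exact: mem_index_enum.
by rewrite subrr.
Qed.

(** Bounding all finite partial sums keeps the estimates inside R; the passage to extended sums
    happens once, in the lemma that follows. *)
Definition null E := forall e : R, 0 < e -> exists A B : nat -> 'rV[R]_m,
  [/\ forall k i, A k 0 i <= B k 0 i, E `<=` \bigcup_k box (A k) (B k)
    & forall n, \sum_(0 <= k < n) volume (A k) (B k) <= e].

Lemma null_lebesgue_outer E : null E -> lebesgue_outer E = 0%E.
Proof.
move=> hE; apply/eqP; rewrite eq_le; apply/andP; split; last first.
  apply: le_ereal_inf_tmp => _ [A [B [AB _ ->]]].
  by apply: nneseries_ge0 => k _ _; rewrite lee_fin volume_ge0.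
apply/lee_addgt0Pr => e e0; rewrite add0e.
have [A [B [AB cov hs]]] := hE e e0.
apply: (@le_trans _ _ (\sum_(0 <= k <oo) (volume (A k) (B k))%:E)%E).
  by apply: ereal_inf_lbound; exists A, B.
apply: lime_le.
  by apply: is_cvg_nneseries => k _ _; rewrite lee_fin volume_ge0.
by apply: nearW => n; rewrite sumEFin lee_fin.
Qed.

Lemma null_subset E F : E `<=` F -> null F -> null E.
Proof.
move=> EF hF e e0; have [A [B [AB cov hs]]] := hF e e0.
by exists A, B; split=> //; exact: subset_trans cov.
Qed.

Lemma null_countable_cover E :
  (forall e : R, 0 < e -> exists (I : countType) (A B : I -> 'rV[R]_m),
    [/\ forall k i, A k 0 i <= B k 0 i, E `<=` \bigcup_k box (A k) (B k)
      & forall s, uniq s -> \sum_(k <- s) volume (A k) (B k) <= e]) -> null E.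
Proof.
move=> h e e0; have [I [A [B [AB cov hs]]]] := h e e0.
(* Integers that code no index receive the degenerate box at 0, of volume 0 because m > 0. *)
pose ext (F : I -> 'rV[R]_m) n := if pickle_inv n is Some k then F k else 0.
exists (ext A), (ext B); split.
- by move=> k i; rewrite /ext; case: pickle_inv.
- move=> x /cov[k _ hx]; exists (pickle k) => //.
  by rewrite /ext pickleK_inv.
- move=> n; apply: le_trans (hs (pmap (@pickle_inv I) (iota 0 n)) _).
    rewrite /index_iota subn0; elim: (iota 0 n) => [|k s IH] /=.
      by rewrite !big_nil.
    rewrite big_cons /ext; case: pickle_inv => [i|] /=.
      by rewrite big_cons lerD2l.
    by rewrite volume_refl add0r.
  apply: (pmap_uniq (@pickle_invK I)); exact: iota_uniq.
Qed.

Lemma sum_uniq_le (I : eqType) (s t : seq I) (F : I -> R) : uniq s -> uniq t ->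
  {subset s <= t} -> (forall i, 0 <= F i) ->
  \sum_(i <- s) F i <= \sum_(i <- t) F i.
Proof.
move=> us ut st F0.
have -> : \sum_(i <- s) F i = \sum_(i <- t | i \in s) F i.
  rewrite -[RHS]big_filter (perm_big [seq i <- t | i \in s]) //.
  apply: uniq_perm; rewrite ?filter_uniq // => i.
  by rewrite mem_filter andb_idr //; exact: st.
by rewrite [leRHS](bigID (mem s)) /= lerDl sumr_ge0.
Qed.

(** The i-th set is covered with total volume e / 2^(i+1), where i is read through [pickle]. *)
Lemma null_bigcup (I : countType) (E : I -> set 'rV[R]_m) :
  (forall i, null (E i)) -> null (\bigcup_i E i).
Proof.
move=> hE; apply: null_countable_cover => e e0; exists (I * nat)%type.
have /choice[A /choice[B hAB]] : forall i, exists A B : nat -> 'rV[R]_m,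
  [/\ forall k j, A k 0 j <= B k 0 j, E i `<=` \bigcup_k box (A k) (B k)
    & forall n, \sum_(0 <= k < n) volume (A k) (B k) <= e / 2 ^+ (pickle i).+1].
  by move=> i; apply: hE; rewrite divr_gt0 // exprn_gt0.
have vol0 i k : 0 <= volume (A i k) (B i k).
  by apply: volume_ge0 => j; have [] := hAB i.
exists (fun ik => A ik.1 ik.2), (fun ik => B ik.1 ik.2); split.
- by move=> [i k] j /=; have [] := hAB i.
- move=> x [i _ Ex]; have [_ /(_ _ Ex)[k _ hx] _] := hAB i.
  by exists (i, k).
move=> s us.
pose n := (\max_(ik <- s) ik.2).+1.
pose t := undup (map fst s).
apply: (@le_trans _ _ (\sum_(ik <- [seq (i, k) | i <- t, k <- iota 0 n])
    volume (A ik.1 ik.2) (B ik.1 ik.2))).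
  apply: (@sum_uniq_le _ _ _ (fun ik : I * nat => volume (A ik.1 ik.2) (B ik.1 ik.2))) => //.
  - by apply: allpairs_uniq; rewrite ?undup_uniq ?iota_uniq // => -[? ?] [].
  - move=> [i k] iks; apply: allpairs_f.
      by rewrite mem_undup; apply/mapP; exists (i, k).
    rewrite mem_iota add0n /= /n ltnS.
    by rewrite (big_rem (i, k)) //= leq_maxl.
rewrite big_allpairs.
apply: (@le_trans _ _ (\sum_(i <- t) e / 2 ^+ (pickle i).+1)).
  apply: ler_sum => i _; have [_ _ /(_ n)] := hAB i.
  by rewrite /index_iota subn0.
pose M := (\max_(i <- t) pickle i).+1.
have -> : \sum_(i <- t) e / 2 ^+ (pickle i).+1 =
    \sum_(k <- map pickle t) e / 2 ^+ k.+1 by rewrite big_map.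
apply: (@le_trans _ _ (\sum_(k <- iota 0 M) e / 2 ^+ k.+1)).
  apply: sum_uniq_le.
  - by rewrite map_inj_uniq ?undup_uniq //; exact: pcan_inj (@pickleK I).
  - exact: iota_uniq.
  - move=> _ /mapP[i it ->]; rewrite mem_iota add0n /= /M ltnS.
    by rewrite (big_rem i) //= leq_maxl.
  - by move=> k; rewrite divr_ge0 ?exprn_ge0 ?ltW.
suff -> : \sum_(k <- iota 0 M) e / 2 ^+ k.+1 = e - e / 2 ^+ M.
  by rewrite gerBl divr_ge0 ?exprn_ge0 ?ltW.
elim: M => [|M IH]; first by rewrite big_nil expr0 divr1 subrr.
rewrite -addn1 iotaD big_cat IH big_seq1 add0n addn1 exprS.
by rewrite /=; field; rewrite expf_neq0.
Qed.

Lemma norm_row_lt (x : 'rV[R]_m) (r : R) : 0 < r -> (forall i, `|x 0 i| < r) -> `|x| < r.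
Proof.
move=> r0 h; rewrite [ltLHS]/Num.Def.normr /= mx_normrE; apply/bigmax_ltP; split=> //.
by move=> [i j] _ /=; rewrite ord1.
Qed.

(** A Lindeloef argument: each point of E lies in a cube with rational centre and radius, small
    enough that its part of E is null, and there are countably many such cubes. *)
Lemma null_local E : (forall x, E x -> exists2 r, 0 < r & null (E `&` ball x r)) ->
  null E.
Proof.
move=> hE.
pose S (c : 'rV[rat]_m * rat) : set 'rV[R]_m :=
  [set x | E x /\ forall i, `|x 0 i - ratr (c.1 0 i)| < ratr c.2].
pose S' c := [set x | S c x /\ null (S c)].
apply: (@null_subset _ (\bigcup_c S' c)); last first.
  apply: null_bigcup => c; have [hc|hc] := pselect (null (S c)).
    by apply: null_subset hc => x [].
  move=> e e0; exists (fun=> 0), (fun=> 0); split=> // [x [_ /hc]//|n].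
  by rewrite big1 ?ltW // => k _; exact: volume_refl.
move=> x Ex; have [r r0 hr] := hE x Ex.
have r2 : 0 < r / 2 by rewrite divr_gt0.
have [rho] := rat_in_itvoo r2; rewrite in_itv /= => /andP[rho0 rhor].
have /choice[q hq] : forall i, exists q : rat, `|x 0 i - ratr q| < ratr rho.
  move=> i; have xi : x 0 i - ratr rho < x 0 i + ratr rho by lra.
  have [q] := rat_in_itvoo xi; rewrite in_itv /= => /andP[h1 h2]; exists q.
  by rewrite ltr_norml; apply/andP; split; lra.
exists (\row_i q i, rho) => //; split.
  by split=> // i; rewrite mxE.
apply: null_subset hr => y [Ey hy]; split=> //.
rewrite -ball_normE /=; apply: norm_row_lt => // i; rewrite !mxE.
have := hy i; have := hq i; rewrite mxE !ltr_norml.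
by move=> /andP[h1 h2] /andP[h3 h4]; apply/andP; split; lra.
Qed.

(* In direction k a set satisfying this cone condition is a Lipschitz graph, so
   in each of the n^(m-1) columns of a grid of mesh 2r/n it has height O(1/n). *)
Lemma cone_null E (k : 'I_m) x0 (r C : R) : 0 < r -> 0 <= C ->
  (forall x, E x -> forall j, `|x 0 j - x0 0 j| < r) ->
  (forall x y, E x -> E y ->
     `|y 0 k - x 0 k| <= C * \sum_(j < m | j != k) `|y 0 j - x 0 j|) ->
  null E.
Proof.
move=> r0 C0 hE hC.
(* There are n^(m-1) columns of volume s^(m-1) 2H with s = 2r/n and H = C m s, in total D/n; n is
   chosen below to make this at most e. *)
pose D : R := (2 * r) ^+ m.-1 * (2 * (C * m%:R * (2 * r))).
have rr : 0 <= r by exact: ltW.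
have D0 : 0 <= D by rewrite /D !mulr_ge0 ?exprn_ge0 ?mulr_ge0.
apply: null_countable_cover => e e0.
pose n := (Num.truncn (D / e)).+1.
have n0 : 0 < n%:R :> R by rewrite ltr0n.
have Dn : D / n%:R <= e.
  by rewrite ler_pdivrMr // mulrC -ler_pdivrMr // ltW // truncnS_gt.
pose s : R := 2 * r / n%:R.
have s0 : 0 < s by rewrite divr_gt0 // mulr_gt0.
pose lo (f : {ffun 'I_m -> 'I_n}) j : R := x0 0 j - r + s * (f j)%:R.
pose col (f : {ffun 'I_m -> 'I_n}) : set 'rV[R]_m :=
  [set x | E x /\ forall j, j != k -> lo f j <= x 0 j <= lo f j + s].
pose H : R := C * (m%:R * s).
have H0 : 0 <= H by rewrite !mulr_ge0 // ltW.
(* Cells are indexed by functions of all m coordinates so that the sum of volumes factorizes. Only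
   those with f k = 0 carry a genuine box, of half-height H around a point of E chosen in the
   column; the others are degenerate in direction k. *)
pose A (f : {ffun 'I_m -> 'I_n}) : 'rV[R]_m := \row_j
  if j == k then (if f k == 0%N :> nat then xget 0 (col f) 0 k - H else 0) else lo f j.
pose B (f : {ffun 'I_m -> 'I_n}) : 'rV[R]_m := \row_j
  if j == k then (if f k == 0%N :> nat then xget 0 (col f) 0 k + H else 0) else lo f j + s.
pose w j (a : 'I_n) : R :=
  if j == k then (if a == 0%N :> nat then H + H else 0) else s.
have volE f : volume (A f) (B f) = \prod_j w j (f j).
  apply: eq_bigr => j _; rewrite !mxE /w; case: eqP => [->|_]; last by ring.
  by case: ifP => _; ring.
have AB f i : A f 0 i <= B f 0 i.
  rewrite !mxE; case: ifP => _; last by rewrite lerDl ltW.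
  by case: ifP => _ //; rewrite -subr_ge0; lra.
exists {ffun 'I_m -> 'I_n}, A, B; split=> // [x Ex|S uS].
  pose a j := (x 0 j - x0 0 j + r) / s.
  have a0 j : 0 <= a j.
    by have := hE x Ex j; rewrite ltr_norml => /andP[h _]; rewrite divr_ge0 ?ltW //; lra.
  have tr_le (y : R) : 0 <= y -> (Num.truncn y)%:R <= y :> R by rewrite truncn_le.
  have an j : (Num.truncn (a j) < n)%N.
    rewrite -(ltr_nat R); apply: le_lt_trans (tr_le _ (a0 j)) _.
    rewrite /a ltr_pdivrMr // /s mulrC divfK ?gt_eqF //.
    by have := hE x Ex j; rewrite ltr_norml => /andP[_ h]; lra.
  pose f : {ffun 'I_m -> 'I_n} := [ffun j => if j == k then ord0 else Ordinal (an j)].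
  have fx : col f x.
    split=> // j jk; rewrite /lo ffunE (negbTE jk) /=.
    have := tr_le _ (a0 j); have := truncnS_gt (a j).
    rewrite {2}/a {1}/a ltr_pdivrMr // ler_pdivlMr // -natr1.
    by move=> h1 h2; apply/andP; split; lra.
  exists f => // i; rewrite !mxE; case: eqP => [->|/eqP ik]; last exact: fx.2.
  rewrite !(ffunE _ k) !eqxx /=.
  have [Ey hy] : col f (xget 0 (col f)) by apply: xgetPex; exists x.
  set y := xget _ _ in Ey hy *.
  suff : `|x 0 k - y 0 k| <= H by rewrite ler_norml => /andP[h1 h2]; apply/andP; split; lra.
  apply: le_trans (hC y x Ey Ex) _; apply: ler_wpM2l => //.
  apply: (@le_trans _ _ (\sum_(j < m) s)); last first.
    by rewrite sumr_const card_ord mulr_natl.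
  rewrite [leRHS](bigID (fun j => j != k)) /= -[leLHS]addr0 lerD //; last first.
    by apply: sumr_ge0 => j _; exact: ltW.
  apply: ler_sum => j jk; have := hy j jk; have := fx.2 j jk.
  by move=> /andP[h1 h2] /andP[h3 h4]; rewrite ler_norml; apply/andP; split; lra.
apply: le_trans Dn.
apply: (@le_trans _ _ (\sum_f volume (A f) (B f))).
  apply: sum_uniq_le => //; first exact: index_enum_uniq.
    by move=> f _; exact: mem_index_enum.
  by move=> f; exact: volume_ge0.
(* The sum of products becomes a product of sums over the coordinates: n s = 2r for each j <> k, and
   2H for k. *)
rewrite (eq_bigr _ (fun f _ => volE f)) -bigA_distr_bigA /=.
rewrite (bigD1 k) //= [X in _ * X](eq_bigr (fun=> 2 * r)); last first.
  move=> j jk; rewrite /w (negbTE jk) sumr_const card_ord -mulr_natl /s.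
  by field; rewrite gt_eqF.
rewrite prodr_const cardC1 card_ord.
rewrite (bigD1 ord0) //= big1 => [|a]; last first.
  by rewrite /w eqxx => /negbTE; rewrite -val_eqE /= => ->.
apply: eqr_le; rewrite addr0 /w !eqxx /D /H /s.
by field; rewrite gt_eqF.
Qed.

End NullSets.

(** * Zeros at which the differential is nonzero *)

Section ZeroSets.
Variables (R : realType) (m : nat).
Hypothesis m_gt0 : (0 < m)%N.
Implicit Types (x y u : 'rV[R]_m).

Lemma diff_delta (g : 'rV[R]_m -> R) x u :
  'd g x u = \sum_j u 0 j * 'd g x (delta_mx 0 j).
Proof.
rewrite {1}(row_sum_delta u) linear_sum; apply: eq_bigr => j _.
by rewrite linearZ.
Qed.

Lemma segment_mean_value (g : 'rV[R]_m -> R) x y :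
  (forall t, 0 <= t <= 1 -> differentiable g (x + t *: (y - x))) ->
  exists2 t : R, 0 <= t <= 1 & g y - g x = 'd g (x + t *: (y - x)) (y - x).
Proof.
move=> hg; pose h (t : R) := g (x + t *: (y - x)).
have hl (t : R) : is_diff t (fun t : R => x + t *: (y - x)) (fun s => s *: (y - x)).
  have := is_diff_funD (is_diff_fun_cst x t) (is_diff_funZl (y - x) (is_diff_id t)).
  by under [X in is_diff_def _ _ X -> _]eq_fun do rewrite add0r.
have hh (t : R) : 0 <= t <= 1 ->
    is_derive t 1 h ('d g (x + t *: (y - x)) (y - x)).
  move=> ht; have [dt dE] := hl t.
  have dh : differentiable h t.
    exact: (@differentiable_comp _ _ _ _ (fun t : R => x + t *: (y - x)) g t dt (hg t ht)).
  apply: DeriveDef; first exact: diff_derivable.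
  rewrite deriveE // /h (@diff_comp _ _ _ _ (fun t : R => x + t *: (y - x)) g t dt (hg t ht)) /=.
  by rewrite dE scale1r.
have ch : {within `[0, 1], continuous h}.
  apply: continuous_in_subspaceT => t; rewrite inE /= in_itv /= => ht.
  apply: differentiable_continuous; have [dt _] := hl t.
  exact: (@differentiable_comp _ _ _ _ (fun t : R => x + t *: (y - x)) g t dt (hg t ht)).
have [|t ht E] := @MVT_segment R h (fun t => 'd g (x + t *: (y - x)) (y - x)) 0 1 ler01 _ ch.
  by move=> t; rewrite in_itv /= => /andP[t0 t1]; apply: hh; rewrite !ltW.
exists t; first by move: ht; rewrite in_itv.
have xy : x + (y - x) = y by rewrite addrC subrK.
by move: E; rewrite /h scale1r scale0r addr0 xy subr0 mulr1.
Qed.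

(** Near such a zero one partial derivative stays at least D/2 in absolute value and the others at
    most M. The mean value theorem between two zeros then gives the cone condition with constant
    2M/D. *)
Lemma regular_zeros_null (V : set 'rV[R]_m) (g : 'rV[R]_m -> R) : open V ->
  (forall x, V x -> differentiable g x) ->
  (forall u x, V x -> {for x, continuous (fun y => 'd g y u : R)}) ->
  null [set x | [/\ V x, g x = 0 & exists u, 'd g x u != 0]].
Proof.
move=> oV hd hc; apply: null_local => // x0 [Vx0 _ [u0 hu0]].
have [k hk] : exists k, 'd g x0 (delta_mx 0 k) != 0.
  apply: contrapT => /forallNP hn; move: hu0; rewrite diff_delta big1 ?eqxx // => j _.
  by have /negP := hn j; rewrite negbK => /eqP ->; rewrite mulr0.
have lower (a b : R) : `|a - b| < `|a| / 2 -> `|a| / 2 <= `|b|.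
  by have := ler_normD (a - b) b; rewrite subrK; lra.
have upper (a b e : R) : `|a - b| < e -> `|b| <= `|a| + e.
  have := ler_normD a (b - a); rewrite (distrC b a) (_ : a + (b - a) = b); last by ring.
  by lra.
have scaled (a D M S : R) : 0 < D -> a * (D / 2) <= M * S -> a <= 2 / D * M * S.
  move=> D0 h; have -> : 2 / D * M * S = M * S / (D / 2) by field; rewrite gt_eqF.
  by rewrite ler_pdivlMr ?divr_gt0.
pose p j x : R := 'd g x (delta_mx 0 j).
pose D := `|p k x0|; have D0 : 0 < D by rewrite normr_gt0.
have D2 : 0 < D / 2 by rewrite divr_gt0.
have : nbhs x0 (fun x => V x /\ forall j, `|p j x0 - p j x| < D / 2).
  have h1 : nbhs x0 V by exact: open_nbhs_nbhs.
  have h2 : nbhs x0 [set x | forall j, `|p j x0 - p j x| < D / 2].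
    apply: (@filter_forall _ _ (fun j x => `|p j x0 - p j x| < D / 2) _ (nbhs_filter x0)) => j.
    have := hc (delta_mx 0 j) x0 Vx0.
    by move=> /cvgr_dist_lt; apply.
  exact: filterI h1 h2.
move=> /nbhs_ballP[r /= r0 hr].
exists r => //.
(* The summand D leaves room for the variation D/2 allowed to each partial derivative on the
   ball. *)
pose M := \sum_j `|p j x0| + D.
have Mj j : `|p j x0| + D / 2 <= M.
  rewrite /M (bigD1 j) //= -addrA lerD2l; have : 0 <= \sum_(i < m | i != j) `|p i x0|.
    by apply: sumr_ge0.
  lra.
have M0 : 0 <= M by apply: le_trans (Mj k); rewrite addr_ge0 // ltW.
have inball x : ball x0 r x -> forall j, `|x 0 j - x0 0 j| < r.
  rewrite -ball_normE /= => hx j; apply: le_lt_trans hx.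
  by rewrite distrC; have := ler_coord_norm (x0 - x) j; rewrite !mxE.
apply: (@cone_null _ _ m_gt0 _ k x0 r (2 / D * M)) => //.
- by rewrite mulr_ge0 // divr_ge0 // ltW.
- by move=> x [_ hx]; exact: inball.
move=> x y [[Vx gx _] hx] [[Vy gy _] hy].
have seg t : 0 <= t <= 1 -> ball x0 r (x + t *: (y - x)).
  move=> /andP[t0 t1]; rewrite -ball_normE /=.
  have -> : x0 - (x + t *: (y - x)) = (1 - t) *: (x0 - x) + t *: (x0 - y).
    by apply/rowP => j; rewrite !mxE; ring.
  apply: le_lt_trans (ler_normD _ _) _; rewrite !normrZ (ger0_norm t0) ger0_norm ?subr_ge0 //.
  move: hx hy; rewrite -ball_normE /= => hx hy.
  have [t00|t00] := eqVneq t 0; first by rewrite t00; lra.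
  have tp : 0 < t by rewrite lt_def t00.
  have := ler_wpM2l (_ : 0 <= 1 - t) (ltW hx); rewrite subr_ge0 => /(_ t1).
  have := hy; rewrite -(ltr_pM2l tp); lra.
have [t ht E] := segment_mean_value (fun t ht => hd _ (hr _ (seg t ht)).1).
move: E; rewrite gx gy subrr diff_delta (bigD1 k) //= -/(p k _).
have [_ hp] := hr _ (seg t ht); move: (x + t *: (y - x)) hp => xi hp.
rewrite !mxE => E.
have pk : D / 2 <= `|p k xi|.
  exact: lower (hp k).
have E1 : `|y 0 k - x 0 k| * `|p k xi| <= M * \sum_(j < m | j != k) `|y 0 j - x 0 j|.
  have E2 : (y 0 k - x 0 k) * p k xi =
    - \sum_(j < m | j != k) (y - x) 0 j * 'd g xi (delta_mx 0 j).
    by apply/eqP; rewrite -addr_eq0 -E.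
  rewrite -normrM E2 normrN; apply: le_trans (ler_norm_sum _ _ _) _.
  rewrite mulr_sumr; apply: ler_sum => j _.
  rewrite normrM !mxE mulrC; apply: ler_wpM2r => //.
  apply: le_trans (Mj j); exact: upper (hp j).
exact: scaled D0 (le_trans (ler_wpM2l (normr_ge0 _) pk) E1).
Qed.

End ZeroSets.

(** * Charts *)

Lemma cvg_ptws (T I : Type) (V : topologicalType) (F : set_system T)
  (FF : Filter F) (g : T -> prod_topology (fun _ : I => V)) (a : prod_topology (fun _ : I => V)) :
  (forall i, (fun t => g t i) @ F --> a i) -> g @ F --> a.
Proof.
move=> h; apply/cvg_sup => i U.
rewrite nbhsE => -[Q [[W oW WO] Qa] QU].
apply: (filterS QU); rewrite -WO.
by apply: (h i); apply: open_nbhs_nbhs; split=> //; move: Qa; rewrite -WO.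
Qed.

Section Translations.
Variables (R : realType) (d N : nat).
Local Notation AN := (afftuple R d N).

Lemma translate0 (alpha : AN) w : translate alpha w 0 = alpha.
Proof.
by apply/funext => i; rewrite /translate scale0r addr0; case: (alpha i).
Qed.

Lemma translate_continuous (alpha : AN) w :
  translate alpha w t @[t --> (0 : R)] --> alpha.
Proof.
apply: cvg_ptws => i.
have h2 : (alpha i).2 + t *: w i @[t --> (0 : R)] --> (alpha i).2.
  have Hid : t @[t --> (0 : R)] --> (0 : R) by exact: cvg_id.
  have H := cvgD (cvg_cst (alpha i).2) (cvgZ Hid (cvg_cst (w i))).
  by rewrite scale0r addr0 in H; exact: H.
suff : translate alpha w t i @[t --> (0 : R)] --> ((alpha i).1, (alpha i).2).
  by rewrite -surjective_pairing.
exact: cvg_pair (cvg_cst (alpha i).1) h2.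
Qed.

(** Membership reads only ratios and rotations, which a translation leaves alone. *)
Lemma translate_AsetN (alpha : AN) w t : AsetN alpha -> AsetN (translate alpha w t).
Proof. by []. Qed.

End Translations.

Lemma is_diff_linear (R : realType) (V W : normedModType R) (f : V -> W) x :
  linear f -> continuous f -> is_diff x f f.
Proof.
move=> lf cf; pose fM := GRing.isLinear.Build _ _ _ _ _ lf.
pose fL : {linear V -> W} := HB.pack f fM.
by apply: DiffDef; [exact: (@linear_differentiable _ _ _ fL)|exact: (@diff_lin _ _ _ fL)].
Qed.

(** * Continuously differentiable functions on an open set *)

Section ContinuouslyDifferentiable.
Variables (R : realType) (m : nat) (V : set 'rV[R]_m).
Hypothesis oV : open V.
Implicit Types (f g : 'rV[R]_m -> R).

Definition C1on f := (forall x, V x -> differentiable f x) /\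
  forall u x, V x -> {for x, continuous (fun y => 'd f y u : R)}.

Lemma C1on_intro f (df : 'rV[R]_m -> 'rV[R]_m -> R) :
  (forall x, V x -> is_diff x f (df x)) ->
  (forall u x, V x -> df y u @[y --> x] --> df x u) -> C1on f.
Proof.
move=> hf hc; split=> [x Vx|u x Vx]; first by have [] := hf x Vx.
have E y : V y -> 'd f y u = df y u by move=> Vy; exact: (is_diff_diff (hf y Vy)).
suff : 'd f y u @[y --> x] --> df x u by rewrite -(E x Vx).
have h : df y u @[y --> x] --> df x u by exact: hc.
have hV : nbhs x V by exact: open_nbhs_nbhs.
have hE : \forall y \near x, df y u = 'd f y u by apply: filterS hV => y Vy; rewrite E.
exact: (cvg_trans (near_eq_cvg hE) h).
Qed.

Lemma C1on_cst (c : R) : C1on (fun=> c).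
Proof.
have h1 x : V x -> is_diff x (fun=> c) (fun=> 0) by move=> _; exact: is_diff_fun_cst.
apply: (C1on_intro h1) => u x _.
by apply: cvg_cst; exact: nbhs_filter.
Qed.

Lemma C1onD f g : C1on f -> C1on g -> C1on (fun x => f x + g x).
Proof.
move=> [df cf] [dg cg].
have h1 x : V x -> is_diff x (fun x => f x + g x) (fun u => 'd f x u + 'd g x u).
  by move=> Vx; exact: (is_diff_funD (differentiableP (df x Vx)) (differentiableP (dg x Vx))).
apply: (C1on_intro h1) => u x Vx.
exact: (cvgD (cf u x Vx) (cg u x Vx)).
Qed.

Lemma C1onM f g : C1on f -> C1on g -> C1on (fun x => f x * g x).
Proof.
move=> [df cf] [dg cg].
have h1 x : V x -> is_diff x (fun x => f x * g x)
    (fun u => f x * 'd g x u + g x * 'd f x u).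
  by move=> Vx; exact: (is_diff_funM (differentiableP (df x Vx)) (differentiableP (dg x Vx))).
apply: (C1on_intro h1) => u x Vx.
have hf := differentiable_continuous (df x Vx).
have hg := differentiable_continuous (dg x Vx).
exact: (cvgD (cvgM hf (cg u x Vx)) (cvgM hg (cf u x Vx))).
Qed.

Lemma C1on_linear (W : normedModType R) (h : 'rV[R]_m -> W) (L : W -> R) :
  classC 1 V h -> linear L -> continuous L -> C1on (fun x => L (h x)).
Proof.
move=> [dh ch] lL cL.
have h1 x : V x -> is_diff x (fun x => L (h x)) (fun u => L ('d h x u)).
  move=> Vx.
  exact: (is_diff_comp (differentiableP (dh x Vx)) (is_diff_linear (h x) lL cL)).
apply: (C1on_intro h1) => u x Vx.
apply: (@cvg_comp _ _ _ (fun y => 'd h y u : W) L _ _ _ (ch u x Vx)).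
exact: cL.
Qed.

End ContinuouslyDifferentiable.

Section ChartPolynomials.
Variables (R : realType) (d N : nat).
Local Notation AN := (afftuple R d N).
Local Notation A1 := (R * 'M[R]_d * 'rV[R]_d)%type.

Definition coord_index (c : affcoord d N) : 'I_N :=
  match c with CoordL i => i | CoordO i _ _ => i | CoordV i _ => i end.

Definition coord_fun (c : affcoord d N) (z : A1) : R :=
  match c with
  | CoordL _ => z.1.1
  | CoordO _ j k => z.1.2 j k
  | CoordV _ k => z.2 0 k
  end.

Lemma coord_valE c (alpha : AN) : coord_val c alpha = coord_fun c (alpha (coord_index c)).
Proof. by case: c. Qed.

Lemma coord_fun_linear c : linear (coord_fun c : A1 -> R).
Proof. by case: c => [i|i j k|i k] a u v /=; rewrite ?mxE. Qed.

Lemma coord_fun_continuous c : continuous (coord_fun c : A1 -> R).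
Proof.
have f1 (U W : topologicalType) : continuous (@fst U W) by move=> p; exact: cvg_fst.
have f2 (U W : topologicalType) : continuous (@snd U W) by move=> p; exact: cvg_snd.
case: c => [i|i j k|i k] z.
- exact: (@cvg_comp _ _ _ fst fst _ _ _ (f1 _ _ z) (f1 _ _ _)).
- have h := @cvg_comp _ _ _ fst snd _ _ _ (f1 _ _ z) (f2 _ _ _).
  exact: (@cvg_comp _ _ _ (fun z : A1 => z.1.2) (fun M : 'M[R]_d => M j k) _ _ _ h (@coord_continuous _ _ _ j k _)).
- exact: (@cvg_comp _ _ _ snd (fun M : 'rV[R]_d => M 0 k) _ _ _ (f2 _ _ z) (@coord_continuous _ _ _ 0 k _)).
Qed.

Lemma peval_C1on m (V : set 'rV[R]_m) (psi : 'rV[R]_m -> AN) (e : pexpr R d N) :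
  open V -> (forall i, classC 1 V (fun x => psi x i : A1)) ->
  C1on V (fun x => peval e (psi x)).
Proof.
move=> oV hpsi; elim: e => [c|c|e1 IH1 e2 IH2|e1 IH1 e2 IH2] /=.
- exact: C1on_cst.
- have := C1on_linear oV (hpsi (coord_index c)) (coord_fun_linear c) (@coord_fun_continuous c).
  by under eq_fun do rewrite -coord_valE.
- exact: C1onD.
- exact: C1onM.
Qed.

End ChartPolynomials.

Lemma diff_near_le (R : realType) (V W : normedModType R) (f : V -> W) x (e : R) :
  differentiable f x -> 0 < e ->
  nbhs x [set y | `|f y - f x - 'd f x (y - x)| <= e * `|y - x|].
Proof.
move=> fx e0.
have /eqaddoP/(_ e e0) h := diff_locally fx.
have {}h : \forall y \near (0 : V),
  `|(f \o shift x - (cst (f x) + 'd f x)) y| <= e * `|y| by exact: h.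
rewrite (near_shift x) sub0r in h.
apply: filterS h => y; rewrite /= !fctE /shift /= subrK.
by rewrite opprD addrA.
Qed.

Section Charts.
Variables (R : realType) (d N m : nat).
Local Notation AN := (afftuple R d N).
Local Notation A1 := (R * 'M[R]_d * 'rV[R]_d)%type.
Variables (V : set 'rV[R]_m) (psi : 'rV[R]_m -> AN).

(** The sum of the norms of the partial differentials attains a positive minimum on the compact unit
    sphere; half of it absorbs the remainders of the first-order expansions. *)
Lemma immersion_expands x0 : (0 < m)%N ->
  (forall i, differentiable (fun x => psi x i : A1) x0) ->
  (forall u, (forall i, 'd (fun x => psi x i : A1) x0 u = 0) -> u = 0) ->
  exists2 c : R, 0 < c & nbhs x0 [set x |
    c * `|x - x0| <= \sum_i `|(psi x i : A1) - psi x0 i|].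
Proof.
move=> m0 dpsi imm.
pose L i u : A1 := 'd (fun x => psi x i : A1) x0 u.
have LZ i (a : R) u : L i (a *: u) = a *: L i u by exact: linearZ.
pose n u : R := \sum_i `|L i u|.
pose S := [set u : 'rV[R]_m | `|u| = 1].
have S0 : S !=set0.
  pose u : 'rV[R]_m := delta_mx 0 (Ordinal m0).
  have u0 : u != 0 by rewrite -enorm_eq0 enorm_delta oner_eq0.
  exists (`|u|^-1 *: u); rewrite /S /= normrZ normfV normr_id mulVf //.
  by rewrite normr_eq0.
have cS : compact S.
  apply: bounded_closed_compact.
    by exists 1; split=> // M M1 u /= ->; exact: ltW.
  rewrite (_ : S = (fun u : 'rV[R]_m => `|u|) @^-1` [set 1]) //.
  apply: closed_comp; last exact: closed_eq.
  by move=> u _; exact: norm_continuous.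
have cn : continuous n.
  move=> u; have FF : Filter (nbhs u) by exact: nbhs_filter.
  apply: (cvg_big _ FF) => [|i _]; first exact: add_continuous.
  apply: cvg_norm; exact: (diff_continuous (dpsi i)).
have [u0 Su0 hmin] := EVT_min_rV S0 cS (continuous_subspaceT cn).
have n0 : 0 < n u0.
  rewrite lt_def sumr_ge0 // andbT; apply/eqP => nu0.
  have u00 : u0 = 0.
    apply: imm => i; apply/eqP; rewrite -normr_eq0.
    move: nu0 => /eqP; rewrite psumr_eq0 // => /allP/(_ i).
    by rewrite mem_index_enum => /(_ isT).
  by move: Su0; rewrite inE /S /= u00 normr0 => /eqP; rewrite eq_sym oner_eq0.
have hn u : n u0 * `|u| <= n u.
  have [->|u1] := eqVneq u 0; first by rewrite normr0 mulr0 sumr_ge0.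
  have nu : 0 < `|u| by rewrite normr_gt0.
  have nz : n (`|u|^-1 *: u) = `|u|^-1 * n u.
    rewrite /n mulr_sumr; apply: eq_bigr => i _.
    by rewrite LZ normrZ normfV normr_id.
  have Su : S (`|u|^-1 *: u).
    by rewrite /S /= normrZ normfV normr_id mulVf ?gt_eqF.
  have := hmin _ (mem_set Su); rewrite nz.
  by rewrite mulrC ler_pdivlMr.
(* With this tolerance the N remainders add up to at most half of the minimum; N + 1 keeps the
   denominator nonzero. *)
have e0 : 0 < n u0 / (2 * N.+1%:R) by rewrite divr_gt0 // mulr_gt0 // ltr0n.
exists (n u0 / 2); first by rewrite divr_gt0.
pose P i x := `|(psi x i : A1) - psi x0 i - L i (x - x0)| <= n u0 / (2 * N.+1%:R) * `|x - x0|.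
have hP : nbhs x0 [set x | forall i, P i x].
  apply: (@filter_forall _ _ P _ (nbhs_filter x0)) => i.
  exact: diff_near_le (dpsi i) e0.
apply: filterS hP => x hx /=.
have h1 : n (x - x0) <= \sum_i `|(psi x i : A1) - psi x0 i| + \sum_(i < N) n u0 / (2 * N.+1%:R) * `|x - x0|.
  rewrite -big_split /=; apply: ler_sum => i _.
  have := hx i; rewrite /P; move: (L i _) (_ - psi x0 i) => a b hab.
  have := ler_normD (a - b) b; rewrite subrK distrC.
  by move=> /le_trans; apply; rewrite [leLHS]addrC lerD2l.
rewrite sumr_const card_ord -[_ *+ N]mulr_natl in h1.
have h3 := hn (x - x0).
have h2 : N%:R * (n u0 / (2 * N.+1%:R) * `|x - x0|) <= n u0 / 2 * `|x - x0|.
  have -> : n u0 / 2 * `|x - x0| = N.+1%:R * (n u0 / (2 * N.+1%:R) * `|x - x0|).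
    by field; rewrite ?pnatr_eq0.
  by rewrite ler_wpM2r ?ler_nat // mulr_ge0 // ltW.
have h4 := le_trans h3 (le_trans h1 (lerD (lexx _) h2)).
have hh (a b c : R) : a * b <= c + a / 2 * b -> a / 2 * b <= c by lra.
exact: hh h4.
Qed.

End Charts.

(** * Growth of a polynomial along a translation *)

Section LinePolynomials.
Variables (R : realType) (d N : nat).
Local Notation AN := (afftuple R d N).

Definition unit_translation (ik : 'I_N * 'I_d) (i : 'I_N) : 'rV[R]_d :=
  if i == ik.1 then delta_mx 0 ik.2 else 0.

Lemma line_poly_unit (alpha : AN) ik e :
  (line_poly alpha (unit_translation ik) e)^`().[0] = peval (pderiv ik e) alpha.
Proof.
rewrite line_poly_deriv horner_sum (bigD1 ik) //= big1 => [|[i k] ne].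
  by rewrite hornerZ line_polyE translate0 /unit_translation eqxx mxE !eqxx mul1r addr0.
rewrite hornerZ /unit_translation /=; case: eqP => [E|_]; last by rewrite mxE mul0r.
rewrite mxE /=; case: eqP => [E'|_]; last by rewrite mul0r.
by move: ne; rewrite E E' -surjective_pairing eqxx.
Qed.

(** The linear term of the polynomial along the line has slope [pderiv ik e]; for small t half of it
    dominates the remainder. *)
Lemma peval_translate_ge (alpha : AN) ik e : peval (pderiv ik e) alpha != 0 ->
  nbhs (0 : R) [set t | `|peval (pderiv ik e) alpha| / 2 * `|t| <=
     `|peval e (translate alpha (unit_translation ik) t) - peval e alpha|].
Proof.
set D := peval _ _; set w := unit_translation ik => D0.
pose p := line_poly alpha w e.
have dp : differentiable (horner p) (0 : R).
  by apply/derivable1_diffP; exact: derivable_horner.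
have dE (t : R) : 'd (horner p) (0 : R) t = t * D.
  rewrite deriv1E /=; last exact: derivable_horner.
  by rewrite -derivE line_poly_unit.
have e0 : 0 < `|D| / 2 by rewrite divr_gt0 // normr_gt0.
apply: filterS (diff_near_le dp e0) => t /=.
rewrite subr0 dE /p !line_polyE translate0.
move: (peval e alpha) (peval e _) => a b h.
have := ler_normD (b - a) (t * D - (b - a)); rewrite addrC subrK normrM => h1.
rewrite distrC in h; nra.
Qed.

Lemma translate_dist (alpha : AN) w (t : R) :
  \sum_i `|(translate alpha w t i : R * 'M[R]_d * 'rV[R]_d) - alpha i| =
  `|t| * \sum_i `|w i|.
Proof.
rewrite mulr_sumr; apply: eq_bigr => i _.
have -> : (translate alpha w t i : R * 'M[R]_d * 'rV[R]_d) - alpha i = (0, t *: w i).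
  rewrite /translate; case: (alpha i) => a b /=.
  by congr pair => /=; [rewrite subrr|rewrite addrAC subrr add0r].
by rewrite prod_normE /= normr0 normrZ max_r // mulr_ge0.
Qed.

End LinePolynomials.

Section ChartRegular.
Variables (R : realType) (d N m : nat).
Local Notation AN := (afftuple R d N).
Local Notation A1 := (R * 'M[R]_d * 'rV[R]_d)%type.

(** If the differential vanished, the polynomial in the chart would change by o(|x - x0|). But small
    translates of psi x0 are of the form psi x with |x - x0| = O(|t|), by the open image and the
    expansion bound, and there the polynomial changes by at least a constant times |t|. The inverse
    of psi is never differentiated. *)
Lemma chart_regular (V : set 'rV[R]_m) (psi : 'rV[R]_m -> AN) x0 e ik : (0 < m)%N ->
  open V -> V x0 ->
  (forall V' : set 'rV[R]_m, open V' -> V' `<=` V ->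
     exists2 W : set AN, open W & psi @` V' = @AsetN R d N `&` W) ->
  (forall i, classC 1 V (fun x => psi x i : A1)) ->
  (forall u, (forall i, 'd (fun x => psi x i : A1) x0 u = 0) -> u = 0) ->
  peval (pderiv ik e) (psi x0) != 0 ->
  exists u, 'd (fun x => peval e (psi x)) x0 u != 0.
Proof.
move=> m0 oV Vx0 hopen hC imm D0.
apply: contrapT => /forallNP hn.
have dpsi i : differentiable (fun x => psi x i : A1) x0 by have [h _] := hC i; exact: h.
have [dG _] := peval_C1on e oV hC.
pose G x := peval e (psi x).
have G0 u : 'd G x0 u = 0 by apply/eqP; have /negP := hn u; rewrite negbK.
have [c c0 hc] := immersion_expands m0 dpsi imm.
set D := peval _ _ in D0.
have D1 : 0 < `|D| by rewrite normr_gt0.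
pose w := unit_translation R ik.
pose K := \sum_i `|w i|.
have K0 : 0 <= K by apply: sumr_ge0.
(* With |x - x0| <= K |t| / c this bounds the change by |D| |t| K / (4 (K + 1)), less than the lower
   bound |D| |t| / 2. *)
pose eps := `|D| * c / (4 * (K + 1)).
have K1 : 0 < 4 * (K + 1) by rewrite mulr_gt0 // ltr_wpDl.
have eps0 : 0 < eps by rewrite divr_gt0 // mulr_gt0.
have hG := diff_near_le (dG x0 Vx0) eps0.
have hV : nbhs x0 V by exact: open_nbhs_nbhs.
have hnb (T : set 'rV[R]_m) : nbhs x0 T -> exists V', [/\ open V', V' x0 & V' `<=` T].
  by rewrite nbhsE => -[V' [oV' V'x0] hV']; exists V'.
have [V' [oV' V'x0 hV']] := hnb _ (filterI hV (filterI hc hG)).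
have V'V : V' `<=` V by move=> x /hV'[].
have [W oW hW] := hopen V' oV' V'V.
have [Ax0 Wx0] : (@AsetN R d N `&` W) (psi x0) by rewrite -hW; exists x0.
have hWt : nbhs (0 : R) [set t | W (translate (psi x0) w t)].
  by apply: (@translate_continuous R d N (psi x0) w); exact: open_nbhs_nbhs.
have := @filterI _ (nbhs (0 : R)) (nbhs_filter _) _ _ hWt (peval_translate_ge D0).
move=> /nbhs_ballP[r /= r0 hr].
have [|Wt Dt] := hr (r / 2).
  rewrite -ball_normE /= sub0r normrN gtr0_norm ?divr_gt0 //.
  by rewrite ltr_pdivrMr // ltr_pMr // ltr1n.
set t := r / 2 in Wt Dt; have t0 : 0 < `|t| by rewrite normr_gt0 /t gt_eqF // divr_gt0.
(* The translate lies in A^N and in W, hence in the relatively open image of V'. *)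
have [x V'x xE] : (psi @` V') (translate (psi x0) w t).
  by rewrite hW; split => //; exact: translate_AsetN.
have [_ [hc1 hG1]] := hV' x V'x.
move: hc1 hG1 => /=; rewrite G0 subr0 xE translate_dist -/K => hc1 hG1.
have := le_trans Dt hG1; rewrite -/D.
move: (`|x - x0|) hc1 => X hc1 hX.
have : eps * X <= eps * (`|t| * K / c).
  by apply: ler_wpM2l; [exact: ltW|rewrite ler_pdivlMr // mulrC].
have -> : eps * (`|t| * K / c) = `|D| * `|t| * K / (4 * (K + 1)).
  by rewrite /eps; field; rewrite !gt_eqF //; lra.
move=> h; have := le_trans hX h.
rewrite ler_pdivlMr //; have := mulr_gt0 D1 t0.
move: (`|D|) (`|t|) K0 => a b; nra.
Qed.

End ChartRegular.

(** * The theorem *)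

Section RootSets.
Variable R : realType.

Lemma finite_roots (p : {poly R}) : p != 0 -> finite_set [set x | root p x].
Proof.
have [n] := ubnP (size p); elim: n p => // n IH p sp p0.
have [[a ra]|nr] := pselect (exists a, root p a); last first.
  by rewrite (_ : [set _ | _] = set0) // -subset0 => x rx; apply: nr; exists x.
have /factor_theorem[q pq] := ra.
have q0 : q != 0 by apply: contraNneq p0 => q0; rewrite pq q0 mul0r.
apply: (@sub_finite_set _ _ ([set x | root q x] `|` [set a])).
  move=> x /=; rewrite pq rootM root_XsubC => /orP[|/eqP]; by [left|right].
rewrite finite_setU; split; last exact: finite_set1.
apply: IH => //; move: sp; rewrite pq size_Mmonic ?monicXsubC // size_XsubC.
by rewrite addn2.
Qed.

(** The roots form a countable set, of Lebesgue measure 0, which cannot contain an interval of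
    length r > 0. *)
Lemma exists_common_nonroot (I : countType) (p : I -> {poly R}) (r : R) :
  0 < r -> (forall i, p i != 0) -> exists2 t, 0 < t < r & forall i, ~~ root (p i) t.
Proof.
move=> r0 hp; apply: contrapT => hn.
have sub : `]0, r[%classic `<=` \bigcup_i [set x | root (p i) x].
  move=> t; rewrite /= in_itv /= => tr; apply: contrapT => ht; apply: hn.
  by exists t => // i; apply/negP => ri; apply: ht; exists i.
have cnt : countable (\bigcup_i [set x | root (p i) x]).
  apply: bigcup_countable => // i _.
  by apply: finite_set_countable; exact: finite_roots.
have := countable_lebesgue_measure0 (sub_countable (subset_card_le sub) cnt).
rewrite lebesgue_measure_itv /= lte_fin r0 sube0 => /eqP.
by rewrite eqe gt_eqF.
Qed.

End RootSets.

(** * Null sets and density of the separated systems *)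

Section Assembly.
Variables (R : realType) (d N : nat).
Local Notation AN := (afftuple R d N).
Implicit Types (Phi : 'I_N -> hat R d -> hat R d) (Omega : set 'rV[R]_d).

Lemma pole_polynomials Phi : (forall i, nform (Phi i)) ->
  exists e : seq 'I_N * seq 'I_N -> pexpr R d N, forall st a, AsetN a ->
    peval (e st) a = 0 <->
    pole (fword (perturb a Phi) st.1) = pole (fword (perturb a Phi) st.2).
Proof.
move=> nf; have /choice[e he] : forall st : seq 'I_N * seq 'I_N,
    exists e : pexpr R d N, forall a, AsetN a -> peval e a = 0 <->
    pole (fword (perturb a Phi) st.1) = pole (fword (perturb a Phi) st.2).
  by move=> st; exact: pole_coincidence_polynomial.
by exists e.
Qed.

Lemma with_translationsE (alpha : AN) v :
  with_translations alpha v = translate alpha (fun i => v i - (alpha i).2) 1.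
Proof.
by apply/funext => i; rewrite /with_translations /translate scale1r addrC subrK.
Qed.

(** The separating vectors of ping-pong are reached at time 1 on a line of translations starting at
    alpha, the form needed for restriction to lines. *)
Lemma exists_separating_translation Phi Omega (Omega' : set 'rV[R]_d) (alpha : AN) :
  (0 < d)%N -> Omega !=set0 -> Sstar Omega Omega' Phi -> AsetN alpha ->
  cifs Omega Omega' (perturb alpha Phi) ->
  exists w, forall s t, Zpairs (FinWord s, FinWord t) ->
    pole (fword (perturb (translate alpha w 1) Phi) s) <>
    pole (fword (perturb (translate alpha w 1) Phi) t).
Proof.
move=> d0 [x Ox] [hPhi hp] hA hc.
have nf i := cifs_nform i hPhi.
have hop i : exists x, opnorm ('d (fin (perturb alpha Phi i)) x) < 1.
  by exists x; have [_ _ _] := hc i; apply; exact: subset_closure.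
have [v hv] := exists_translations d0 nf hA hop hp.
by exists (fun i => v i - (alpha i).2); rewrite -with_translationsE.
Qed.

Lemma bad_null_in_charts Phi Omega (Omega' : set 'rV[R]_d) :
  (0 < d)%N -> (0 < N)%N -> Omega !=set0 -> Sstar Omega Omega' Phi ->
  null_in_charts [set alpha : AN |
    (AsetN alpha /\ cifs Omega Omega' (perturb alpha Phi)) /\
    ~ GTfin Omega Omega' (perturb alpha Phi)].
Proof.
move=> d0 N0 hO hS V psi [oV _ hopen hC imm].
have m0 : (0 < dimAN d N)%N by rewrite /dimAN muln_gt0 N0 /= addnC addn_gt0 d0.
have nf i := cifs_nform i hS.1.
have [e he] := pole_polynomials nf.
apply: null_lebesgue_outer => //.
(* The pieces are indexed by a pair of words and a list of directions of differentiation, a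
   countable type. *)
pose S (k : (seq 'I_N * seq 'I_N) * seq ('I_N * 'I_d)) :=
  let g := fun x => peval (foldr (@pderiv R d N) (e k.1) k.2) (psi x) in
  [set x | [/\ V x, g x = 0 & exists u, 'd g x u != 0]].
apply: (@null_subset _ _ _ (\bigcup_k S k)); last first.
  apply: null_bigcup => // k.
  have [hd hc] := peval_C1on (foldr (@pderiv R d N) (e k.1) k.2) oV (hC 1%N).
  exact: regular_zeros_null.
move=> x [Vx [[hA hc] hbad]].
have [s [t [hZ hst]]] : exists s t : seq 'I_N, Zpairs (FinWord s, FinWord t) /\
    pole (fword (perturb (psi x) Phi) s) = pole (fword (perturb (psi x) Phi) t).
  apply: contrapT => hn; apply: hbad; split=> // s t hZ hst.
  by apply: hn; exists s, t.
have e0 : peval (e (s, t)) (psi x) = 0 by apply/he.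
have [w hw] := exists_separating_translation d0 hO hS hA hc.
have e1 : peval (e (s, t)) (translate (psi x) w 1) != 0.
  apply/eqP => /he h; apply: (hw s t hZ); apply: h; exact: translate_AsetN.
have [b [ik [hb hik]]] := exists_transversal_jet e0 e1.
exists ((s, t), b) => //; split=> //.
exact: (chart_regular m0 oV Vx hopen (hC 1%N) (imm x ^~ Vx) hik).
Qed.

Lemma idtuple_AsetN : AsetN (@idtuple R d N).
Proof. by move=> i; split; [exact: ltr01|exact: orthogonal1|rewrite det1]. Qed.

Lemma nbhs_translate (alpha : AN) w (A : set AN) : nbhs alpha A ->
  nbhs (0 : R) [set t | A (translate alpha w t)].
Proof. by move=> hA; apply: (@translate_continuous R d N alpha w). Qed.

(** On the line from the identity tuple to a separating one, each pair in Z gives a polynomial that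
    is nonzero because it does not vanish at t = 1. A small t > 0 avoiding all roots separates all
    poles and stays close in [d2]. *)
Lemma GTfin_dense Phi Omega (Omega' : set 'rV[R]_d) (eps : R) :
  (0 < d)%N -> domain Omega -> bounded_set Omega -> closure Omega `<=` Omega' ->
  Sstar Omega Omega' Phi -> 0 < eps ->
  exists2 Psi, GTfin Omega Omega' Psi & (d2 Omega Phi Psi < eps%:E)%E.
Proof.
move=> d0 [ne0 oO _] hb hsub hS eps0; have hPhi := hS.1.
have nf i := cifs_nform i hPhi.
have [e he] := pole_polynomials nf.
have hNN := nbhs_perturb_cifs d0 oO hb hsub hPhi.
have eps2 : 0 < eps / 2 by rewrite divr_gt0.
pose D : set AN := [set alpha | (d2 Omega (perturb alpha Phi) Phi <= (eps / 2)%:E)%E].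
have hd2 : nbhs (@idtuple R d N) D := near_perturb_d2 hb hsub hPhi eps2.
have idA := idtuple_AsetN.
have [_ hid] : AsetN (@idtuple R d N) /\ cifs Omega Omega' (perturb (@idtuple R d N) Phi).
  by have := nbhs_singleton hNN; apply.
have [w hw] := exists_separating_translation d0 ne0 hS idA hid.
pose good (t : R) := cifs Omega Omega' (perturb (translate (@idtuple R d N) w t) Phi) /\
  D (translate (@idtuple R d N) w t).
have : nbhs (0 : R) [set t | good t].
  have h1 : nbhs (0 : R) [set t | AsetN (translate (@idtuple R d N) w t) ->
      AsetN (translate (@idtuple R d N) w t) /\
      cifs Omega Omega' (perturb (translate (@idtuple R d N) w t) Phi)].
    exact: nbhs_translate hNN.
  have h2 : nbhs (0 : R) [set t | D (translate (@idtuple R d N) w t)].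
    exact: nbhs_translate hd2.
  apply: filterS2 h1 h2 => t h1 h2; split; last exact: h2.
  by have [] := h1 (translate_AsetN w t idA).
move=> /nbhs_ballP[r /= r0 hr].
(* Reflecting membership in Z into a boolean makes the pairs a countable subtype. *)
pose Z := {st : seq 'I_N * seq 'I_N | `[< Zpairs (FinWord st.1, FinWord st.2) >]}.
pose p (st : Z) := line_poly (@idtuple R d N) w (e (val st)).
have p0 st : p st != 0.
  have /asboolP hZ := valP st; apply/eqP => p0; apply: (hw _ _ hZ).
  apply/(he (val st)); first exact: translate_AsetN.
  by rewrite -line_polyE -/(p st) p0 horner0.
have [t /andP[t0 tr] ht] := exists_common_nonroot r0 p0.
have [g1 g2] : good t by apply: hr; rewrite -ball_normE /= sub0r normrN gtr0_norm.
exists (perturb (translate (@idtuple R d N) w t) Phi).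
  split=> // s s' hZ hss'.
  have hZ' : `[< Zpairs (FinWord (s, s').1, FinWord (s, s').2) >] by apply/asboolP.
  have /negP := ht (exist _ (s, s') hZ'); apply.
  apply/eqP; rewrite /p line_polyE /=; apply/he => //; exact: translate_AsetN.
rewrite d2C; apply: le_lt_trans g2 _.
by rewrite lte_fin ltr_pdivrMr // ltr_pMr // ltr1n.
Qed.

End Assembly.

Theorem proposition11p13 (R : realType) (d N : nat)
    (hd : (3 <= d)%N) (hN : (2 <= N)%N)
    (Omega Omega' : set 'rV[R]_d)
    (hOmega : domain Omega) (hbounded : bounded_set Omega)
    (hOmega' : domain Omega') (hsub : closure Omega `<=` Omega') :
  [/\ @GT R d N Omega Omega' `<=` @GTfin R d N Omega Omega',
      @GTfin R d N Omega Omega' `<=` @Sstar R d N Omega Omega',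
      (* S* is open in (S, d2) *)
      forall Phi, @Sstar R d N Omega Omega' Phi ->
        exists2 eps : R, 0 < eps &
          forall Psi, cifs Omega Omega' Psi ->
            (d2 Omega Phi Psi < eps%:E)%E -> Sstar Omega Omega' Psi,
      (* GTfin is dense in S* *)
      forall Phi, @Sstar R d N Omega Omega' Phi ->
        forall eps : R, 0 < eps ->
          exists2 Psi, GTfin Omega Omega' Psi & (d2 Omega Phi Psi < eps%:E)%E
    & forall Phi, @Sstar R d N Omega Omega' Phi ->
        exists NN : set (afftuple R d N),
          [/\ NN `<=` @AsetN R d N /\ nbhs_id NN,
              forall alpha, NN alpha -> Sstar Omega Omega' (perturb alpha Phi),
              d2 Omega (perturb alpha Phi) Phi @[alpha --> @nbhs_id R d N]
                --> 0%E
            & null_in_charts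
                [set alpha | NN alpha /\
                             ~ GTfin Omega Omega' (perturb alpha Phi)]]].
Proof.
have d0 : (0 < d)%N by exact: leq_trans hd.
have N0 : (0 < N)%N by exact: leq_trans hN.
have [ne0 oO _] := hOmega.
split.
- exact: GT_subset_GTfin.
- exact: GTfin_subset_Sstar.
- by move=> Phi; exact: Sstar_open.
- by move=> Phi hPhi eps; exact: GTfin_dense.
move=> Phi hS; have [hPhi hp] := hS.
(* Similarities on the left do not move poles, so distinctness of the poles is inherited and only
   membership in the class of systems has to be imposed. *)
exists [set alpha | AsetN alpha /\ cifs Omega Omega' (perturb alpha Phi)]; split.
- split; first by move=> alpha [].
  exact: nbhs_perturb_cifs.
- move=> alpha [hA hc]; split=> // i j ij.
  have nf k := cifs_nform k hPhi.
  by rewrite /perturb !pole_similarity_comp //; exact: hp.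
- exact: perturb_cvg hbounded hsub hPhi.
- exact: bad_null_in_charts.
Qed.
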